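(* The family $\{M_{0,\beta}\}_{\beta\in[0,1]}$ is a filtration of $\mathcal{G}$ such that $M_{0,1}=S^*\left(\frac12\right)\subsetneq\mathcal{G}$ and, for every $\beta\in[0,1]$, $$\sup_{f\in M_{0,\beta}}|\Phi(f,\lambda)|=\max\left(\frac{2-\beta}{6-4\beta},\,|1-\lambda|\right)\quad\text{for all }\lambda\in\mathbb{C}.$$
   Context: $\mathbb{D}$ is the open unit disk in $\mathbb{C}$. $\mathcal{A}$ is the set of holomorphic functions $f:\mathbb{D}\to\mathbb{C}$ with $f(0)=0$, $f'(0)=1$. $\mathcal{G}$ is the set of $f\in\mathcal{A}$ with $\operatorname{Re}\frac{f(z)}{z}>0$ for all $z\in\mathbb{D}$. $S^*\left(\frac12\right)$ is the set of $f\in\mathcal{A}$ with $\operatorname{Re}\frac{zf'(z)}{f(z)}>\frac12$ for all $z\in\mathbb{D}$. A filtration of $\mathcal{G}$ is a family $\{\mathfrak{F}_s\}_{s\in[a,b]}$ of subsets $\mathfrak{F}_s\subseteq\mathcal{G}$, with $a,b\in[-\infty,+\infty]$, $a<b$, such that $\mathfrak{F}_s\subseteq\mathfrak{F}_t$ whenever $a\le s\le t\le b$. For $f(z)=z+\sum_{k\ge2}f_kz^k\in\mathcal{A}$ and $\lambda\in\mathbb{C}$, $\Phi(f,\lambda)=f_3-\lambda f_2^2$. For real $\beta$, $$M_{0,\beta}=\left\{f\in\mathcal{A}:\ \operatorname{Re}\left[\beta\frac{zf'(z)}{f(z)}+(1-\beta)\left(1+\frac{zf''(z)}{f'(z)}\right)\right]>\frac{\beta}{2}\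 \text{ for all } z\in\mathbb{D}\right\},$$ where $zf'(z)/f(z)$ has value $1$ at $z=0$, a term with zero coefficient is omitted, and the expression is required to be well defined on $\mathbb{D}$: $f(z)\ne0$ for $z\in\mathbb{D}\setminus\{0\}$ if $\beta\neq0$, and $f'(z)\ne0$ on $\mathbb{D}$ if $\beta\ne1$. *)

(* Defs.v *)
From Stdlib Require Import Reals Ensembles Factorial.
From Coquelicot Require Import Coquelicot.

Open Scope R_scope.

(* Functions on the unit disk are represented by total functions [C -> C].
   Every predicate below depends only on the values of its argument on the
   open disk, so the values elsewhere are irrelevant. *)
Definition unit_disk (z : C) : Prop := Cmod z < 1.

Definition holomorphic_on_disk (f : C -> C) : Prop :=
  forall z : C, unit_disk z ->
    ex_derive (K := C_AbsRing) (V := C_NormedModule) f z.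

(* Coquelicot's [C_derive] takes the limit of the difference quotient along the
   real direction; it is the complex derivative wherever the function is complex
   differentiable, in particular at every order on the disk for a holomorphic
   function. *)
Definition C_derive_n (f : C -> C) (n : nat) : C -> C := Nat.iter n C_derive f.

Definition taylor_coef (f : C -> C) (k : nat) : C :=
  Cdiv (C_derive_n f k (RtoC 0)) (RtoC (INR (fact k))).

Definition class_A : Ensemble (C -> C) := fun f =>
  holomorphic_on_disk f /\ f (RtoC 0) = RtoC 0 /\
  C_derive f (RtoC 0) = RtoC 1.

(* f(z)/z, extended by its limit f'(0) = 1 at z = 0. *)
Definition quot_id (f : C -> C) (z : C) : C :=
  if Ceq_dec z (RtoC 0) then RtoC 1 else Cdiv (f z) z.

(* z f'(z)/f(z), with value 1 at z = 0. *)
Definition star_quot (f : C -> C) (z : C) : C :=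
  if Ceq_dec z (RtoC 0) then RtoC 1
  else Cdiv (Cmult z (C_derive f z)) (f z).

Definition convex_quot (f : C -> C) (z : C) : C :=
  Cplus (RtoC 1) (Cdiv (Cmult z (C_derive_n f 2 z)) (C_derive f z)).

Definition nonzero_off_origin (f : C -> C) : Prop :=
  forall z : C, unit_disk z -> z <> RtoC 0 -> f z <> RtoC 0.

Definition derive_nonzero (f : C -> C) : Prop :=
  forall z : C, unit_disk z -> C_derive f z <> RtoC 0.

Definition class_G : Ensemble (C -> C) := fun f =>
  class_A f /\ forall z : C, unit_disk z -> Re (quot_id f z) > 0.

Definition starlike_half : Ensemble (C -> C) := fun f =>
  class_A f /\ nonzero_off_origin f /\
  forall z : C, unit_disk z -> Re (star_quot f z) > 1 / 2.

(* Division in [C] is total, so a term with zero coefficient contributes 0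
   even where its denominator vanishes. *)
Definition M0 (beta : R) : Ensemble (C -> C) := fun f =>
  class_A f /\
  (beta <> 0 -> nonzero_off_origin f) /\
  (beta <> 1 -> derive_nonzero f) /\
  forall z : C, unit_disk z ->
    Re (Cplus (Cmult (RtoC beta) (star_quot f z))
              (Cmult (RtoC (1 - beta)) (convex_quot f z))) > beta / 2.

(* Only the members of [F] with index in [a, b] matter. *)
Definition filtration_of_G (a b : Rbar) (F : Rbar -> Ensemble (C -> C)) : Prop :=
  Rbar_lt a b /\
  (forall s : Rbar, Rbar_le a s -> Rbar_le s b -> Included _ (F s) class_G) /\
  (forall s t : Rbar, Rbar_le a s -> Rbar_le s t -> Rbar_le t b ->
     Included _ (F s) (F t)).

Definition Phi (f : C -> C) (lambda : C) : C :=
  Cminus (taylor_coef f 3)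
         (Cmult lambda (Cmult (taylor_coef f 2) (taylor_coef f 2))).

(* Main.v *)
Require Import Defs.
From Stdlib Require Import Reals Ensembles Lra Lia Classical ClassicalEpsilon Factorial.
From Coquelicot Require Import Coquelicot.
Open Scope R_scope.

(** Write [g = z f' / f]. Then [1 + z f'' / f' = g + z g' / g], and the class with parameter
    [beta] is described by [Re (g + (1 - beta) z g' / g) > beta / 2].

    The inclusions come from Jack's lemma ([jack]): if [omega] is holomorphic,
    [omega 0 = 0] and [|omega|] reaches [1], then at some point where [|omega| >= 1] the
    quotient [z omega' / omega] is a real number [k >= 1]. Applied to [omega = 1 - 1 / g] it
    gives [Re g > 1 / 2] on every class, so that the classes lie in S^*(1/2)
    ([M0_included_starlike_half]); then the condition for a larger parameter is a convex
    combination of the given condition and of [Re g > 1 / 2] ([M0_monotone]). Applied to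
    [omega = 1 - z / f] it gives [Re (f / z) > 1 / 2] on S^*(1/2)
    ([starlike_half_included_G]). The polynomial [z + z^2] shows that the last inclusion
    is strict.

    For the functional, normalise the defining expression to a self-map [z phi] of
    the disk, with [|phi| <= 1] by Schwarz's lemma. Comparing Taylor coefficients gives
    [Phi (f, lambda) = A phi'(0) + (1 - lambda) phi(0)^2] with
    [A = (2 - beta) / (6 - 4 beta)] ([M0_Phi_representation]), and the Schwarz-Pick inequality
    [|phi'(0)| <= 1 - |phi(0)|^2] yields the maximum of [A] and [|1 - lambda|]. Both values are
    attained: [|1 - lambda|] by [z / (1 - z)], where [phi = 1], and [A] by the function with
    [phi = z], found from a linear differential equation, which [1 - 1 / g] solves as a power
    series with nonnegative coefficients ([M0_extremal_first], [M0_extremal_second]).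

    The function theory behind this rests on Goursat's theorem for rectangles
    ([goursat_rectangle]). In logarithmic coordinates it says that the integral of a
    holomorphic function over concentric circles does not depend on the radius. This gives
    Cauchy's formula on circles around the origin, which in turn gives the maximum modulus
    principle and the Taylor expansion on the disk. *)

Notation is_Cderive f z l :=
  (is_derive (K := C_AbsRing) (V := C_NormedModule) f z l).
Notation ex_Cderive f z :=
  (ex_derive (K := C_AbsRing) (V := C_NormedModule) f z).
Notation CRInt := (RInt (V := C_R_CompleteNormedModule)).
Notation ex_CRInt := (ex_RInt (V := C_R_CompleteNormedModule)).

(** * Complex derivatives *)

(** The epsilon-delta form of complex differentiability. Estimates are done on
    this form, and it does not depend on which of the equivalent uniform
    structures the complex numbers carry. *)
Definition affine_approx (f : C -> C) (z l : C) : Prop :=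
  forall eps, 0 < eps -> exists delta, 0 < delta /\
    forall w, Cmod (w - z) < delta ->
      Cmod (f w - f z - (w - z) * l) <= eps * Cmod (w - z).

Lemma is_Cderive_iff (f : C -> C) (z l : C) :
  is_Cderive f z l <-> affine_approx f z l.
Proof.
  split.
  - intros [_ H] eps He.
    destruct (H z (fun P HP => HP) (mkposreal eps He)) as [d Hd].
    exists d; split; [apply cond_pos|]. intros w Hw. apply (Hd w Hw).
  - intros H. split.
    + apply (is_linear_scal_l (K := C_AbsRing) (V := C_NormedModule)).
    + intros x Hx.
      assert (z = x) as <-.
      { apply (is_filter_lim_locally_unique (K := C_AbsRing)
                 (V := AbsRing_NormedModule C_AbsRing)). exact Hx. }
      intros [eps He]. destruct (H eps He) as [d [Hd Hd2]].
      exists (mkposreal d Hd). intros w Hw. apply (Hd2 w Hw).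
Qed.

(** The normed module [C_NormedModule] and the field regarded as a module
    over itself have different, though equivalent, neighbourhoods. The general
    product and chain rules speak of the latter, so they are transported
    through this equivalence. *)
Lemma is_Cderive_AbsRing (f : C -> C) (z l : C) :
  is_Cderive f z l <->
  is_derive (K := C_AbsRing) (V := AbsRing_NormedModule C_AbsRing) f z l.
Proof.
  rewrite is_Cderive_iff. split.
  - intros H. split.
    + apply (is_linear_scal_l (K := C_AbsRing)
               (V := AbsRing_NormedModule C_AbsRing)).
    + intros x Hx.
      assert (z = x) as <-.
      { apply (is_filter_lim_locally_unique (K := C_AbsRing)
                 (V := AbsRing_NormedModule C_AbsRing)). exact Hx. }
      intros [eps He]. destruct (H eps He) as [d [Hd Hd2]].
      exists (mkposreal d Hd). intros w Hw. apply (Hd2 w Hw).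
  - intros [_ H] eps He.
    destruct (H z (fun P HP => HP) (mkposreal eps He)) as [d Hd].
    exists d; split; [apply cond_pos|]. intros w Hw. apply (Hd w Hw).
Qed.

Lemma is_Cderive_eq (f : C -> C) (z l l' : C) :
  is_Cderive f z l -> l = l' -> is_Cderive f z l'.
Proof. now intros H <-. Qed.

Lemma is_Cderive_const (c z : C) : is_Cderive (fun _ => c) z (RtoC 0).
Proof. apply (is_derive_const (K := C_AbsRing) (V := C_NormedModule) c z). Qed.

Lemma is_Cderive_id (z : C) : is_Cderive (fun w => w) z (RtoC 1).
Proof. apply is_Cderive_AbsRing, (is_derive_id (K := C_AbsRing) z). Qed.

Lemma is_Cderive_plus (f g : C -> C) (z df dg : C) :
  is_Cderive f z df -> is_Cderive g z dg ->
  is_Cderive (fun w => f w + g w)%C z (df + dg)%C.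
Proof. apply (is_derive_plus (K := C_AbsRing) (V := C_NormedModule) f g z). Qed.

Lemma is_Cderive_minus (f g : C -> C) (z df dg : C) :
  is_Cderive f z df -> is_Cderive g z dg ->
  is_Cderive (fun w => f w - g w)%C z (df - dg)%C.
Proof. apply (is_derive_minus (K := C_AbsRing) (V := C_NormedModule) f g z). Qed.

Lemma is_Cderive_mult (f g : C -> C) (z df dg : C) :
  is_Cderive f z df -> is_Cderive g z dg ->
  is_Cderive (fun w => f w * g w)%C z (df * g z + f z * dg)%C.
Proof.
  rewrite !is_Cderive_AbsRing. intros Hf Hg.
  apply (is_derive_mult (K := C_AbsRing) f g z df dg Hf Hg). apply Cmult_comm.
Qed.

Lemma is_Cderive_comp (f g : C -> C) (z df dg : C) :
  is_Cderive f (g z) df -> is_Cderive g z dg ->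
  is_Cderive (fun w => f (g w)) z (dg * df)%C.
Proof.
  rewrite (is_Cderive_AbsRing g). intros Hf Hg.
  apply (is_derive_comp (K := C_AbsRing) (V := C_NormedModule) f g z df dg Hf Hg).
Qed.

Lemma Cmod_triangle_minus (x y : C) : Cmod x - Cmod y <= Cmod (x - y).
Proof.
  generalize (Cmod_triangle (x - y) y).
  replace (x - y + y)%C with x by ring. lra.
Qed.

Lemma Cmod_minus_sym (x y : C) : Cmod (x - y) = Cmod (y - x).
Proof. rewrite <- Cmod_opp. f_equal. ring. Qed.

Lemma is_Cderive_inv_id (z : C) :
  z <> RtoC 0 -> is_Cderive Cinv z (- / (z * z))%C.
Proof.
  intros Hz. apply is_Cderive_iff. intros eps He.
  assert (Hm := proj1 (Cmod_gt_0 z) Hz). set (m := Cmod z) in *.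
  assert (Hm3 : 0 < m * m * m) by (repeat apply Rmult_lt_0_compat; lra).
  exists (Rmin (m / 2) (eps * (m * m * m) / 2)). split.
  { apply Rmin_pos; [lra|]. apply Rdiv_lt_0_compat; [|lra]. nra. }
  intros w Hw.
  assert (H1 := Rlt_le_trans _ _ _ Hw (Rmin_l _ _)).
  assert (H2 := Rlt_le_trans _ _ _ Hw (Rmin_r _ _)).
  assert (Hwm : m / 2 < Cmod w).
  { generalize (Cmod_triangle_minus z w). rewrite Cmod_minus_sym. fold m. lra. }
  assert (Hw0 : w <> RtoC 0) by (apply Cmod_gt_0; lra).
  replace (/ w - / z - (w - z) * - / (z * z))%C
    with ((w - z) * (w - z) * / (w * (z * z)))%C by (field; tauto).
  rewrite !Cmod_mult, Cmod_inv, !Cmod_mult by (repeat apply Cmult_neq_0; auto).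
  fold m. set (d := Cmod (w - z)) in *.
  assert (0 <= d) by apply Cmod_ge_0.
  assert (/ (Cmod w * (m * m)) <= / (m / 2 * (m * m))).
  { apply Rinv_le_contravar. apply Rmult_lt_0_compat; nra. nra. }
  apply Rle_trans with (d * d * / (m / 2 * (m * m))).
  { apply Rmult_le_compat_l; nra. }
  replace (d * d * / (m / 2 * (m * m))) with ((d * 2 / (m * m * m)) * d)
    by (field; lra).
  apply Rmult_le_compat_r; [lra|].
  apply Rle_div_l; [lra|]. lra.
Qed.

Lemma is_Cderive_inv (f : C -> C) (z df : C) :
  is_Cderive f z df -> f z <> RtoC 0 ->
  is_Cderive (fun w => / f w)%C z (- df / (f z * f z))%C.
Proof.
  intros Hf Hz. eapply is_Cderive_eq.
  - apply (is_Cderive_comp Cinv f); [apply is_Cderive_inv_id, Hz | exact Hf].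
  - field. exact Hz.
Qed.

Lemma is_Cderive_div (f g : C -> C) (z df dg : C) :
  is_Cderive f z df -> is_Cderive g z dg -> g z <> RtoC 0 ->
  is_Cderive (fun w => f w / g w)%C z ((df * g z - f z * dg) / (g z * g z))%C.
Proof.
  intros Hf Hg Hz. eapply is_Cderive_eq.
  - apply (is_Cderive_mult f (fun w => / g w)%C); [exact Hf|].
    apply is_Cderive_inv; eassumption.
  - field. exact Hz.
Qed.

Lemma is_Cderive_ext_ball (f g : C -> C) (z l : C) (r : R) :
  0 < r -> (forall w, Cmod (w - z) < r -> f w = g w) ->
  is_Cderive f z l -> is_Cderive g z l.
Proof.
  rewrite !is_Cderive_iff. intros Hr He H eps Heps.
  destruct (H eps Heps) as [d [Hd H']].
  exists (Rmin d r). split; [now apply Rmin_pos|]. intros w Hw.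
  assert (H1 := Rlt_le_trans _ _ _ Hw (Rmin_l _ _)).
  assert (H2 := Rlt_le_trans _ _ _ Hw (Rmin_r _ _)).
  rewrite <- !He; auto. replace (z - z)%C with (RtoC 0) by ring.
  rewrite Cmod_0. lra.
Qed.

Definition Ccontinuous (f : C -> C) (z : C) : Prop :=
  forall eps, 0 < eps -> exists delta, 0 < delta /\
    forall w, Cmod (w - z) < delta -> Cmod (f w - f z) < eps.

Lemma is_Cderive_continuous (f : C -> C) (z l : C) :
  is_Cderive f z l -> Ccontinuous f z.
Proof.
  intros H eps He. apply is_Cderive_iff in H.
  destruct (H 1 Rlt_0_1) as [d [Hd H']].
  set (k := 1 + Cmod l). assert (0 <= Cmod l) by apply Cmod_ge_0.
  exists (Rmin d (eps / k)). split.
  { apply Rmin_pos; [lra|]. apply Rdiv_lt_0_compat; unfold k; lra. }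
  intros w Hw.
  assert (H1 := Rlt_le_trans _ _ _ Hw (Rmin_l _ _)).
  assert (H2 := Rlt_le_trans _ _ _ Hw (Rmin_r _ _)).
  specialize (H' w H1).
  replace (f w - f z)%C with ((f w - f z - (w - z) * l) + (w - z) * l)%C by ring.
  apply Rle_lt_trans with (1 := Cmod_triangle _ _). rewrite Cmod_mult.
  apply Rlt_div_r in H2; unfold k in *; lra.
Qed.

(** * Integrals of complex functions of a real variable *)

Definition RCcontinuous (f : R -> C) (t : R) : Prop :=
  forall eps, 0 < eps -> exists delta, 0 < delta /\
    forall u, Rabs (u - t) < delta -> Cmod (f u - f t) < eps.

Lemma RCcontinuous_continuous (f : R -> C) (t : R) :
  RCcontinuous f t -> continuous (U := C_R_CompleteNormedModule) f t.
Proof.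
  intros H P [eps HP]. destruct (H eps (cond_pos eps)) as [d [Hd H']].
  exists (mkposreal d Hd). intros u Hu. apply HP.
  apply C_NormedModule_mixin_compat1. apply H', Hu.
Qed.

Lemma RCcontinuous_comp (f : C -> C) (g : R -> C) (t : R) :
  Ccontinuous f (g t) -> RCcontinuous g t -> RCcontinuous (fun u => f (g u)) t.
Proof.
  intros Hf Hg eps He. destruct (Hf eps He) as [d [Hd H]].
  destruct (Hg d Hd) as [d' [Hd' H']]. exists d'. split; auto.
Qed.

Lemma ex_CRInt_continuous (f : R -> C) (a b : R) :
  a <= b -> (forall t, a <= t <= b -> RCcontinuous f t) -> ex_CRInt f a b.
Proof.
  intros Hab H. apply (ex_RInt_continuous (V := C_R_CompleteNormedModule)).
  rewrite Rmin_left, Rmax_right by lra. intros t Ht.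
  apply RCcontinuous_continuous, H, Ht.
Qed.

Lemma C_R_norm (x : C) : norm (V := C_R_NormedModule) x = Cmod x.
Proof.
  change (sqrt (Rabs (fst x) ^ 2 + Rabs (snd x) ^ 2) = Cmod x).
  unfold Cmod. now rewrite !pow2_abs.
Qed.

Lemma Cmod_CRInt_le (f : R -> C) (a b M : R) :
  a <= b -> ex_CRInt f a b -> (forall t, a <= t <= b -> Cmod (f t) <= M) ->
  Cmod (CRInt f a b) <= (b - a) * M.
Proof.
  intros Hab Hex HM. rewrite <- C_R_norm.
  assert (HM' : forall t, a <= t <= b -> norm (V := C_R_NormedModule) (f t) <= M)
    by (intros t Ht; rewrite C_R_norm; auto).
  apply (norm_RInt_le_const (V := C_R_NormedModule) f a b _ M Hab HM').
  apply (RInt_correct (V := C_R_CompleteNormedModule)), Hex.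
Qed.

Lemma is_CRInt_Cmult (f : R -> C) (a b : R) (c l : C) :
  is_RInt (V := C_R_NormedModule) f a b l ->
  is_RInt (V := C_R_NormedModule) (fun t => c * f t)%C a b (c * l)%C.
Proof.
  intros H.
  assert (H1 := is_RInt_fct_extend_fst (U := R_NormedModule)
                  (V := R_NormedModule) f a b l H).
  assert (H2 := is_RInt_fct_extend_snd (U := R_NormedModule)
                  (V := R_NormedModule) f a b l H).
  apply (is_RInt_fct_extend_pair (U := R_NormedModule) (V := R_NormedModule)
           (fun t => c * f t)%C a b).
  - apply (is_RInt_minus (V := R_NormedModule));
      apply (is_RInt_scal (V := R_NormedModule)); assumption.
  - apply (is_RInt_plus (V := R_NormedModule));
      apply (is_RInt_scal (V := R_NormedModule)); assumption.
Qed.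

Lemma CRInt_Cmult (f : R -> C) (a b : R) (c : C) :
  ex_CRInt f a b -> CRInt (fun t => c * f t)%C a b = (c * CRInt f a b)%C.
Proof.
  intros H. apply (is_RInt_unique (V := C_R_CompleteNormedModule)).
  apply is_CRInt_Cmult, (RInt_correct (V := C_R_CompleteNormedModule)), H.
Qed.

Lemma CRInt_minus (f g : R -> C) (a b : R) :
  ex_CRInt f a b -> ex_CRInt g a b ->
  CRInt (fun t => f t - g t)%C a b = (CRInt f a b - CRInt g a b)%C.
Proof. apply (RInt_minus (V := C_R_CompleteNormedModule)). Qed.

Lemma ex_CRInt_minus (f g : R -> C) (a b : R) :
  ex_CRInt f a b -> ex_CRInt g a b -> ex_CRInt (fun t => f t - g t)%C a b.
Proof. apply (ex_RInt_minus (V := C_R_CompleteNormedModule)). Qed.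

Lemma CRInt_Chasles (f : R -> C) (a b c : R) :
  ex_CRInt f a b -> ex_CRInt f b c ->
  (CRInt f a b + CRInt f b c)%C = CRInt f a c.
Proof. apply (RInt_Chasles (V := C_R_CompleteNormedModule)). Qed.

Lemma CRInt_const (a b : R) (c : C) :
  CRInt (fun _ => c) a b = (RtoC (b - a) * c)%C.
Proof.
  etransitivity. apply (RInt_const (V := C_R_CompleteNormedModule)).
  apply scal_R_Cmult.
Qed.

Lemma CRInt_ext (f g : R -> C) (a b : R) :
  a <= b -> (forall t, a <= t <= b -> f t = g t) -> CRInt f a b = CRInt g a b.
Proof.
  intros Hab H. apply (RInt_ext (V := C_R_CompleteNormedModule)).
  rewrite Rmin_left, Rmax_right by lra. intros t Ht. apply H. lra.
Qed.

(** Differentiability of a curve in the plane, in the form in which it follows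
    from [affine_approx] along a line. *)
Definition RCderive (g : R -> C) (t : R) (l : C) : Prop :=
  forall eps, 0 < eps -> exists delta, 0 < delta /\ forall u, Rabs (u - t) < delta ->
      Cmod (g u - g t - RtoC (u - t) * l) <= eps * Rabs (u - t).

Lemma RCderive_is_derive (g : R -> C) (t : R) (l : C) :
  RCderive g t l -> is_derive (K := R_AbsRing) (V := C_R_NormedModule) g t l.
Proof.
  intros H. split.
  - apply (is_linear_scal_l (K := R_AbsRing) (V := C_R_NormedModule)).
  - intros x Hx.
    assert (t = x) as <-.
    { apply (is_filter_lim_locally_unique (K := R_AbsRing)
               (V := R_NormedModule)). exact Hx. }
    intros [eps He]. destruct (H eps He) as [d [Hd Hd2]].
    exists (mkposreal d Hd). intros w Hw. rewrite C_R_norm.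
    rewrite scal_R_Cmult. apply (Hd2 w Hw).
Qed.

(** The fundamental theorem of calculus for curves in the plane; in the proof of
    Goursat's theorem it disposes of the affine part of the integrand. *)
Lemma CRInt_antiderivative (g dg : R -> C) (a b : R) :
  a <= b -> (forall t, a <= t <= b -> RCderive g t (dg t)) ->
  (forall t, a <= t <= b -> RCcontinuous dg t) ->
  CRInt dg a b = (g b - g a)%C.
Proof.
  intros Hab Hd Hc. apply (is_RInt_unique (V := C_R_CompleteNormedModule)).
  apply (is_RInt_derive (V := C_R_CompleteNormedModule));
    rewrite Rmin_left, Rmax_right by lra; intros t Ht.
  - now apply RCderive_is_derive, Hd.
  - now apply RCcontinuous_continuous, Hc.
Qed.

Lemma RCderive_line (f : C -> C) (p v l : C) (t : R) :
  is_Cderive f (p + RtoC t * v)%C l ->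
  RCderive (fun u => f (p + RtoC u * v)%C) t (v * l)%C.
Proof.
  intros H eps He. apply is_Cderive_iff in H.
  assert (Hv := Cmod_ge_0 v). set (m := Cmod v) in *.
  assert (0 < m + 1) by lra.
  destruct (H (eps / (m + 1))) as [d [Hd H']].
  { apply Rdiv_lt_0_compat; lra. }
  exists (d / (m + 1)). split. { apply Rdiv_lt_0_compat; lra. }
  intros u Hu.
  assert (E : (p + RtoC u * v - (p + RtoC t * v) = RtoC (u - t) * v)%C)
    by (rewrite RtoC_minus; ring).
  assert (Hn : Cmod (p + RtoC u * v - (p + RtoC t * v))%C = Rabs (u - t) * m)
    by now rewrite E, Cmod_mult, Cmod_R.
  assert (Hab := Rabs_pos (u - t)).
  apply Rlt_div_r in Hu; [|lra].
  eapply Rle_trans; [eapply Rle_trans; [|apply (H' (p + RtoC u * v)%C)]|].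
  - rewrite E. right. f_equal. ring.
  - rewrite Hn. nra.
  - rewrite Hn. apply Rle_trans with (eps / (m + 1) * (Rabs (u - t) * (m + 1))).
    + apply Rmult_le_compat_l; [|nra]. apply Rlt_le, Rdiv_lt_0_compat; lra.
    + right. field. lra.
Qed.

Lemma RCcontinuous_line (f : C -> C) (p v : C) (t : R) :
  Ccontinuous f (p + RtoC t * v)%C ->
  RCcontinuous (fun u => f (p + RtoC u * v)%C) t.
Proof.
  intros H eps He. destruct (H eps He) as [d [Hd H']].
  assert (Hv := Cmod_ge_0 v). exists (d / (Cmod v + 1)). split.
  { apply Rdiv_lt_0_compat; lra. }
  intros u Hu. apply H'.
  replace (p + RtoC u * v - (p + RtoC t * v))%C with (RtoC (u - t) * v)%C
    by (rewrite RtoC_minus; ring).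
  rewrite Cmod_mult, Cmod_R. assert (Hab := Rabs_pos (u - t)).
  apply Rlt_div_r in Hu; nra.
Qed.

(** * Goursat's theorem for rectangles *)

(** The integral along the segment from [p] to [p + h v] with respect to the
    real parameter; the factor [v] of the complex line element is put in by
    [boundary_int]. *)
Definition side (f : C -> C) (p v : C) (h : R) : C :=
  CRInt (fun u => f (p + RtoC u * v)%C) 0 h.

(** The contour integral around the rectangle with lower left corner [p], width
    [a] and height [b], counterclockwise. *)
Definition boundary_int (f : C -> C) (p : C) (a b : R) : C :=
  (side f p (RtoC 1) a + Ci * side f (p + RtoC a) Ci b
   - side f (p + RtoC b * Ci) (RtoC 1) a - Ci * side f p Ci b)%C.

Definition in_rect (p : C) (a b : R) (z : C) : Prop :=
  Re p <= Re z <= Re p + a /\ Im p <= Im z <= Im p + b.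

Definition continuous_on_side (f : C -> C) (p v : C) (h : R) : Prop :=
  forall u, 0 <= u <= h -> Ccontinuous f (p + RtoC u * v)%C.

Lemma ex_side (f : C -> C) (p v : C) (h : R) :
  0 <= h -> continuous_on_side f p v h ->
  ex_CRInt (fun u => f (p + RtoC u * v)%C) 0 h.
Proof.
  intros Hh Hc. apply ex_CRInt_continuous; [exact Hh|].
  intros t Ht. now apply RCcontinuous_line, Hc.
Qed.

Lemma side_halves (f : C -> C) (p v : C) (h : R) :
  0 <= h -> continuous_on_side f p v (2 * h) ->
  side f p v (2 * h) = (side f p v h + side f (p + RtoC h * v) v h)%C.
Proof.
  intros Hh Hc. unfold side.
  rewrite <- (CRInt_Chasles _ 0 h (2 * h)).
  - f_equal.
    assert (E := RInt_comp_lin (V := C_R_CompleteNormedModule)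
                   (fun u => f (p + RtoC u * v)%C) 1 h 0 h).
    replace (1 * 0 + h) with h in E by ring.
    replace (1 * h + h) with (2 * h) in E by ring.
    rewrite <- E.
    + apply CRInt_ext; [exact Hh|]. intros t Ht.
      rewrite scal_R_Cmult, Cmult_1_l. f_equal.
      rewrite Rmult_1_l, RtoC_plus. ring.
    + apply ex_CRInt_continuous; [lra|]. intros t Ht.
      apply RCcontinuous_line, Hc. lra.
  - apply ex_side; [exact Hh|]. intros t Ht. apply Hc. lra.
  - apply ex_CRInt_continuous; [lra|]. intros t Ht.
    apply RCcontinuous_line, Hc. lra.
Qed.

Lemma side_minus (f g : C -> C) (p v : C) (h : R) :
  0 <= h -> continuous_on_side f p v h -> continuous_on_side g p v h ->
  side (fun z => f z - g z)%C p v h = (side f p v h - side g p v h)%C.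
Proof. intros Hh Hf Hg. apply CRInt_minus; now apply ex_side. Qed.

Lemma side_bound (f : C -> C) (p v : C) (h M : R) :
  0 <= h -> continuous_on_side f p v h ->
  (forall u, 0 <= u <= h -> Cmod (f (p + RtoC u * v)%C) <= M) ->
  Cmod (side f p v h) <= h * M.
Proof.
  intros Hh Hc HM. rewrite <- (Rminus_0_r h) at 2.
  apply Cmod_CRInt_le; auto. now apply ex_side.
Qed.

Lemma side_antiderivative (F f : C -> C) (p v : C) (h : R) :
  0 <= h -> (forall z, is_Cderive F z (f z)) -> (forall z, Ccontinuous f z) ->
  (v * side f p v h = F (p + RtoC h * v) - F p)%C.
Proof.
  intros Hh HF Hf. unfold side.
  rewrite <- CRInt_Cmult by (apply ex_side; [exact Hh|intros u _; apply Hf]).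
  rewrite (CRInt_antiderivative (fun u => F (p + RtoC u * v)%C)).
  - f_equal. f_equal. f_equal. ring.
  - exact Hh.
  - intros t _. now apply RCderive_line.
  - intros t _. apply (RCcontinuous_line (fun z => v * f z)%C).
    intros eps He. assert (Hv := Cmod_ge_0 v).
    destruct (Hf (p + RtoC t * v)%C (eps / (Cmod v + 1))) as [d [Hd H]].
    { apply Rdiv_lt_0_compat; lra. }
    exists d. split; [exact Hd|]. intros w Hw. specialize (H w Hw).
    replace (v * f w - v * f (p + RtoC t * v))%C
      with (v * (f w - f (p + RtoC t * v)))%C by ring.
    rewrite Cmod_mult. apply Rlt_div_r in H; [|lra].
    assert (H0 := Cmod_ge_0 (f w - f (p + RtoC t * v))%C). nra.
Qed.

Lemma boundary_int_antiderivative (F f : C -> C) (p : C) (a b : R) :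
  0 <= a -> 0 <= b ->
  (forall z, is_Cderive F z (f z)) -> (forall z, Ccontinuous f z) ->
  boundary_int f p a b = RtoC 0.
Proof.
  intros Ha Hb HF Hf. unfold boundary_int.
  rewrite <- (Cmult_1_l (side f p (RtoC 1) a)).
  rewrite <- (Cmult_1_l (side f (p + RtoC b * Ci) (RtoC 1) a)).
  rewrite !(side_antiderivative F) by auto.
  replace (p + RtoC a * RtoC 1)%C with (p + RtoC a)%C by ring.
  replace (p + RtoC b * Ci + RtoC a * RtoC 1)%C with (p + RtoC a + RtoC b * Ci)%C
    by ring. ring.
Qed.

Lemma boundary_int_affine (c0 c1 p : C) (a b : R) :
  0 <= a -> 0 <= b -> boundary_int (fun z => c0 + c1 * z)%C p a b = RtoC 0.
Proof.
  intros Ha Hb.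
  assert (D : forall z, is_Cderive (fun z => c0 + c1 * z)%C z c1).
  { intros z. eapply is_Cderive_eq.
    - apply is_Cderive_plus; [apply is_Cderive_const|].
      apply is_Cderive_mult; [apply is_Cderive_const|apply is_Cderive_id].
    - cbv beta; ring. }
  apply (boundary_int_antiderivative (fun z => c0 * z + c1 * (z * z) / RtoC 2)%C);
    auto.
  - intros z. eapply is_Cderive_eq.
    + apply is_Cderive_plus.
      * apply is_Cderive_mult; [apply is_Cderive_const|apply is_Cderive_id].
      * apply (is_Cderive_mult (fun z => c1 * (z * z))%C (fun _ => / RtoC 2)%C);
          [|apply is_Cderive_const].
        apply is_Cderive_mult; [apply is_Cderive_const|].
        apply is_Cderive_mult; apply is_Cderive_id.
    + cbv beta; field.
  - intros z. eapply is_Cderive_continuous, D.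
Qed.

(** Hypotheses on a rectangle specialise to its four sides, in the
    parametrisation that [boundary_int] uses. *)
Lemma rect_sides (P : C -> Prop) (p : C) (a b : R) :
  0 <= a -> 0 <= b -> (forall z, in_rect p a b z -> P z) ->
  (forall u, 0 <= u <= a -> P (p + RtoC u * RtoC 1)%C) /\
  (forall u, 0 <= u <= b -> P (p + RtoC a + RtoC u * Ci)%C) /\
  (forall u, 0 <= u <= a -> P (p + RtoC b * Ci + RtoC u * RtoC 1)%C) /\
  (forall u, 0 <= u <= b -> P (p + RtoC u * Ci)%C).
Proof.
  intros Ha Hb H; repeat split; intros u Hu; apply H; unfold in_rect, Re, Im;
    simpl; lra.
Qed.

Lemma boundary_int_minus (f g : C -> C) (p : C) (a b : R) :
  0 <= a -> 0 <= b ->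
  (forall z, in_rect p a b z -> Ccontinuous f z) ->
  (forall z, in_rect p a b z -> Ccontinuous g z) ->
  boundary_int (fun z => f z - g z)%C p a b =
  (boundary_int f p a b - boundary_int g p a b)%C.
Proof.
  intros Ha Hb Hf Hg.
  destruct (rect_sides _ p a b Ha Hb Hf) as (F1 & F2 & F3 & F4).
  destruct (rect_sides _ p a b Ha Hb Hg) as (G1 & G2 & G3 & G4).
  unfold boundary_int. rewrite !side_minus; auto. ring.
Qed.

Lemma boundary_int_bound (f : C -> C) (p : C) (a b M : R) :
  0 <= a -> 0 <= b ->
  (forall z, in_rect p a b z -> Ccontinuous f z) ->
  (forall z, in_rect p a b z -> Cmod (f z) <= M) ->
  Cmod (boundary_int f p a b) <= 2 * (a + b) * M.
Proof.
  intros Ha Hb Hf HM.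
  destruct (rect_sides _ p a b Ha Hb Hf) as (F1 & F2 & F3 & F4).
  destruct (rect_sides _ p a b Ha Hb HM) as (G1 & G2 & G3 & G4).
  assert (B1 := side_bound f _ _ a M Ha F1 G1).
  assert (B2 := side_bound f _ _ b M Hb F2 G2).
  assert (B3 := side_bound f _ _ a M Ha F3 G3).
  assert (B4 := side_bound f _ _ b M Hb F4 G4).
  unfold boundary_int, Cminus.
  eapply Rle_trans; [apply Cmod_triangle|].
  eapply Rle_trans; [apply Rplus_le_compat_r, Cmod_triangle|].
  eapply Rle_trans; [apply Rplus_le_compat_r, Rplus_le_compat_r, Cmod_triangle|].
  rewrite !Cmod_opp, !Cmod_mult, Cmod_Ci. lra.
Qed.

(** The contour integrals of the four quarters add up, because the inner sides
    are run through twice in opposite directions. *)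
Lemma boundary_int_quarters (f : C -> C) (p : C) (a b : R) :
  0 <= a -> 0 <= b ->
  (forall z, in_rect p (2 * a) (2 * b) z -> Ccontinuous f z) ->
  boundary_int f p (2 * a) (2 * b) =
  (boundary_int f p a b + boundary_int f (p + RtoC a) a b
   + boundary_int f (p + RtoC b * Ci) a b
   + boundary_int f (p + RtoC a + RtoC b * Ci) a b)%C.
Proof.
  intros Ha Hb Hf. unfold boundary_int.
  assert (Ha2 : 0 <= 2 * a) by lra. assert (Hb2 : 0 <= 2 * b) by lra.
  destruct (rect_sides _ p _ _ Ha2 Hb2 Hf) as (F1 & F2 & F3 & F4).
  rewrite !side_halves by auto. rewrite !RtoC_mult.
  replace (p + RtoC a * RtoC 1)%C with (p + RtoC a)%C by ring.
  replace (p + RtoC 2 * RtoC a)%C with (p + RtoC a + RtoC a)%C by ring.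
  replace (p + RtoC 2 * RtoC b * Ci)%C with (p + RtoC b * Ci + RtoC b * Ci)%C by ring.
  replace (p + RtoC a + RtoC a + RtoC b * Ci)%C
    with (p + RtoC a + RtoC b * Ci + RtoC a)%C by ring.
  replace (p + RtoC b * Ci + RtoC b * Ci + RtoC a * RtoC 1)%C
    with (p + RtoC a + RtoC b * Ci + RtoC b * Ci)%C by ring.
  replace (p + RtoC b * Ci + RtoC a)%C with (p + RtoC a + RtoC b * Ci)%C by ring.
  ring.
Qed.

Lemma nested_intervals (x y : nat -> R) :
  (forall n, x n <= x (S n)) -> (forall n, y (S n) <= y n) ->
  (forall n, x n <= y n) -> exists c, forall n, x n <= c <= y n.
Proof.
  intros Hx Hy Hxy.
  assert (Mx : forall n k, x n <= x (n + k)%nat).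
  { intros n k; induction k; [rewrite Nat.add_0_r; lra|].
    rewrite Nat.add_succ_r. specialize (Hx (n + k)%nat). lra. }
  assert (My : forall n k, y (n + k)%nat <= y n).
  { intros n k; induction k; [rewrite Nat.add_0_r; lra|].
    rewrite Nat.add_succ_r. specialize (Hy (n + k)%nat). lra. }
  assert (B : forall n m, x n <= y m).
  { intros n m. specialize (Mx n m). specialize (My m n).
    rewrite (Nat.add_comm m n) in My. specialize (Hxy (n + m)%nat). lra. }
  destruct (completeness (fun r => exists n, r = x n)) as [c [Hc1 Hc2]].
  - exists (y 0%nat). intros r [n ->]. apply B.
  - exists (x 0%nat). now exists 0%nat.
  - exists c. intros n. split.
    + apply Hc1. now exists n.
    + apply Hc2. intros r [m ->]. apply B.
Qed.

Lemma dependent_choice (A : Type) (Good : nat -> A -> Prop)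
    (Next : nat -> A -> A -> Prop) (x0 : A) :
  Good 0%nat x0 ->
  (forall n x, Good n x -> exists y, Good (S n) y /\ Next n x y) ->
  exists s : nat -> A, s 0%nat = x0 /\
    forall n, Good n (s n) /\ Next n (s n) (s (S n)).
Proof.
  intros H0 HS.
  pose (step := fun n (x : {x | Good n x}) =>
    let (y, Hy) := constructive_indefinite_description _
                     (HS n (proj1_sig x) (proj2_sig x)) in
    exist (Good (S n)) y (proj1 Hy)).
  pose (s := nat_rect (fun n => {x | Good n x}) (exist _ x0 H0) step).
  exists (fun n => proj1_sig (s n)). split; [reflexivity|].
  intros n. split; [apply proj2_sig|]. simpl. fold (s n). unfold step.
  destruct (constructive_indefinite_description _ _) as [y Hy]. apply Hy.
Qed.

(** By the triangle inequality one of the four quarters carries at least a quarter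
    of the contour integral. This is the step of the bisection in Goursat's
    theorem. *)
Lemma boundary_int_step (f : C -> C) (p : C) (a b K : R) :
  0 <= a -> 0 <= b ->
  (forall z, in_rect p a b z -> Ccontinuous f z) ->
  K < Cmod (boundary_int f p a b) ->
  exists q, K / 4 < Cmod (boundary_int f q (a / 2) (b / 2)) /\
    Re p <= Re q /\ Re q + a / 2 <= Re p + a /\
    Im p <= Im q /\ Im q + b / 2 <= Im p + b.
Proof.
  intros Ha Hb Hf HK. set (h := a / 2). set (k := b / 2).
  replace a with (2 * h) in * by (unfold h; field).
  replace b with (2 * k) in * by (unfold k; field).
  rewrite boundary_int_quarters in HK by (auto; lra).
  destruct (Rlt_le_dec (K / 4) (Cmod (boundary_int f p h k))) as [H1|H1].
  { exists p. split; [exact H1|]. lra. }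
  destruct (Rlt_le_dec (K / 4) (Cmod (boundary_int f (p + RtoC h) h k))) as [H2|H2].
  { exists (p + RtoC h)%C. split; [exact H2|]. unfold Re, Im; simpl. lra. }
  destruct (Rlt_le_dec (K / 4) (Cmod (boundary_int f (p + RtoC k * Ci) h k)))
    as [H3|H3].
  { exists (p + RtoC k * Ci)%C. split; [exact H3|]. unfold Re, Im; simpl. lra. }
  exists (p + RtoC h + RtoC k * Ci)%C. split; [|unfold Re, Im; simpl; lra].
  assert (T1 := Cmod_triangle (boundary_int f p h k) (boundary_int f (p + RtoC h) h k)).
  assert (T2 := Cmod_triangle (boundary_int f p h k + boundary_int f (p + RtoC h) h k)
     (boundary_int f (p + RtoC k * Ci) h k)).
  assert (T3 := Cmod_triangle (boundary_int f p h k + boundary_int f (p + RtoC h) h k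
     + boundary_int f (p + RtoC k * Ci) h k)
     (boundary_int f (p + RtoC h + RtoC k * Ci) h k)).
  lra.
Qed.

Lemma Cmod_le_Re_Im (z : C) : Cmod z <= Rabs (Re z) + Rabs (Im z).
Proof.
  unfold Re, Im. destruct z as [x y]. simpl fst. simpl snd.
  replace (x, y) with (RtoC x + RtoC y * Ci)%C.
  - eapply Rle_trans; [apply Cmod_triangle|].
    rewrite Cmod_mult, Cmod_Ci, !Cmod_R. lra.
  - unfold RtoC, Ci, Cplus, Cmult; simpl. f_equal; ring.
Qed.

Lemma in_rect_dist (p : C) (a b : R) (z w : C) :
  in_rect p a b z -> in_rect p a b w -> Cmod (z - w) <= a + b.
Proof.
  intros [Hz1 Hz2] [Hw1 Hw2].
  eapply Rle_trans; [apply Cmod_le_Re_Im|].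
  apply Rplus_le_compat; apply Rabs_le; unfold Re, Im in *; simpl; lra.
Qed.

(** Bisection. If the contour integral exceeded [K > 0] in modulus, nested
    rectangles of size [2^-n] would carry more than [K / 4^n]. At their common
    point the function is affine up to [eps] times the distance; affine functions
    have integral zero, and the remainder contributes at most
    [2 (a + b)^2 eps / 4^n], which is too small. *)
Theorem goursat_rectangle (f : C -> C) (p : C) (a b : R) :
  0 < a -> 0 < b -> (forall z, in_rect p a b z -> ex_Cderive f z) ->
  boundary_int f p a b = RtoC 0.
Proof.
  intros Ha Hb Hd.
  assert (Hf : forall z, in_rect p a b z -> Ccontinuous f z).
  { intros z Hz. destruct (Hd z Hz) as [l Hl]. eapply is_Cderive_continuous, Hl. }
  apply NNPP. intros Hne. apply Cmod_gt_0 in Hne.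
  set (K := Cmod (boundary_int f p a b) / 2) in *.
  assert (HK : 0 < K) by (unfold K; lra).
  assert (P2 : forall n, 0 < 2 ^ n) by (intros; apply pow_lt; lra).
  destruct (dependent_choice C
    (fun n q => K / 4 ^ n < Cmod (boundary_int f q (a / 2 ^ n) (b / 2 ^ n)) /\
       forall z, in_rect q (a / 2 ^ n) (b / 2 ^ n) z -> in_rect p a b z)
    (fun n q q' => Re q <= Re q' /\ Im q <= Im q' /\
       Re q' + a / 2 ^ S n <= Re q + a / 2 ^ n /\
       Im q' + b / 2 ^ S n <= Im q + b / 2 ^ n) p) as (s & Hs0 & Hs).
  - simpl. rewrite !Rdiv_1_r. split; [unfold K in *; lra|auto].
  - intros n q [H1 H2].
    assert (Ha' : 0 < a / 2 ^ n) by (apply Rdiv_lt_0_compat; auto).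
    assert (Hb' : 0 < b / 2 ^ n) by (apply Rdiv_lt_0_compat; auto).
    destruct (boundary_int_step f q (a / 2 ^ n) (b / 2 ^ n) (K / 4 ^ n))
      as (q' & Hq & Hq1 & Hq2 & Hq3 & Hq4); auto; try lra.
    exists q'.
    replace (a / 2 ^ S n) with (a / 2 ^ n / 2) by (simpl; field; specialize (P2 n); lra).
    replace (b / 2 ^ S n) with (b / 2 ^ n / 2) by (simpl; field; specialize (P2 n); lra).
    replace (K / 4 ^ S n) with (K / 4 ^ n / 4)
      by (simpl; field; apply pow_nonzero; lra).
    repeat split; auto; apply H2 || idtac; unfold in_rect in *;
    try (destruct (H2 z); lra).
  - assert (Hp : forall n, 0 < a / 2 ^ n /\ 0 < b / 2 ^ n)
      by (intros n; split; apply Rdiv_lt_0_compat; auto).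
    destruct (nested_intervals (fun n => Re (s n)) (fun n => Re (s n) + a / 2 ^ n))
      as [cx Hcx]; try (intros n; destruct (Hs n) as [_ H]; destruct (Hp n); lra).
    destruct (nested_intervals (fun n => Im (s n)) (fun n => Im (s n) + b / 2 ^ n))
      as [cy Hcy]; try (intros n; destruct (Hs n) as [_ H]; destruct (Hp n); lra).
    set (c := (cx, cy) : C).
    assert (Hc : forall n, in_rect (s n) (a / 2 ^ n) (b / 2 ^ n) c)
      by (intros n; split; [apply Hcx|apply Hcy]).
    destruct (Hd c) as [l Hl]. { apply (proj2 (proj1 (Hs 0%nat))), Hc. }
    apply is_Cderive_iff in Hl.
    (* This value makes the error bound below equal to [K / 4 ^ N]. *)
    set (eps := K / (2 * (a + b) * (a + b))).
    assert (He : 0 < eps) by (apply Rdiv_lt_0_compat; [lra|nra]).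
    destruct (Hl eps He) as [d [Hdp Happ]].
    destruct (pow_lt_1_zero (/ 2)) with (y := d / (a + b)) as [N HN].
    { rewrite Rabs_pos_eq; lra. } { apply Rdiv_lt_0_compat; lra. }
    specialize (HN N (Nat.le_refl N)).
    destruct (Hs N) as [[HsK HsR] _]. destruct (Hp N) as [Ha' Hb'].
    set (t := / 2 ^ N).
    assert (Ht : 0 < t) by (apply Rinv_0_lt_compat; auto).
    rewrite pow_inv in HN. fold t in HN. rewrite Rabs_pos_eq in HN by lra.
    replace (a / 2 ^ N) with (a * t) in * by reflexivity.
    replace (b / 2 ^ N) with (b * t) in * by reflexivity.
    assert (Cg : forall z, Ccontinuous (fun z => (f c - c * l) + l * z)%C z).
    { intros z. apply (is_Cderive_continuous _ _ (RtoC 0 + (RtoC 0 * z + l * RtoC 1))%C).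
      apply is_Cderive_plus; [apply is_Cderive_const|].
      apply is_Cderive_mult; [apply is_Cderive_const|apply is_Cderive_id]. }
    assert (E : boundary_int (fun z => f z - ((f c - c * l) + l * z))%C (s N) (a * t) (b * t)
       = boundary_int f (s N) (a * t) (b * t)).
    { rewrite boundary_int_minus; auto; try lra.
      rewrite boundary_int_affine by lra. ring. }
    rewrite <- E in HsK.
    assert (Bd : Cmod (boundary_int (fun z => f z - ((f c - c * l) + l * z))%C
       (s N) (a * t) (b * t)) <= 2 * (a * t + b * t) * (eps * (a * t + b * t))).
    { apply boundary_int_bound; try lra.
      - intros z Hz eps' He'.
        destruct (Hf z (HsR z Hz) (eps' / 2)) as [d1 [Hd1 H1]]; [lra|].
        destruct (Cg z (eps' / 2)) as [d2 [Hd2 H2]]; [lra|].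
        exists (Rmin d1 d2). split; [now apply Rmin_pos|]. intros w Hw.
        specialize (H1 w (Rlt_le_trans _ _ _ Hw (Rmin_l _ _))).
        specialize (H2 w (Rlt_le_trans _ _ _ Hw (Rmin_r _ _))).
        cbv beta in H2.
        replace (f w - (f c - c * l + l * w) - (f z - (f c - c * l + l * z)))%C
          with ((f w - f z) + - (f c - c * l + l * w - (f c - c * l + l * z)))%C by ring.
        eapply Rle_lt_trans; [apply Cmod_triangle|]. rewrite Cmod_opp. lra.
      - intros z Hz.
        assert (Hzc := in_rect_dist _ _ _ _ _ Hz (Hc N)).
        replace (f z - (f c - c * l + l * z))%C with (f z - f c - (z - c) * l)%C by ring.
        eapply Rle_trans; [apply Happ|].
        + apply Rle_lt_trans with (1 := Hzc). apply Rlt_div_r in HN; lra.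
        + apply Rmult_le_compat_l; lra. }
    replace (2 * (a * t + b * t) * (eps * (a * t + b * t))) with (K * (t * t)) in Bd
      by (unfold eps; field; lra).
    replace (K / 4 ^ N) with (K * (t * t)) in HsK.
    + lra.
    + unfold t. replace 4 with (2 * 2) by ring. rewrite Rpow_mult_distr.
      specialize (P2 N). field. lra.
Qed.

(** * The complex exponential *)

(** Written in real terms so that the periodicity in the imaginary part, on which
    [circ_int_holomorphic] rests, is that of [cos] and [sin]. *)
Definition Cexp (z : C) : C := (exp (Re z) * cos (Im z), exp (Re z) * sin (Im z)).

Lemma Cexp_plus (z w : C) : Cexp (z + w) = (Cexp z * Cexp w)%C.
Proof.
  unfold Cexp, Cmult; simpl fst; simpl snd.
  rewrite re_plus, im_plus, exp_plus, cos_plus, sin_plus. f_equal; ring.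
Qed.

Lemma Cexp_0 : Cexp (RtoC 0) = RtoC 1.
Proof.
  unfold Cexp, RtoC, Re, Im; simpl. rewrite exp_0, cos_0, sin_0.
  f_equal; ring.
Qed.

Lemma Cmod_Cexp (z : C) : Cmod (Cexp z) = exp (Re z).
Proof.
  unfold Cmod, Cexp; simpl fst; simpl snd.
  replace ((exp (Re z) * cos (Im z)) ^ 2 + (exp (Re z) * sin (Im z)) ^ 2)
    with (exp (Re z) ^ 2 * ((sin (Im z))² + (cos (Im z))²)) by (unfold Rsqr; ring).
  rewrite sin2_cos2, Rmult_1_r. apply sqrt_pow2, Rlt_le, exp_pos.
Qed.

Lemma Cexp_neq_0 (z : C) : Cexp z <> RtoC 0.
Proof. apply Cmod_gt_0. rewrite Cmod_Cexp. apply exp_pos. Qed.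

Lemma real_affine_approx_0 (f : R -> R) (l eps : R) :
  is_derive f 0 l -> 0 < eps -> exists d, 0 < d /\
    forall x, Rabs x < d -> Rabs (f x - f 0 - l * x) <= eps * Rabs x.
Proof.
  intros [_ H] He. destruct (H 0 (fun P HP => HP) (mkposreal eps He)) as [d Hd].
  exists d. split; [apply cond_pos|]. intros x Hx.
  assert (E := Hd x). unfold ball in E; simpl in E.
  unfold AbsRing_ball, norm, minus, plus, opp, scal, abs in E; simpl in E.
  unfold mult in E; simpl in E.
  replace (x + - 0) with x in E by ring.
  replace (f x + - f 0 + - (x * l)) with (f x - f 0 - l * x) in E by ring. auto.
Qed.

Lemma is_Cderive_Cexp_0 : is_Cderive Cexp (RtoC 0) (RtoC 1).
Proof.
  (* The errors of the four real approximations add up to at most [9 e |w|]. *)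
  apply is_Cderive_iff. intros eps He. set (e := Rmin (eps / 9) 1).
  assert (He0 : 0 < e) by (apply Rmin_pos; lra).
  assert (He1 : e <= 1) by apply Rmin_r.
  assert (He9 : 9 * e <= eps) by (generalize (Rmin_l (eps / 9) 1); fold e; lra).
  destruct (real_affine_approx_0 exp 1 e) as [d1 [Hd1 H1]]; auto.
  { rewrite <- exp_0. apply is_derive_exp. }
  destruct (real_affine_approx_0 cos 0 e) as [d2 [Hd2 H2]]; auto.
  { replace 0 with (- sin 0) at 2 by (rewrite sin_0; ring). apply is_derive_cos. }
  destruct (real_affine_approx_0 sin 1 e) as [d3 [Hd3 H3]]; auto.
  { rewrite <- cos_0. apply is_derive_sin. }
  exists (Rmin (Rmin d1 d2) (Rmin d3 e)). split. { repeat apply Rmin_pos; lra. }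
  intros w Hw. replace (w - RtoC 0)%C with w in * by ring.
  rewrite Cexp_0. set (x := Re w). set (y := Im w).
  assert (Hx : Rabs x <= Cmod w) by apply re_le_Cmod.
  assert (Hy : Rabs y <= Cmod w).
  { eapply Rle_trans; [apply Rmax_r|apply Rmax_Cmod]. }
  assert (HA := Rmin_l (Rmin d1 d2) (Rmin d3 e)).
  assert (HB := Rmin_r (Rmin d1 d2) (Rmin d3 e)).
  assert (HC := Rmin_l d1 d2). assert (HD := Rmin_r d1 d2).
  assert (HE := Rmin_l d3 e). assert (HF := Rmin_r d3 e).
  assert (K1 := H1 x ltac:(lra)). assert (K2 := H2 y ltac:(lra)).
  assert (K3 := H3 y ltac:(lra)).
  rewrite exp_0 in K1. rewrite cos_0 in K2. rewrite sin_0 in K3.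
  replace (sin y - 0 - 1 * y) with (sin y - y) in K3 by ring.
  replace (cos y - 1 - 0 * y) with (cos y - 1) in K2 by ring.
  assert (Px := Rabs_pos x). assert (Py := Rabs_pos y).
  assert (Kx : Rabs (exp x - 1) <= 2 * Rabs x).
  { replace (exp x - 1) with ((exp x - 1 - 1 * x) + x) by ring.
    eapply Rle_trans; [apply Rabs_triang|]. nra. }
  assert (Ex : Rabs (exp x) <= 3).
  { replace (exp x) with ((exp x - 1) + 1) by ring.
    eapply Rle_trans; [apply Rabs_triang|]. rewrite Rabs_R1. lra. }
  eapply Rle_trans; [apply Cmod_le_Re_Im|].
  replace (Re (Cexp w - RtoC 1 - w * RtoC 1)%C)
    with ((exp x - 1 - 1 * x) + exp x * (cos y - 1))
    by (unfold Cexp, Re, Im, x, y; simpl; unfold Re, Im; ring).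
  replace (Im (Cexp w - RtoC 1 - w * RtoC 1)%C)
    with (exp x * (sin y - y) + (exp x - 1) * y)
    by (unfold Cexp, Re, Im, x, y; simpl; unfold Re, Im; ring).
  assert (B1 := Rabs_triang (exp x - 1 - 1 * x) (exp x * (cos y - 1))).
  assert (B2 := Rabs_triang (exp x * (sin y - y)) ((exp x - 1) * y)).
  rewrite Rabs_mult in B1. rewrite !Rabs_mult in B2.
  assert (Pc := Rabs_pos (cos y - 1)). assert (Ps := Rabs_pos (sin y - y)).
  assert (C1 : Rabs (exp x) * Rabs (cos y - 1) <= 3 * (e * Rabs y))
    by (apply Rmult_le_compat; auto using Rabs_pos).
  assert (C2 : Rabs (exp x) * Rabs (sin y - y) <= 3 * (e * Rabs y))
    by (apply Rmult_le_compat; auto using Rabs_pos).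
  assert (C3 : Rabs (exp x - 1) * Rabs y <= 2 * e * Rabs y)
    by (apply Rmult_le_compat_r; lra).
  assert (C4 : e * Rabs x <= e * Cmod w) by (apply Rmult_le_compat_l; lra).
  assert (C5 : e * Rabs y <= e * Cmod w) by (apply Rmult_le_compat_l; lra).
  assert (C6 : 9 * e * Cmod w <= eps * Cmod w)
    by (apply Rmult_le_compat_r; [apply Cmod_ge_0|lra]).
  lra.
Qed.

Lemma is_Cderive_Cexp (z : C) : is_Cderive Cexp z (Cexp z).
Proof.
  apply (is_Cderive_ext_ball (fun w => Cexp z * Cexp (w - z))%C _ _ _ 1 Rlt_0_1).
  { intros w _. rewrite <- Cexp_plus. f_equal. ring. }
  eapply is_Cderive_eq.
  - apply is_Cderive_mult; [apply is_Cderive_const|].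
    apply (is_Cderive_comp Cexp (fun w => w - z)%C).
    + replace (z - z)%C with (RtoC 0) by ring. apply is_Cderive_Cexp_0.
    + apply is_Cderive_minus; [apply is_Cderive_id|apply is_Cderive_const].
  - cbv beta. ring.
Qed.

(** * Means over circles *)

Definition circ (r t : R) : C := (r * cos t, r * sin t).

Lemma Cmod_circ (r t : R) : 0 <= r -> Cmod (circ r t) = r.
Proof.
  intros Hr. unfold Cmod, circ; simpl fst; simpl snd.
  replace ((r * cos t) ^ 2 + (r * sin t) ^ 2) with (r ^ 2 * ((sin t)² + (cos t)²))
    by (unfold Rsqr; ring).
  rewrite sin2_cos2, Rmult_1_r. now apply sqrt_pow2.
Qed.

Lemma circ_surj (z : C) : exists t, 0 <= t <= 2 * PI /\ z = circ (Cmod z) t.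
Proof.
  destruct (Ceq_dec z (RtoC 0)) as [->|Hz].
  { exists 0. rewrite Cmod_0. split; [generalize PI_RGT_0; lra|].
    unfold circ, RtoC. f_equal; ring. }
  assert (Hm := proj1 (Cmod_gt_0 z) Hz).
  assert (E := Cmod2_alt z). set (r := Cmod z) in *.
  set (x := Re z / r). set (y := Im z / r).
  assert (Exy : x * x + y * y = 1).
  { unfold x, y.
    replace (Re z / r * (Re z / r) + Im z / r * (Im z / r))
      with ((Re z ^ 2 + Im z ^ 2) / r ^ 2) by (field; lra).
    rewrite <- E. field. lra. }
  assert (Hx : -1 <= x <= 1) by nra.
  assert (Hs : sin (acos x) = Rabs y).
  { rewrite sin_acos by lra. rewrite <- sqrt_Rsqr_abs. f_equal. unfold Rsqr. lra. }
  assert (Hc := cos_acos x Hx). assert (Hb := acos_bound x).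
  assert (Ez : z = (r * x, r * y)).
  { unfold x, y. destruct z as [u v]. unfold Re, Im; simpl. f_equal; field; lra. }
  destruct (Rle_lt_dec 0 y) as [Hy|Hy].
  - exists (acos x). split; [lra|]. rewrite Ez at 1. unfold circ.
    rewrite Hc, Hs, Rabs_pos_eq by lra. reflexivity.
  - exists (2 * PI - acos x). split; [lra|]. rewrite Ez at 1. unfold circ.
    rewrite cos_minus, sin_minus, cos_2PI, sin_2PI, Hc, Hs, Rabs_left by lra.
    f_equal; ring.
Qed.

Lemma real_lipschitz (f f' : R -> R) :
  (forall x, is_derive f x (f' x)) -> (forall x, Rabs (f' x) <= 1) ->
  forall x y, Rabs (f x - f y) <= Rabs (x - y).
Proof.
  intros Hf Hb x y.
  destruct (MVT_gen f y x f') as [c [_ Hc]].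
  - auto.
  - intros u _. apply derivable_continuous_pt. exists (f' u). now apply is_derive_Reals.
  - rewrite Hc, Rabs_mult. specialize (Hb c). assert (P := Rabs_pos (x - y)). nra.
Qed.

Lemma circ_dist (r r' t t' : R) :
  0 <= r -> Cmod (circ r' t' - circ r t) <= 2 * Rabs (r' - r) + 2 * r * Rabs (t' - t).
Proof.
  intros Hr.
  assert (Hc : Rabs (cos t' - cos t) <= Rabs (t' - t)).
  { apply (real_lipschitz cos (fun x => - sin x)); intros x.
    - apply is_derive_cos. - rewrite Rabs_Ropp. apply Rabs_le, SIN_bound. }
  assert (Hs : Rabs (sin t' - sin t) <= Rabs (t' - t)).
  { apply (real_lipschitz sin cos); intros x.
    - apply is_derive_sin. - apply Rabs_le, COS_bound. }
  assert (B1 : Rabs (cos t') <= 1) by (apply Rabs_le, COS_bound).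
  assert (B2 : Rabs (sin t') <= 1) by (apply Rabs_le, SIN_bound).
  eapply Rle_trans; [apply Cmod_le_Re_Im|].
  replace (Re (circ r' t' - circ r t)%C)
    with ((r' - r) * cos t' + r * (cos t' - cos t)) by (unfold circ, Re; simpl; ring).
  replace (Im (circ r' t' - circ r t)%C)
    with ((r' - r) * sin t' + r * (sin t' - sin t)) by (unfold circ, Im; simpl; ring).
  assert (T1 := Rabs_triang ((r' - r) * cos t') (r * (cos t' - cos t))).
  assert (T2 := Rabs_triang ((r' - r) * sin t') (r * (sin t' - sin t))).
  rewrite !Rabs_mult, (Rabs_pos_eq r Hr) in *.
  assert (P := Rabs_pos (r' - r)).
  assert (U1 : Rabs (r' - r) * Rabs (cos t') <= Rabs (r' - r)) by nra.
  assert (U2 : Rabs (r' - r) * Rabs (sin t') <= Rabs (r' - r)) by nra.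
  assert (U3 : r * Rabs (cos t' - cos t) <= r * Rabs (t' - t)) by nra.
  assert (U4 : r * Rabs (sin t' - sin t) <= r * Rabs (t' - t)) by nra.
  lra.
Qed.

Lemma RCcontinuous_circ (r t : R) : 0 <= r -> RCcontinuous (circ r) t.
Proof.
  intros Hr eps He. exists (eps / (2 * r + 1)). split.
  { apply Rdiv_lt_0_compat; lra. }
  intros u Hu. eapply Rle_lt_trans; [now apply circ_dist|].
  rewrite Rminus_diag, Rabs_R0. apply Rlt_div_r in Hu; [|lra].
  assert (P := Rabs_pos (u - t)). nra.
Qed.

Definition circ_int (F : C -> C) (r : R) : C :=
  CRInt (fun t => F (circ r t)) 0 (2 * PI).

Definition continuous_on_circ (F : C -> C) (r : R) : Prop :=
  forall z, Cmod z = r -> Ccontinuous F z.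

Lemma two_PI_pos : 0 < 2 * PI.
Proof. generalize PI_RGT_0; lra. Qed.

Lemma ex_circ_int (F : C -> C) (r : R) :
  0 <= r -> continuous_on_circ F r ->
  ex_CRInt (fun t => F (circ r t)) 0 (2 * PI).
Proof.
  intros Hr HF. apply ex_CRInt_continuous; [apply Rlt_le, two_PI_pos|].
  intros t _. apply RCcontinuous_comp.
  - now apply HF, Cmod_circ.
  - now apply RCcontinuous_circ.
Qed.

Lemma circ_int_bound (F : C -> C) (r M : R) :
  0 <= r -> continuous_on_circ F r ->
  (forall z, Cmod z = r -> Cmod (F z) <= M) ->
  Cmod (circ_int F r) <= 2 * PI * M.
Proof.
  intros Hr HF HM. rewrite <- (Rminus_0_r (2 * PI)).
  apply Cmod_CRInt_le; [apply Rlt_le, two_PI_pos|now apply ex_circ_int|].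
  intros t _. now apply HM, Cmod_circ.
Qed.

Lemma circ_int_ext (F G : C -> C) (r : R) :
  0 <= r -> (forall z, Cmod z = r -> F z = G z) -> circ_int F r = circ_int G r.
Proof.
  intros Hr H. apply CRInt_ext; [apply Rlt_le, two_PI_pos|].
  intros t _. now apply H, Cmod_circ.
Qed.

Lemma circ_int_const (c : C) (r : R) :
  circ_int (fun _ => c) r = (RtoC (2 * PI) * c)%C.
Proof. unfold circ_int. rewrite CRInt_const. do 2 f_equal. ring. Qed.

Lemma circ_int_minus (F G : C -> C) (r : R) :
  0 <= r -> continuous_on_circ F r -> continuous_on_circ G r ->
  circ_int (fun z => F z - G z)%C r = (circ_int F r - circ_int G r)%C.
Proof. intros Hr HF HG. apply CRInt_minus; now apply ex_circ_int. Qed.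

Lemma circ_int_Cmult (F : C -> C) (c : C) (r : R) :
  0 <= r -> continuous_on_circ F r ->
  circ_int (fun z => c * F z)%C r = (c * circ_int F r)%C.
Proof. intros Hr HF. now apply CRInt_Cmult, ex_circ_int. Qed.

Lemma exp_le_compat (x y : R) : x <= y -> exp x <= exp y.
Proof.
  intros [H| ->]; [now apply Rlt_le, exp_increasing|lra].
Qed.

Lemma Cexp_ln_circ (r t : R) : 0 < r -> Cexp (ln r, t) = circ r t.
Proof.
  intros Hr. unfold Cexp, circ, Re, Im; simpl. now rewrite exp_ln.
Qed.

(** In logarithmic coordinates the annulus becomes a rectangle of height [2 pi].
    The integrals of [F o exp] over its horizontal sides cancel by periodicity, and
    those over the vertical sides are the two circle integrals, so Goursat's theorem
    for the rectangle gives their equality. *)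
Lemma circ_int_holomorphic (F : C -> C) (r1 r2 : R) :
  0 < r1 -> r1 < r2 ->
  (forall z, r1 <= Cmod z <= r2 -> ex_Cderive F z) ->
  circ_int F r1 = circ_int F r2.
Proof.
  intros H1 H2 HF.
  assert (Hln := ln_increasing _ _ H1 H2).
  assert (G := goursat_rectangle (fun z => F (Cexp z)) (ln r1, 0) (ln r2 - ln r1)
                 (2 * PI) ltac:(lra) two_PI_pos).
  unfold boundary_int, side in G.
  assert (E1 : CRInt (fun u => F (Cexp ((ln r1, 0) + RtoC u * Ci))%C) 0 (2 * PI)
               = circ_int F r1).
  { apply CRInt_ext; [apply Rlt_le, two_PI_pos|]. intros t _. f_equal.
    rewrite <- Cexp_ln_circ by lra. f_equal.
    unfold Cplus, Cmult, Ci, RtoC; simpl. f_equal; ring. }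
  assert (E2 : CRInt (fun u => F (Cexp ((ln r1, 0) + RtoC (ln r2 - ln r1)
                 + RtoC u * Ci))%C) 0 (2 * PI) = circ_int F r2).
  { apply CRInt_ext; [apply Rlt_le, two_PI_pos|]. intros t _. f_equal.
    rewrite <- Cexp_ln_circ by lra. f_equal.
    unfold Cplus, Cmult, Ci, RtoC; simpl. f_equal; ring. }
  assert (E3 : CRInt (fun u => F (Cexp ((ln r1, 0) + RtoC (2 * PI) * Ci
                 + RtoC u * RtoC 1))%C) 0 (ln r2 - ln r1)
     = CRInt (fun u => F (Cexp ((ln r1, 0) + RtoC u * RtoC 1))%C) 0 (ln r2 - ln r1)).
  { apply CRInt_ext; [lra|]. intros t _. f_equal.
    unfold Cexp, Re, Im; simpl.
    replace (0 + (2 * PI * 1 + 0 * 0) + (t * 0 + 0 * 1)) with (2 * PI) by ring.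
    replace (0 + (t * 0 + 0 * 1)) with 0 by ring.
    rewrite cos_2PI, sin_2PI, cos_0, sin_0.
    repeat f_equal; ring. }
  rewrite E1, E2, E3 in G.
  assert (D : (Ci * (circ_int F r2 - circ_int F r1) = RtoC 0)%C).
  { rewrite <- G.
    - ring.
    - intros z [[Hz1 Hz2] _]. unfold Re in Hz1, Hz2; simpl in Hz1, Hz2.
      destruct (HF (Cexp z)) as [l Hl].
      + rewrite Cmod_Cexp. unfold Re. rewrite <- (exp_ln r1), <- (exp_ln r2) by lra.
        split; apply exp_le_compat; lra.
      + eexists. apply (is_Cderive_comp F Cexp); [exact Hl|apply is_Cderive_Cexp]. }
  apply Ceq_minus. apply NNPP. intros Hn.
  apply (Cmult_neq_0 Ci (circ_int F r2 - circ_int F r1)%C).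
  - apply Ci_nz.
  - intros E. apply Hn. replace (circ_int F r1 - circ_int F r2)%C
      with (- (circ_int F r2 - circ_int F r1))%C by ring. rewrite E. ring.
  - exact D.
Qed.

(** The compactness of the range of angles makes the continuity of [F] uniform along
    the circle of radius [r0]. *)
Lemma circ_int_radius_continuous (F : C -> C) (r0 eps : R) :
  0 <= r0 -> r0 < 1 -> 0 < eps ->
  (forall z, Cmod z < 1 -> Ccontinuous F z) ->
  exists d, 0 < d /\ forall r, 0 <= r < 1 -> Rabs (r - r0) < d ->
    Cmod (circ_int F r - circ_int F r0) <= eps.
Proof.
  intros Hr0 Hr1 He HF.
  assert (Hpi := two_PI_pos). set (e := eps / (2 * PI)).
  assert (He' : 0 < e) by (apply Rdiv_lt_0_compat; lra).
  assert (HC : forall t, exists d : posreal,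
     forall w, Cmod (w - circ r0 t) < d -> Cmod (F w - F (circ r0 t)) < e / 2).
  { intros t. destruct (HF (circ r0 t)) with (eps := e / 2) as [d [Hd H]].
    - now rewrite Cmod_circ.
    - lra.
    - now exists (mkposreal d Hd). }
  pose (D := fun t => proj1_sig (constructive_indefinite_description _ (HC t))).
  assert (HD : forall t w, Cmod (w - circ r0 t) < D t ->
                 Cmod (F w - F (circ r0 t)) < e / 2).
  { intros t. exact (proj2_sig (constructive_indefinite_description _ (HC t))). }
  assert (Hd' : forall t, 0 < D t / (2 + 2 * r0)).
  { intros t. apply Rdiv_lt_0_compat; [apply cond_pos|lra]. }
  destruct (compactness_value_1d 0 (2 * PI) (fun t => mkposreal _ (Hd' t)))
    as [d Hd]. simpl in Hd.
  exists d. split; [apply cond_pos|]. intros r Hr Hrd.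
  assert (Ex : forall s, 0 <= s < 1 -> continuous_on_circ F s)
    by (intros s Hs z Hz; apply HF; lra).
  replace (circ_int F r - circ_int F r0)%C
    with (CRInt (fun t => F (circ r t) - F (circ r0 t))%C 0 (2 * PI)).
  2:{ apply CRInt_minus; apply ex_circ_int; try apply Ex; lra. }
  replace eps with ((2 * PI - 0) * e) by (unfold e; field; apply PI_neq0).
  apply Cmod_CRInt_le; [lra| |].
  { apply ex_CRInt_minus; apply ex_circ_int; try apply Ex; lra. }
  intros t Ht. apply Rnot_lt_le. intros Hlt.
  apply (Hd t Ht). intros (s & Hs & Hts & Hds).
  set (k := 2 + 2 * r0) in *. assert (0 < k) by (unfold k; lra).
  assert (Q1 : Rabs (t - s) * k < D s) by (apply Rlt_div_r in Hts; lra).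
  assert (Q2 : d * k <= D s) by (apply Rle_div_r in Hds; lra).
  assert (P1 := Rabs_pos (t - s)). assert (P2 := Rabs_pos (r - r0)).
  assert (N1 : Cmod (F (circ r t) - F (circ r0 s)) < e / 2).
  { apply HD. eapply Rle_lt_trans; [now apply circ_dist|]. unfold k in *. nra. }
  assert (N2 : Cmod (F (circ r0 t) - F (circ r0 s)) < e / 2).
  { apply HD. eapply Rle_lt_trans; [now apply circ_dist|].
    rewrite Rminus_diag, Rabs_R0. unfold k in *. nra. }
  assert (T := Cmod_triangle (F (circ r t) - F (circ r0 s))
                 (- (F (circ r0 t) - F (circ r0 s)))).
  rewrite Cmod_opp in T.
  replace (F (circ r t) - F (circ r0 s) + - (F (circ r0 t) - F (circ r0 s)))%C
    with (F (circ r t) - F (circ r0 t))%C in T by ring. lra.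
Qed.

Lemma Cmod_small_eq (z w : C) :
  (forall eps, 0 < eps -> Cmod (z - w) <= eps) -> z = w.
Proof.
  intros H. apply Ceq_minus, Cmod_eq_0.
  assert (P := Cmod_ge_0 (z - w)).
  destruct (Rle_lt_or_eq_dec _ _ P) as [Hlt|]; [|auto].
  specialize (H (Cmod (z - w) / 2)). lra.
Qed.

(** The mean value property, with a circle [|z| = rho] on which [F] is only continuous.
    The circle integral is constant on the two ranges of radii that avoid [rho],
    and its continuity in the radius closes the gap at [rho] and at [0]. This
    tolerance is what lets the difference quotient in [cauchy_formula] be treated
    without removing its singularity first. *)
Lemma circ_int_mean (F : C -> C) (rho r : R) :
  (forall z, Cmod z < 1 -> Ccontinuous F z) ->
  (forall z, 0 < Cmod z < 1 -> Cmod z <> rho -> ex_Cderive F z) ->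
  0 <= r < 1 -> circ_int F r = (RtoC (2 * PI) * F (RtoC 0))%C.
Proof.
  intros HF HD Hr.
  assert (Claim : forall s t, 0 <= s -> s < t -> t < 1 ->
     (forall u, s < u < t -> u <> rho) -> circ_int F s = circ_int F t).
  { intros s t Hs Hst Ht Hu. apply Cmod_small_eq. intros eps He.
    destruct (circ_int_radius_continuous F s (eps / 2)) as [d1 [Hd1 H1]]; auto; try lra.
    destruct (circ_int_radius_continuous F t (eps / 2)) as [d2 [Hd2 H2]]; auto; try lra.
    set (h1 := Rmin d1 ((t - s) / 2) / 2). set (h2 := Rmin d2 ((t - s) / 2) / 2).
    assert (L1 := Rmin_l d1 ((t - s) / 2)). assert (L2 := Rmin_r d1 ((t - s) / 2)).
    assert (L3 := Rmin_l d2 ((t - s) / 2)). assert (L4 := Rmin_r d2 ((t - s) / 2)).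
    assert (L5 : 0 < Rmin d1 ((t - s) / 2)) by (apply Rmin_pos; lra).
    assert (L6 : 0 < Rmin d2 ((t - s) / 2)) by (apply Rmin_pos; lra).
    assert (B1 : Cmod (circ_int F (s + h1) - circ_int F s) <= eps / 2).
    { apply H1; unfold h1 in *; [lra|]. rewrite Rabs_pos_eq; lra. }
    assert (B2 : Cmod (circ_int F (t - h2) - circ_int F t) <= eps / 2).
    { apply H2; unfold h2 in *; [lra|]. rewrite Rabs_left; lra. }
    assert (E : circ_int F (s + h1) = circ_int F (t - h2)).
    { apply circ_int_holomorphic; unfold h1, h2 in *; try lra.
      intros z Hz. apply HD; [lra|]. apply Hu. lra. }
    rewrite E in B1. rewrite Cmod_minus_sym in B1.
    replace (circ_int F s - circ_int F t)%C
      with ((circ_int F s - circ_int F (t - h2)) + (circ_int F (t - h2) - circ_int F t))%C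
      by ring.
    eapply Rle_trans; [apply Cmod_triangle|]. lra. }
  assert (E0 : circ_int F 0 = (RtoC (2 * PI) * F (RtoC 0))%C).
  { rewrite <- (circ_int_const _ 0). apply circ_int_ext; [lra|].
    intros z Hz. now rewrite (Cmod_eq_0 z Hz). }
  rewrite <- E0. symmetry.
  destruct (Rle_lt_or_eq_dec 0 r (proj1 Hr)) as [Hr0|<-]; [|reflexivity].
  destruct (Rlt_le_dec 0 rho) as [H1|H1]; [|apply Claim; try lra; intros u; lra].
  destruct (Rlt_le_dec rho r) as [H2|H2]; [|apply Claim; try lra; intros u; lra].
  transitivity (circ_int F rho); apply Claim; try lra; intros u; lra.
Qed.

(** * Cauchy's formula on circles around the origin *)

Lemma Cminus_neq_0_Cmod (z a : C) : Cmod a < Cmod z -> (z - a)%C <> RtoC 0.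
Proof. intros H E. apply Ceq_minus in E. subst. lra. Qed.

Lemma ex_Cderive_kernel (a z : C) :
  z <> a -> ex_Cderive (fun w => w / (w - a))%C z.
Proof.
  intros Hz. eexists. apply is_Cderive_div.
  - apply is_Cderive_id.
  - apply is_Cderive_minus; [apply is_Cderive_id|apply is_Cderive_const].
  - intros E. now apply Hz, Ceq_minus.
Qed.

Lemma ex_Cderive_continuous (f : C -> C) (z : C) :
  ex_Cderive f z -> Ccontinuous f z.
Proof. intros [l H]. now apply (is_Cderive_continuous f z l). Qed.

Lemma ex_Cderive_mult (f g : C -> C) (z : C) :
  ex_Cderive f z -> ex_Cderive g z -> ex_Cderive (fun w => f w * g w)%C z.
Proof. intros [l H] [l' H']. eexists. apply is_Cderive_mult; eassumption. Qed.

(** The kernel is holomorphic outside the disk of radius [|a|], so the radius may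
    tend to infinity, where the kernel tends to [1]. *)
Lemma circ_int_kernel (a : C) (R0 : R) :
  Cmod a < R0 -> circ_int (fun z => z / (z - a))%C R0 = RtoC (2 * PI).
Proof.
  intros Ha. assert (Pa := Cmod_ge_0 a). assert (Hpi := two_PI_pos).
  apply Cmod_small_eq. intros eps He.
  (* At this radius the kernel differs from [1] by at most [eps / (2 PI)]. *)
  set (R1 := R0 + 1 + Cmod a + 2 * PI * Cmod a / eps).
  assert (Hq : 0 <= 2 * PI * Cmod a / eps).
  { apply Rdiv_le_0_compat; [|lra]. apply Rmult_le_pos; lra. }
  assert (HD : forall z, R0 <= Cmod z -> ex_Cderive (fun z => z / (z - a))%C z).
  { intros z Hz. apply ex_Cderive_kernel. intros E. subst. lra. }
  rewrite (circ_int_holomorphic _ R0 R1); [|lra|unfold R1; lra|intros z Hz; apply HD, Hz].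
  replace (RtoC (2 * PI)) with (circ_int (fun _ => RtoC 1) R1)
    by (rewrite circ_int_const; ring).
  assert (C1 : continuous_on_circ (fun z => z / (z - a))%C R1).
  { intros z Hz. apply ex_Cderive_continuous, HD. rewrite Hz. unfold R1. lra. }
  assert (C2 : continuous_on_circ (fun _ : C => RtoC 1) R1).
  { intros z _. eapply is_Cderive_continuous, is_Cderive_const. }
  assert (P1 : 0 < R1 - Cmod a) by (unfold R1; lra).
  rewrite <- circ_int_minus; auto; [|unfold R1; lra].
  eapply Rle_trans.
  - apply (circ_int_bound _ _ (Cmod a / (R1 - Cmod a))); [unfold R1; lra| |].
    + intros z Hz e He'.
      destruct (C1 z Hz e He') as [d [Hd H]]. exists d. split; auto.
      intros w Hw. replace (w / (w - a) - RtoC 1 - (z / (z - a) - RtoC 1))%C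
        with (w / (w - a) - z / (z - a))%C by ring. auto.
    + intros z Hz. assert (Hn : (z - a)%C <> RtoC 0) by (apply Cminus_neq_0_Cmod; lra).
      replace (z / (z - a) - RtoC 1)%C with (a / (z - a))%C by (field; auto).
      rewrite Cmod_div by auto. apply Rmult_le_compat_l; [lra|].
      apply Rinv_le_contravar; [lra|]. rewrite <- Hz. apply Cmod_triangle_minus.
  - apply Rle_trans with (2 * PI * Cmod a / (R1 - Cmod a)); [right; field; lra|].
    apply Rle_div_l; [lra|].
    apply Rle_trans with (eps * (2 * PI * Cmod a / eps)); [right; field; lra|].
    apply Rmult_le_compat_l; [lra|]. unfold R1. lra.
Qed.

Lemma holomorphic_continuous (f : C -> C) (z : C) :
  holomorphic_on_disk f -> Cmod z < 1 -> Ccontinuous f z.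
Proof. intros Hf Hz. now apply ex_Cderive_continuous, Hf. Qed.

(** The mean value property for [z (f z - f a) / (z - a)], which vanishes at [0] and is
    continuous, but possibly not holomorphic, at the point [a]. *)
Theorem cauchy_formula (f : C -> C) (a : C) (R0 : R) :
  holomorphic_on_disk f -> Cmod a < R0 < 1 ->
  circ_int (fun z => f z * (z / (z - a)))%C R0 = (RtoC (2 * PI) * f a)%C.
Proof.
  intros Hf [Ha HR]. assert (Pa := Cmod_ge_0 a).
  destruct (Hf a) as [l Hl]; [unfold unit_disk; lra|].
  pose (F := fun z => if Ceq_dec z a then (a * l)%C else (z * ((f z - f a) / (z - a)))%C).
  assert (Fout : forall z, z <> a -> Cmod z < 1 -> ex_Cderive F z).
  { intros z Hza Hz. destruct (Hf z Hz) as [l' Hl'].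
    assert (Hn : (z - a)%C <> RtoC 0) by (intros E; now apply Hza, Ceq_minus).
    eexists. apply (is_Cderive_ext_ball (fun z => z * ((f z - f a) / (z - a)))%C
      _ _ _ (Cmod (z - a)) (proj1 (Cmod_gt_0 _) Hn)).
    - intros w Hw. unfold F. destruct (Ceq_dec w a) as [->|]; [|reflexivity].
      rewrite Cmod_minus_sym in Hw. lra.
    - apply is_Cderive_mult; [apply is_Cderive_id|].
      apply is_Cderive_div; [|apply is_Cderive_minus;
        [apply is_Cderive_id|apply is_Cderive_const]|exact Hn].
      apply is_Cderive_minus; [exact Hl'|apply is_Cderive_const]. }
  assert (Fa : Ccontinuous F a).
  { intros eps He. apply is_Cderive_iff in Hl.
    assert (Pl := Cmod_ge_0 l).
    destruct (Hl (eps / 4)) as [d [Hd H]]; [lra|].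
    exists (Rmin d (Rmin 1 (eps / (4 * (Cmod l + 1))))). split.
    { repeat apply Rmin_pos; try lra. apply Rdiv_lt_0_compat; lra. }
    intros w Hw. unfold F at 2. destruct (Ceq_dec a a) as [_|]; [|tauto].
    unfold F. destruct (Ceq_dec w a) as [_|Hwa].
    { replace (a * l - a * l)%C with (RtoC 0) by ring. rewrite Cmod_0. lra. }
    assert (H1 := Rlt_le_trans _ _ _ Hw (Rmin_l _ _)).
    assert (H2 := Rlt_le_trans _ _ _ Hw (Rmin_r _ _)).
    assert (H3 := Rlt_le_trans _ _ _ H2 (Rmin_l _ _)).
    assert (H4 := Rlt_le_trans _ _ _ H2 (Rmin_r _ _)).
    apply Rlt_div_r in H4; [|lra].
    assert (Hn : (w - a)%C <> RtoC 0) by (intros E; now apply Hwa, Ceq_minus).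
    assert (Hp := proj1 (Cmod_gt_0 _) Hn). specialize (H w H1).
    replace (w * ((f w - f a) / (w - a)) - a * l)%C
      with ((w - a) * l + w * ((f w - f a - (w - a) * l) / (w - a)))%C by (field; auto).
    eapply Rle_lt_trans; [apply Cmod_triangle|].
    rewrite !Cmod_mult, Cmod_div by auto.
    apply Rle_div_l in H; [|exact Hp].
    assert (Hw2 : Cmod w <= 2).
    { replace w with ((w - a) + a)%C by ring. generalize (Cmod_triangle (w - a) a). lra. }
    assert (0 <= Cmod (f w - f a - (w - a) * l)%C / Cmod (w - a)).
    { apply Rdiv_le_0_compat; [apply Cmod_ge_0|exact Hp]. }
    nra. }
  assert (M := circ_int_mean F (Cmod a) R0).
  assert (F0 : F (RtoC 0) = RtoC 0).
  { unfold F. destruct (Ceq_dec (RtoC 0) a) as [<-|]; ring. }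
  assert (CF : forall z, Cmod z < 1 -> Ccontinuous F z).
  { intros z Hz. destruct (Ceq_dec z a) as [->|Hza]; [exact Fa|].
    now apply ex_Cderive_continuous, Fout. }
  rewrite F0, Cmult_0_r in M.
  rewrite <- (circ_int_kernel a R0 Ha).
  assert (K : continuous_on_circ (fun z => z / (z - a))%C R0).
  { intros z Hz. apply ex_Cderive_continuous, ex_Cderive_kernel.
    intros E. subst. lra. }
  assert (K' : continuous_on_circ (fun z => f z * (z / (z - a)))%C R0).
  { intros z Hz. apply ex_Cderive_continuous, ex_Cderive_mult.
    - apply Hf. unfold unit_disk. lra.
    - apply ex_Cderive_kernel. intros E. subst. lra. }
  assert (K'' : continuous_on_circ (fun z => f a * (z / (z - a)))%C R0).
  { intros z Hz. apply ex_Cderive_continuous, ex_Cderive_mult.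
    - eexists. apply is_Cderive_const.
    - apply ex_Cderive_kernel. intros E. subst. lra. }
  rewrite Cmult_comm, <- circ_int_Cmult by (auto; lra).
  apply Ceq_minus. rewrite <- circ_int_minus by (auto; lra).
  rewrite <- M; auto; [|intros z Hz Hza; apply Fout; [intros ->; auto|lra]|lra].
  apply circ_int_ext; [lra|]. intros z Hz. unfold F.
  destruct (Ceq_dec z a) as [->|Hza]; [lra|]. field.
  intros E. now apply Hza, Ceq_minus.
Qed.

Lemma ex_Cderive_pow (f : C -> C) (n : nat) (z : C) :
  ex_Cderive f z -> ex_Cderive (fun w => f w ^ n)%C z.
Proof.
  intros Hf. induction n as [|n IH]; simpl.
  - eexists. apply is_Cderive_const.
  - now apply ex_Cderive_mult.
Qed.

(** Cauchy's formula bounds [|f a|] by [C M], where [C = R0 / (R0 - |a|)] does not depend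
    on [f]. Applied to the powers of [f] it gives [|f a|^n <= C M^n] for every [n], and
    hence [|f a| <= M]. *)
Theorem maximum_modulus (f : C -> C) (a : C) (R0 M : R) :
  holomorphic_on_disk f -> Cmod a < R0 < 1 ->
  (forall z, Cmod z = R0 -> Cmod (f z) <= M) -> Cmod (f a) <= M.
Proof.
  intros Hf [Ha HR] HM. assert (Pa := Cmod_ge_0 a). assert (Hpi := two_PI_pos).
  assert (PM : 0 <= M).
  { eapply Rle_trans; [apply Cmod_ge_0|apply (HM (RtoC R0))].
    rewrite Cmod_R. apply Rabs_pos_eq. lra. }
  assert (Key : forall n, Cmod (f a) ^ n * (R0 - Cmod a) <= M ^ n * R0).
  { intros n.
    assert (Hfn : holomorphic_on_disk (fun z => f z ^ n)%C)
      by (intros z Hz; apply ex_Cderive_pow, Hf, Hz).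
    assert (E := cauchy_formula (fun z => f z ^ n)%C a R0 Hfn (conj Ha HR)).
    assert (B : Cmod (circ_int (fun z => f z ^ n * (z / (z - a)))%C R0)
                <= 2 * PI * (M ^ n * (R0 / (R0 - Cmod a)))).
    { apply circ_int_bound; [lra| |].
      - intros z Hz. apply ex_Cderive_continuous, ex_Cderive_mult.
        + apply Hfn. unfold unit_disk; lra.
        + apply ex_Cderive_kernel. intros E'. subst. lra.
      - intros z Hz. assert (Hn : (z - a)%C <> RtoC 0) by (apply Cminus_neq_0_Cmod; lra).
        rewrite Cmod_mult, Cmod_pow, Cmod_div by auto.
        apply Rmult_le_compat; [apply pow_le, Cmod_ge_0| | |].
        + apply Rdiv_le_0_compat; [apply Cmod_ge_0|now apply Cmod_gt_0].
        + apply pow_incr. split; [apply Cmod_ge_0|auto].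
        + rewrite Hz. apply Rmult_le_compat_l; [lra|].
          apply Rinv_le_contravar; [lra|]. rewrite <- Hz. apply Cmod_triangle_minus. }
    rewrite E, Cmod_mult, Cmod_R, Rabs_pos_eq, Cmod_pow in B by lra.
    apply Rmult_le_reg_l in B; [|lra].
    replace (M ^ n * R0) with (M ^ n * (R0 / (R0 - Cmod a)) * (R0 - Cmod a))
      by (field; lra).
    apply Rmult_le_compat_r; lra. }
  apply Rnot_lt_le. intros Hlt. set (x := Cmod (f a)) in *.
  destruct (pow_lt_1_zero (M / x)) with (y := (R0 - Cmod a) / R0) as [N HN].
  - rewrite Rabs_pos_eq.
    + apply Rlt_div_l; lra.
    + apply Rdiv_le_0_compat; lra.
  - apply Rdiv_lt_0_compat; lra.
  - specialize (HN N (Nat.le_refl N)). specialize (Key N).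
    assert (Px : 0 < x ^ N) by (apply pow_lt; lra).
    assert (0 <= M / x) by (apply Rdiv_le_0_compat; lra).
    rewrite Rabs_pos_eq in HN by now apply pow_le.
    assert (E : (M / x) ^ N = M ^ N / x ^ N)
      by (unfold Rdiv; rewrite Rpow_mult_distr, pow_inv; reflexivity).
    rewrite E in HN. apply Rlt_div_r in HN; [|lra].
    replace (M ^ N / x ^ N * R0) with (M ^ N * R0 / x ^ N) in HN by (field; lra).
    apply Rlt_div_l in HN; [|exact Px]. lra.
Qed.

Lemma circle_max (f : C -> C) (r : R) :
  0 <= r -> continuous_on_circ f r ->
  exists z0, Cmod z0 = r /\ forall z, Cmod z = r -> Cmod (f z) <= Cmod (f z0).
Proof.
  intros Hr Hf.
  destruct (continuity_ab_maj (fun t => Cmod (f (circ r t))) 0 (2 * PI))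
    as [t0 [Ht0 _]].
  - apply Rlt_le, two_PI_pos.
  - intros t _ eps He.
    assert (Hc : RCcontinuous (fun t => f (circ r t)) t).
    { apply RCcontinuous_comp; [now apply Hf, Cmod_circ|now apply RCcontinuous_circ]. }
    destruct (Hc eps He) as [d [Hd H]]. exists d. split; [exact Hd|].
    intros u [_ Hu]. unfold dist in *; simpl in *; unfold Rdist in *.
    eapply Rle_lt_trans; [|apply (H u Hu)].
    apply Rabs_le. split; [|apply Cmod_triangle_minus].
    generalize (Cmod_triangle_minus (f (circ r t)) (f (circ r u))).
    rewrite Cmod_minus_sym. lra.
  - exists (circ r t0). split; [now apply Cmod_circ|]. intros z Hz.
    destruct (circ_surj z) as [t [Ht ->]]. rewrite Hz. now apply Ht0.
Qed.

(** * Power series converging on the unit disk *)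

Fixpoint csum (u : nat -> C) (n : nat) : C :=
  match n with O => RtoC 0 | S m => (csum u m + u m)%C end.

Fixpoint rsum (u : nat -> R) (n : nat) : R :=
  match n with O => 0 | S m => rsum u m + u m end.

Definition sums_to (u : nat -> C) (l : C) : Prop :=
  forall eps, 0 < eps -> exists N, forall n, (N <= n)%nat ->
    Cmod (csum u n - l) < eps.

Lemma csum_ext (u v : nat -> C) (n : nat) :
  (forall k, u k = v k) -> csum u n = csum v n.
Proof. intros H. induction n as [|n IH]; simpl; congruence. Qed.

Lemma csum_S (u : nat -> C) (n : nat) :
  csum u (S n) = (u 0%nat + csum (fun k => u (S k)) n)%C.
Proof.
  induction n as [|n IH]; [simpl; ring|].
  change (csum u (S (S n))) with (csum u (S n) + u (S n))%C.
  rewrite IH. simpl. ring.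
Qed.

Lemma Cmod_csum_le (u : nat -> C) (v : nat -> R) (n : nat) :
  (forall k, Cmod (u k) <= v k) -> Cmod (csum u n) <= rsum v n.
Proof.
  intros H. induction n as [|n IH]; simpl; [rewrite Cmod_0; lra|].
  eapply Rle_trans; [apply Cmod_triangle|]. specialize (H n). lra.
Qed.

Lemma sums_to_ext (u v : nat -> C) (l : C) :
  (forall k, u k = v k) -> sums_to u l -> sums_to v l.
Proof.
  intros H Hu eps He. destruct (Hu eps He) as [N HN]. exists N.
  intros n Hn. rewrite <- (csum_ext u v) by exact H. auto.
Qed.

Lemma sums_to_bound (u : nat -> C) (l : C) (B : R) :
  sums_to u l -> (forall n, Cmod (csum u n) <= B) -> Cmod l <= B.
Proof.
  intros Hu HB. apply Rnot_lt_le. intros Hlt.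
  destruct (Hu (Cmod l - B)) as [N HN]; [lra|].
  specialize (HN N (Nat.le_refl N)). specialize (HB N).
  rewrite Cmod_minus_sym in HN.
  generalize (Cmod_triangle_minus l (csum u N)). lra.
Qed.

Lemma sums_to_plus (u v : nat -> C) (l m : C) :
  sums_to u l -> sums_to v m -> sums_to (fun n => u n + v n)%C (l + m)%C.
Proof.
  intros Hu Hv eps He.
  destruct (Hu (eps / 2)) as [N1 H1]; [lra|].
  destruct (Hv (eps / 2)) as [N2 H2]; [lra|].
  exists (max N1 N2). intros n Hn.
  replace (csum (fun n => u n + v n)%C n) with (csum u n + csum v n)%C.
  - replace (csum u n + csum v n - (l + m))%C
      with ((csum u n - l) + (csum v n - m))%C by ring.
    eapply Rle_lt_trans; [apply Cmod_triangle|].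
    specialize (H1 n ltac:(lia)). specialize (H2 n ltac:(lia)). lra.
  - clear. induction n as [|n IH]; simpl; [ring|]. rewrite <- IH. ring.
Qed.

Lemma sums_to_Cmult (u : nat -> C) (c l : C) :
  sums_to u l -> sums_to (fun n => c * u n)%C (c * l)%C.
Proof.
  intros Hu eps He. assert (P := Cmod_ge_0 c).
  destruct (Hu (eps / (Cmod c + 1))) as [N HN].
  { apply Rdiv_lt_0_compat; lra. }
  exists N. intros n Hn. specialize (HN n Hn).
  replace (csum (fun n => c * u n)%C n) with (c * csum u n)%C.
  - replace (c * csum u n - c * l)%C with (c * (csum u n - l))%C by ring.
    rewrite Cmod_mult. apply Rlt_div_r in HN; [|lra].
    assert (P' := Cmod_ge_0 (csum u n - l)%C). nra.
  - clear. induction n as [|n IH]; simpl; [ring|]. rewrite <- IH. ring.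
Qed.

Lemma sums_to_unique (u : nat -> C) (l m : C) :
  sums_to u l -> sums_to u m -> l = m.
Proof.
  intros Hl Hm. apply Cmod_small_eq. intros eps He.
  destruct (Hl (eps / 2)) as [N1 H1]; [lra|].
  destruct (Hm (eps / 2)) as [N2 H2]; [lra|].
  specialize (H1 (max N1 N2) ltac:(lia)). specialize (H2 (max N1 N2) ltac:(lia)).
  rewrite Cmod_minus_sym in H1.
  replace (l - m)%C with ((l - csum u (max N1 N2)) + (csum u (max N1 N2) - m))%C by ring.
  eapply Rle_trans; [apply Cmod_triangle|]. lra.
Qed.

Lemma sums_to_S (u : nat -> C) (l : C) :
  sums_to (fun n => u (S n)) l -> sums_to u (u 0%nat + l)%C.
Proof.
  intros H eps He. destruct (H eps He) as [N HN]. exists (S N).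
  intros [|n] Hn; [lia|]. rewrite csum_S.
  replace (u 0%nat + csum (fun k => u (S k)) n - (u 0%nat + l))%C
    with (csum (fun k => u (S k)) n - l)%C by ring. apply HN. lia.
Qed.

Lemma sums_to_0 : sums_to (fun _ => RtoC 0) (RtoC 0).
Proof.
  intros eps He. exists 0%nat. intros n _.
  replace (csum (fun _ => RtoC 0) n - RtoC 0)%C with (RtoC 0).
  - now rewrite Cmod_0.
  - induction n as [|n IH]; simpl; [ring|]. rewrite IH at 1. ring.
Qed.

Lemma geometric_sums_to (u : nat -> C) (M q : R) :
  0 <= q < 1 -> (forall n, Cmod (u n) <= M * q ^ n) -> exists l, sums_to u l.
Proof.
  intros Hq HM.
  assert (Hg : ex_series (fun n => M * q ^ n)).
  { apply (ex_series_scal (V := R_NormedModule) M (fun n => q ^ n)).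
    apply ex_series_geom. rewrite Rabs_pos_eq; lra. }
  assert (Hex : forall g : C -> R, (forall z, Rabs (g z) <= Cmod z) ->
             ex_series (fun n => g (u n))).
  { intros g Hgz. apply (ex_series_le (V := R_CompleteNormedModule) _ (fun n => M * q ^ n));
      [|exact Hg]. intros n. eapply Rle_trans; [apply Hgz|apply HM]. }
  destruct (Hex Re re_le_Cmod) as [x Hx].
  assert (HIm : forall z, Rabs (Im z) <= Cmod z).
  { intros z. eapply Rle_trans; [apply Rmax_r|apply Rmax_Cmod]. }
  destruct (Hex Im HIm) as [y Hy].
  exists (x, y). intros eps He.
  assert (Lx : is_lim_seq (sum_n (fun n => Re (u n))) x) by exact Hx.
  assert (Ly : is_lim_seq (sum_n (fun n => Im (u n))) y) by exact Hy.
  apply is_lim_seq_Reals in Lx. apply is_lim_seq_Reals in Ly.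
  destruct (Lx (eps / 2)) as [N1 H1]; [lra|].
  destruct (Ly (eps / 2)) as [N2 H2]; [lra|].
  exists (S (max N1 N2)). intros [|n] Hn; [lia|].
  assert (E1 : Re (csum u (S n)) = sum_n (fun n => Re (u n)) n).
  { clear. induction n as [|n IH].
    - rewrite sum_O. simpl. unfold Re; simpl. ring.
    - rewrite sum_Sn, <- IH. reflexivity. }
  assert (E2 : Im (csum u (S n)) = sum_n (fun n => Im (u n)) n).
  { clear. induction n as [|n IH].
    - rewrite sum_O. simpl. unfold Im; simpl. ring.
    - rewrite sum_Sn, <- IH. reflexivity. }
  eapply Rle_lt_trans; [apply Cmod_le_Re_Im|].
  replace (Re (csum u (S n) - (x, y))%C) with (Re (csum u (S n)) - x)
    by (unfold Re; simpl; ring).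
  replace (Im (csum u (S n) - (x, y))%C) with (Im (csum u (S n)) - y)
    by (unfold Im; simpl; ring).
  rewrite E1, E2. specialize (H1 n ltac:(lia)). specialize (H2 n ltac:(lia)).
  unfold Rdist in *. lra.
Qed.

(** For coefficients this is equivalent to a radius of convergence of at least [1], and it is
    manifestly stable under the termwise operations below. *)
Definition coef_bounded (c : nat -> C) : Prop :=
  forall r, 0 < r < 1 -> exists M, forall n, Cmod (c n) * r ^ n <= M.

Definition power_series (c : nat -> C) (f : C -> C) : Prop :=
  coef_bounded c /\
  forall z, Cmod z < 1 -> sums_to (fun n => c n * z ^ n)%C (f z).

(** Outside the disk of convergence the value is arbitrary. *)
Definition psum (c : nat -> C) (z : C) : C :=
  epsilon (inhabits (RtoC 0)) (fun l => sums_to (fun n => c n * z ^ n)%C l).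

Lemma psum_power_series (c : nat -> C) : coef_bounded c -> power_series c (psum c).
Proof.
  intros Hc. split; [exact Hc|]. intros z Hz. assert (P := Cmod_ge_0 z).
  unfold psum. apply epsilon_spec. set (r := (1 + Cmod z) / 2).
  destruct (Hc r) as [M HM]; [unfold r; lra|].
  apply (geometric_sums_to _ M (Cmod z / r)).
  - split; [apply Rdiv_le_0_compat; unfold r; lra|].
    apply Rlt_div_l; unfold r; lra.
  - intros n. rewrite Cmod_mult, Cmod_pow.
    replace (Cmod (c n) * Cmod z ^ n) with (Cmod (c n) * r ^ n * (Cmod z / r) ^ n).
    + apply Rmult_le_compat_r; [|apply HM].
      apply pow_le, Rdiv_le_0_compat; unfold r; lra.
    + rewrite Rmult_assoc, <- Rpow_mult_distr. do 2 f_equal. field. unfold r; lra.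
Qed.

Lemma succ_pow_bound (q : R) (n : nat) :
  0 <= q < 1 -> (INR n + 1) * q ^ n * (1 - q) <= 1.
Proof.
  intros Hq. assert (Pq : 0 <= q ^ n) by (apply pow_le; lra).
  assert (H : (INR n + 1) * q ^ n * (1 - q) <= 1 - q ^ S n); [|simpl in H; nra].
  clear Pq. induction n as [|n IH]; [simpl; lra|].
  rewrite S_INR. set (x := q ^ S n) in *.
  assert (Hx : 0 <= x <= 1).
  { split; [apply pow_le; lra|]. unfold x. rewrite <- (pow1 (S n)).
    apply pow_incr. lra. }
  replace ((INR n + 1 + 1) * x * (1 - q))
    with (q * ((INR n + 1) * q ^ n * (1 - q)) + x * (1 - q)) by (unfold x; simpl; ring).
  change (q ^ S (S n)) with (q * x). nra.
Qed.

Lemma rsum_le (u v : nat -> R) (n : nat) :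
  (forall k, u k <= v k) -> rsum u n <= rsum v n.
Proof. intros H. induction n as [|n IH]; simpl; [lra|]. specialize (H n). lra. Qed.

Lemma rsum_scal (a : R) (u : nat -> R) (n : nat) :
  rsum (fun k => a * u k) n = a * rsum u n.
Proof. induction n as [|n IH]; simpl; [ring|]. rewrite IH. ring. Qed.

Lemma rsum_geom_bound (q : R) (n : nat) :
  0 <= q < 1 -> rsum (fun k => q ^ k) n <= / (1 - q).
Proof.
  intros Hq. apply Rmult_le_reg_r with (1 - q); [lra|].
  rewrite Rinv_l by lra.
  assert (E : rsum (fun k => q ^ k) n * (1 - q) = 1 - q ^ n).
  { induction n as [|n IH]; simpl; [ring|]. rewrite Rmult_plus_distr_r, IH. ring. }
  rewrite E. assert (0 <= q ^ n) by (apply pow_le; lra). lra.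
Qed.

Lemma rsum_square_geom_bound (q : R) :
  0 <= q < 1 -> exists K, forall n, rsum (fun k => INR k * INR k * q ^ k) n <= K.
Proof.
  (* Write [q = t^4]: two of the factors absorb [k^2], and the other two leave a geometric
     series. *)
  intros Hq. set (s := sqrt q). set (t := sqrt s).
  assert (Hs : 0 <= s < 1).
  { split; [apply sqrt_pos|]. unfold s. rewrite <- sqrt_1. apply sqrt_lt_1; lra. }
  assert (Ht : 0 <= t < 1).
  { split; [apply sqrt_pos|]. unfold t. rewrite <- sqrt_1. apply sqrt_lt_1; lra. }
  assert (Es : s * s = q) by (apply sqrt_sqrt; lra).
  assert (Et : t * t = s) by (apply sqrt_sqrt; lra).
  set (B := / (1 - t)).
  assert (HB : forall k, INR k * t ^ k <= B).
  { intros k. assert (H := succ_pow_bound t k Ht).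
    assert (0 <= t ^ k) by (apply pow_le; lra).
    unfold B. apply Rmult_le_reg_r with (1 - t); [lra|]. rewrite Rinv_l by lra. nra. }
  exists (B * B * / (1 - s)). intros n.
  apply Rle_trans with (rsum (fun k => (B * B) * s ^ k) n).
  - apply rsum_le. intros k. rewrite <- Es, Rpow_mult_distr.
    rewrite <- Et at 1. rewrite Rpow_mult_distr.
    replace (INR k * INR k * (t ^ k * t ^ k * s ^ k))
      with ((INR k * t ^ k) * (INR k * t ^ k) * s ^ k) by ring.
    apply Rmult_le_compat_r; [apply pow_le; lra|].
    assert (0 <= INR k * t ^ k) by (apply Rmult_le_pos; [apply pos_INR|apply pow_le; lra]).
    specialize (HB k). apply Rmult_le_compat; lra.
  - rewrite rsum_scal. apply Rmult_le_compat_l; [|now apply rsum_geom_bound].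
    apply Rle_0_sqr.
Qed.

Definition derive_coef (c : nat -> C) (n : nat) : C := (RtoC (INR (S n)) * c (S n))%C.

Lemma coef_bounded_derive (c : nat -> C) :
  coef_bounded c -> coef_bounded (derive_coef c).
Proof.
  intros Hc r Hr. set (r' := (1 + r) / 2).
  destruct (Hc r') as [M HM]; [unfold r'; lra|]. set (q := r / r').
  assert (Hq : 0 <= q < 1).
  { split; [apply Rdiv_le_0_compat|apply Rlt_div_l]; unfold r'; lra. }
  exists (M / r' * / (1 - q)). intros n.
  unfold derive_coef. rewrite Cmod_mult, Cmod_R, Rabs_pos_eq by apply pos_INR.
  assert (Hr' : 0 < r' < 1) by (unfold r'; lra).
  assert (Hpow : r ^ n = q ^ n * r' ^ n).
  { rewrite <- Rpow_mult_distr. f_equal. unfold q. field. lra. }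
  rewrite S_INR, Hpow.
  replace ((INR n + 1) * Cmod (c (S n)) * (q ^ n * r' ^ n))
    with ((Cmod (c (S n)) * r' ^ S n / r') * ((INR n + 1) * q ^ n))
    by (simpl; field; lra).
  apply Rmult_le_compat.
  - apply Rdiv_le_0_compat; [|lra].
    apply Rmult_le_pos; [apply Cmod_ge_0|apply pow_le; lra].
  - apply Rmult_le_pos; [generalize (pos_INR n); lra|apply pow_le; lra].
  - apply Rmult_le_compat_r; [|apply HM]. apply Rlt_le, Rinv_0_lt_compat; lra.
  - apply Rmult_le_reg_r with (1 - q); [lra|]. rewrite Rinv_l by lra.
    now apply succ_pow_bound.
Qed.

(** The error of the linear approximation of [z^n] satisfies
    [D (n + 1) = w D n + n z^(n-1) (w - z)^2], from which the bound follows by induction.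
    The factor [rho ^ 2] keeps the exponent on the right from becoming negative. *)
Lemma pow_second_order (z w : C) (rho : R) (n : nat) :
  0 < rho -> Cmod z <= rho -> Cmod w <= rho ->
  Cmod (w ^ n - z ^ n - (w - z) * (RtoC (INR n) * z ^ (n - 1)))%C * rho ^ 2
  <= INR n * INR n * rho ^ n * Cmod (w - z)%C ^ 2.
Proof.
  intros Hr Hz Hw. set (h := (w - z)%C).
  induction n as [|n IH].
  - simpl. replace (RtoC 1 - RtoC 1 - h * (RtoC 0 * RtoC 1))%C with (RtoC 0) by ring.
    rewrite Cmod_0. lra.
  - set (D := (w ^ n - z ^ n - h * (RtoC (INR n) * z ^ (n - 1)))%C) in *.
    assert (E : (w ^ S n - z ^ S n - h * (RtoC (INR (S n)) * z ^ (S n - 1)))%C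
       = (w * D + RtoC (INR n) * z ^ (n - 1) * (h * h))%C).
    { unfold D. rewrite S_INR, RtoC_plus. simpl Nat.sub. rewrite Nat.sub_0_r.
      destruct n as [|n]; [simpl; unfold h; ring|].
      simpl Nat.sub. rewrite Nat.sub_0_r. rewrite !Cpow_S. unfold h. ring. }
    rewrite E. clear E.
    assert (Pn := pos_INR n). assert (PD := Cmod_ge_0 D). assert (Ph := Cmod_ge_0 h).
    assert (Prn : 0 <= rho ^ n) by (apply pow_le; lra).
    assert (Pr2 : 0 <= rho ^ 2) by (apply pow_le; lra).
    assert (Hp : INR n * Cmod z ^ (n - 1) * rho ^ 2 <= INR n * (rho * rho ^ n)).
    { destruct n as [|n]; [simpl; lra|].
      replace (S n - 1)%nat with n by lia. rewrite Rmult_assoc.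
      apply Rmult_le_compat_l; [lra|].
      replace (rho * rho ^ S n) with (rho ^ n * rho ^ 2) by (simpl; ring).
      apply Rmult_le_compat_r; [lra|]. apply pow_incr. split; [apply Cmod_ge_0|lra]. }
    apply Rle_trans with ((Cmod w * Cmod D + INR n * Cmod z ^ (n - 1)
       * (Cmod h * Cmod h)) * rho ^ 2).
    { apply Rmult_le_compat_r; [lra|]. eapply Rle_trans; [apply Cmod_triangle|].
      rewrite !Cmod_mult, Cmod_R, Cmod_pow, Rabs_pos_eq by lra. lra. }
    apply Rle_trans with (rho * (INR n * INR n * rho ^ n * Cmod h ^ 2)
       + INR n * (rho * rho ^ n) * (Cmod h * Cmod h)).
    { rewrite Rmult_plus_distr_r. apply Rplus_le_compat.
      - rewrite Rmult_assoc. apply Rmult_le_compat; try lra; [apply Cmod_ge_0|].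
        apply Rmult_le_pos; lra.
      - replace (INR n * Cmod z ^ (n - 1) * (Cmod h * Cmod h) * rho ^ 2)
          with (INR n * Cmod z ^ (n - 1) * rho ^ 2 * (Cmod h * Cmod h)) by ring.
        apply Rmult_le_compat_r; [nra|exact Hp]. }
    rewrite S_INR.
    replace (rho * (INR n * INR n * rho ^ n * Cmod h ^ 2)
       + INR n * (rho * rho ^ n) * (Cmod h * Cmod h))
      with ((INR n * INR n + INR n) * (rho ^ S n * Cmod h ^ 2)) by (simpl; ring).
    rewrite (Rmult_assoc ((INR n + 1) * (INR n + 1))).
    apply Rmult_le_compat_r; [|nra].
    apply Rmult_le_pos; [apply pow_le; lra|apply pow2_ge_0].
Qed.

(** Summing [pow_second_order] against the coefficients bounds the error of the
    termwise linear approximation by a constant times [|w - z|^2]. *)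
Theorem power_series_derive (c : nat -> C) (f g : C -> C) (z : C) :
  power_series c f -> power_series (derive_coef c) g -> Cmod z < 1 ->
  is_Cderive f z (g z).
Proof.
  intros [Hc Hf] [_ Hg] Hz. assert (Pz := Cmod_ge_0 z).
  (* Points near [z] stay in the disk of radius [rho], and the coefficients are controlled
     on the larger circle of radius [r]. *)
  set (rho := (1 + Cmod z) / 2). set (r := (1 + rho) / 2). set (q := rho / r).
  assert (Hrho : 0 < rho < 1) by (unfold rho; lra).
  assert (Hr : rho < r < 1) by (unfold r; lra).
  assert (Hq : 0 <= q < 1).
  { split; [apply Rdiv_le_0_compat|apply Rlt_div_l]; lra. }
  destruct (Hc r) as [M HM]; [lra|].
  assert (PM : 0 <= M).
  { eapply Rle_trans; [|apply (HM 0%nat)]. simpl. rewrite Rmult_1_r. apply Cmod_ge_0. }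
  destruct (rsum_square_geom_bound q Hq) as [K HK].
  assert (PK : 0 <= K) by apply (HK 0%nat).
  set (B := M / rho ^ 2 * K).
  assert (Pr2 : 0 < rho ^ 2) by (apply pow_lt; lra).
  assert (PB : 0 <= B).
  { apply Rmult_le_pos; [apply Rdiv_le_0_compat|]; lra. }
  assert (Main : forall w, Cmod w <= rho ->
     Cmod (f w - f z - (w - z) * g z) <= B * Cmod (w - z) ^ 2).
  { intros w Hw. set (h := (w - z)%C).
    pose (u := fun n => ((c n * w ^ n + (- RtoC 1) * (c n * z ^ n))
       + (- h) * (c n * (RtoC (INR n) * z ^ (n - 1))))%C).
    assert (Hu : sums_to u (f w - f z - h * g z)%C).
    { replace (f w - f z - h * g z)%C
        with ((f w + (- RtoC 1) * f z) + (- h) * g z)%C by ring.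
      apply sums_to_plus; [apply sums_to_plus|].
      - apply Hf; lra.
      - apply sums_to_Cmult, Hf; lra.
      - apply sums_to_Cmult.
        replace (g z) with (c 0%nat * (RtoC (INR 0) * z ^ (0 - 1)) + g z)%C
          by (simpl; ring).
        apply (sums_to_S (fun n => c n * (RtoC (INR n) * z ^ (n - 1)))%C).
        eapply sums_to_ext; [|apply Hg, Hz]. intros n. unfold derive_coef.
        replace (S n - 1)%nat with n by lia. ring. }
    apply (sums_to_bound u); [exact Hu|]. intros n.
    eapply Rle_trans.
    - apply (Cmod_csum_le _
        (fun k => (M / rho ^ 2 * Cmod h ^ 2) * (INR k * INR k * q ^ k))).
      intros k. assert (T := pow_second_order z w rho k).
      fold h in T. unfold u.
      replace (c k * w ^ k + (- RtoC 1) * (c k * z ^ k)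
         + - h * (c k * (RtoC (INR k) * z ^ (k - 1))))%C
        with (c k * (w ^ k - z ^ k - h * (RtoC (INR k) * z ^ (k - 1))))%C
        by ring.
      rewrite Cmod_mult.
      set (D := Cmod (w ^ k - z ^ k - h * (RtoC (INR k) * z ^ (k - 1)))%C) in *.
      assert (T' : D <= INR k * INR k * rho ^ k * Cmod h ^ 2 / rho ^ 2).
      { apply Rle_div_r; [exact Pr2|]. apply T; unfold rho in *; lra. }
      apply Rle_trans with (Cmod (c k) * (INR k * INR k * rho ^ k * Cmod h ^ 2 / rho ^ 2)).
      { apply Rmult_le_compat_l; [apply Cmod_ge_0|exact T']. }
      assert (Hpow : rho ^ k = q ^ k * r ^ k).
      { rewrite <- Rpow_mult_distr. f_equal. unfold q. field. lra. }
      rewrite Hpow.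
      replace (Cmod (c k) * (INR k * INR k * (q ^ k * r ^ k) * Cmod h ^ 2 / rho ^ 2))
        with (Cmod (c k) * r ^ k * (Cmod h ^ 2 / rho ^ 2 * (INR k * INR k * q ^ k)))
        by (field; lra).
      replace (M / rho ^ 2 * Cmod h ^ 2 * (INR k * INR k * q ^ k))
        with (M * (Cmod h ^ 2 / rho ^ 2 * (INR k * INR k * q ^ k))) by (field; lra).
      apply Rmult_le_compat_r; [|apply HM].
      apply Rmult_le_pos.
      + apply Rdiv_le_0_compat; [apply pow2_ge_0|exact Pr2].
      + apply Rmult_le_pos; [apply Rmult_le_pos; apply pos_INR|apply pow_le; lra].
    - rewrite rsum_scal. unfold B. rewrite Rmult_assoc, (Rmult_comm (Cmod h ^ 2)).
      rewrite <- Rmult_assoc. apply Rmult_le_compat_r; [apply pow2_ge_0|].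
      apply Rmult_le_compat_l; [apply Rdiv_le_0_compat; lra|]. apply HK. }
  apply is_Cderive_iff. intros eps He.
  exists (Rmin (rho - Cmod z) (eps / (B + 1))). split.
  { apply Rmin_pos; [unfold rho; lra|]. apply Rdiv_lt_0_compat; lra. }
  intros w Hw.
  assert (H1 := Rlt_le_trans _ _ _ Hw (Rmin_l _ _)).
  assert (H2 := Rlt_le_trans _ _ _ Hw (Rmin_r _ _)).
  apply Rlt_div_r in H2; [|lra].
  eapply Rle_trans; [apply Main|].
  - replace w with ((w - z) + z)%C by ring. generalize (Cmod_triangle (w - z) z). lra.
  - assert (P := Cmod_ge_0 (w - z)%C). set (d := Cmod (w - z)%C) in *. nra.
Qed.

Lemma power_series_holomorphic (c : nat -> C) (f : C -> C) :
  power_series c f -> holomorphic_on_disk f.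
Proof.
  intros Hf z Hz. exists (psum (derive_coef c) z).
  apply (power_series_derive c); [exact Hf| |exact Hz].
  apply psum_power_series, coef_bounded_derive, Hf.
Qed.

Lemma power_series_at_0 (c : nat -> C) (f : C -> C) :
  power_series c f -> f (RtoC 0) = c 0%nat.
Proof.
  intros [_ Hf]. apply (sums_to_unique (fun n => c n * RtoC 0 ^ n)%C).
  - apply Hf. rewrite Cmod_0. lra.
  - replace (c 0%nat) with (c 0%nat * RtoC 0 ^ 0 + RtoC 0)%C by (simpl; ring).
    apply (sums_to_S (fun n => c n * RtoC 0 ^ n)%C).
    eapply sums_to_ext; [|apply sums_to_0]. intros n. simpl. ring.
Qed.

Lemma csum_telescope (E u : nat -> C) (n : nat) :
  (forall k, (E k - E (S k) = u k)%C) -> csum u n = (E 0%nat - E n)%C.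
Proof.
  intros H. induction n as [|n IH]; simpl; [ring|]. rewrite IH, <- H. ring.
Qed.

(** Expanding the kernel of Cauchy's formula in a finite geometric series gives the
    partial sums of the Taylor series, with a remainder [E n] that decays like
    [(|a| / r)^n]. The coefficients are the same for all circles by
    [circ_int_holomorphic], so one series serves the whole disk. *)
Theorem taylor_expansion (f : C -> C) :
  holomorphic_on_disk f -> exists c, power_series c f.
Proof.
  intros Hf. assert (Hpi := two_PI_pos).
  set (k := (/ RtoC (2 * PI))%C).
  assert (Hk : RtoC (2 * PI) <> RtoC 0).
  { apply Cmod_gt_0. rewrite Cmod_R, Rabs_pos_eq; lra. }
  pose (c := fun n => (k * circ_int (fun z => f z * / (z ^ n)) (1 / 2))%C).
  assert (Hd : forall n z, 0 < Cmod z < 1 -> ex_Cderive (fun z => f z * / (z ^ n))%C z).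
  { intros n z Hz. apply ex_Cderive_mult; [apply Hf; unfold unit_disk; lra|].
    destruct (ex_Cderive_pow (fun w => w) n z) as [l Hl].
    { eexists. apply is_Cderive_id. }
    eexists. apply is_Cderive_inv; [exact Hl|]. apply Cpow_nz, Cmod_gt_0. lra. }
  assert (Hc : forall r n, 0 < r < 1 ->
                 c n = (k * circ_int (fun z => f z * / (z ^ n)) r)%C).
  { intros r n Hr. unfold c. f_equal.
    destruct (Rtotal_order r (1 / 2)) as [H|[->|H]]; [|reflexivity|].
    - symmetry. apply circ_int_holomorphic; try lra. intros z Hz. apply Hd. lra.
    - apply circ_int_holomorphic; try lra. intros z Hz. apply Hd. lra. }
  assert (Cf : forall r, 0 < r < 1 -> continuous_on_circ f r).
  { intros r Hr z Hz. apply holomorphic_continuous; [exact Hf|lra]. }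
  exists c. split.
  - intros r Hr. destruct (circle_max f r) as [z0 [_ HM]]; [lra|now apply Cf|].
    exists (Cmod (f z0)). intros n. rewrite (Hc r n Hr).
    assert (Prn : 0 < r ^ n) by (apply pow_lt; lra).
    rewrite Cmod_mult. unfold k. rewrite Cmod_inv, Cmod_R, Rabs_pos_eq by (auto; lra).
    assert (B : Cmod (circ_int (fun z => f z * / (z ^ n))%C r)
                <= 2 * PI * (Cmod (f z0) * / r ^ n)).
    { apply circ_int_bound; [lra| |].
      - intros z Hz. apply ex_Cderive_continuous, Hd. lra.
      - intros z Hz. rewrite Cmod_mult, Cmod_inv, Cmod_pow, Hz
          by (apply Cpow_nz, Cmod_gt_0; lra).
        apply Rmult_le_compat_r; [apply Rlt_le, Rinv_0_lt_compat; auto|auto]. }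
    apply Rle_trans with (/ (2 * PI) * (2 * PI * (Cmod (f z0) * / r ^ n)) * r ^ n).
    + apply Rmult_le_compat_r; [lra|]. apply Rmult_le_compat_l; [|exact B].
      apply Rlt_le, Rinv_0_lt_compat, Hpi.
    + right. field. split; [lra|apply PI_neq0].
  - intros a Ha. assert (Pa := Cmod_ge_0 a).
    set (r := (1 + Cmod a) / 2).
    assert (Hr : Cmod a < r < 1) by (unfold r; lra).
    assert (Hr0 : 0 < r < 1) by lra.
    destruct (circle_max f r) as [z0 [_ HM]]; [lra|now apply Cf|].
    (* Up to the factor [k], the remainder after [n] terms. *)
    pose (E := fun n => circ_int (fun z => (f z * (z / (z - a))) * (a / z) ^ n)%C r).
    assert (Dk : forall z, Cmod z = r -> ex_Cderive (fun z => f z * (z / (z - a)))%C z).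
    { intros z Hz. apply ex_Cderive_mult; [apply Hf; unfold unit_disk; lra|].
      apply ex_Cderive_kernel. intros E'. subst z. lra. }
    assert (Dq : forall n z, Cmod z = r -> ex_Cderive (fun z => (a / z) ^ n)%C z).
    { intros n z Hz. apply ex_Cderive_pow. eexists. apply is_Cderive_div.
      - apply is_Cderive_const. - apply is_Cderive_id.
      - apply Cmod_gt_0. lra. }
    assert (CE : forall n, continuous_on_circ
              (fun z => (f z * (z / (z - a))) * (a / z) ^ n)%C r).
    { intros n z Hz. apply ex_Cderive_continuous, ex_Cderive_mult; auto. }
    assert (Step : forall n, (k * E n - k * E (S n) = c n * a ^ n)%C).
    { intros n. rewrite (Hc r n Hr0).
      replace (k * circ_int (fun z => f z * / (z ^ n)) r * a ^ n)%C
        with (k * (a ^ n * circ_int (fun z => f z * / (z ^ n)) r))%C by ring.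
      rewrite <- circ_int_Cmult; [|lra|].
      2:{ intros z Hz. apply ex_Cderive_continuous, Hd. lra. }
      replace (k * E n - k * E (S n))%C with (k * (E n - E (S n)))%C by ring.
      f_equal. unfold E. rewrite <- circ_int_minus by (auto; lra).
      apply circ_int_ext; [lra|]. intros z Hz.
      assert (Hz0 : z <> RtoC 0) by (apply Cmod_gt_0; lra).
      assert (Hza : (z - a)%C <> RtoC 0) by (apply Cminus_neq_0_Cmod; lra).
      unfold Cdiv. rewrite Cpow_S, Cpow_mult_l, Cpow_inv by auto.
      assert (Hzn := Cpow_nz z n Hz0). field. auto. }
    assert (E0 : (k * E 0%nat = f a)%C).
    { unfold E.
      rewrite (circ_int_ext _ (fun z => f z * (z / (z - a)))%C);
        [|lra|intros z _; simpl; ring].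
      rewrite (cauchy_formula f a r Hf) by lra. unfold k. field. exact Hk. }
    set (M := Cmod (f z0)). set (q := Cmod a / r).
    assert (Hq : 0 <= q < 1).
    { split; [apply Rdiv_le_0_compat|apply Rlt_div_l]; lra. }
    set (B := M * (r / (r - Cmod a))).
    assert (PB : 0 <= B).
    { apply Rmult_le_pos; [apply Cmod_ge_0|]. apply Rdiv_le_0_compat; lra. }
    assert (Bd : forall n, Cmod (k * E n) <= B * q ^ n).
    { intros n. rewrite Cmod_mult. unfold k.
      rewrite Cmod_inv, Cmod_R, Rabs_pos_eq by (auto; lra).
      assert (BE : Cmod (E n) <= 2 * PI * (B * q ^ n)).
      { unfold E. apply (circ_int_bound _ r (B * q ^ n)); [lra|apply CE|]. intros z Hz.
        assert (Hz0 : z <> RtoC 0) by (apply Cmod_gt_0; lra).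
        assert (Hza : (z - a)%C <> RtoC 0) by (apply Cminus_neq_0_Cmod; lra).
        rewrite !Cmod_mult, Cmod_pow, !Cmod_div, Hz by auto. fold q.
        apply Rmult_le_compat_r; [apply pow_le; lra|]. unfold B.
        apply Rmult_le_compat; [apply Cmod_ge_0| |now apply HM|].
        - apply Rdiv_le_0_compat; [lra|now apply Cmod_gt_0].
        - apply Rmult_le_compat_l; [lra|]. apply Rinv_le_contravar; [lra|].
          rewrite <- Hz. apply Cmod_triangle_minus. }
      apply Rle_trans with (/ (2 * PI) * (2 * PI * (B * q ^ n))).
      - apply Rmult_le_compat_l; [|exact BE]. apply Rlt_le, Rinv_0_lt_compat, Hpi.
      - right. field. apply PI_neq0. }
    intros eps He.
    destruct (pow_lt_1_zero q) with (y := eps / (B + 1)) as [N HN].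
    { rewrite Rabs_pos_eq; lra. } { apply Rdiv_lt_0_compat; lra. }
    exists N. intros n Hn. specialize (HN n Hn).
    assert (Pq : 0 <= q ^ n) by (apply pow_le; lra).
    rewrite Rabs_pos_eq in HN by exact Pq. apply Rlt_div_r in HN; [|lra].
    rewrite (csum_telescope (fun n => k * E n)%C) by exact Step. rewrite E0.
    replace (f a - k * E n - f a)%C with (- (k * E n))%C by ring.
    rewrite Cmod_opp. eapply Rle_lt_trans; [apply Bd|]. nra.
Qed.

(** * Closure properties of holomorphic functions *)

Lemma holomorphic_is_Cderive (f : C -> C) (z : C) :
  holomorphic_on_disk f -> Cmod z < 1 -> is_Cderive f z (C_derive f z).
Proof. intros Hf Hz. apply C_derive_correct; [exact z|]. now apply Hf. Qed.

Lemma is_Cderive_ext_disk (f g : C -> C) (z l : C) :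
  Cmod z < 1 -> (forall w, Cmod w < 1 -> f w = g w) ->
  is_Cderive f z l -> is_Cderive g z l.
Proof.
  intros Hz H. apply (is_Cderive_ext_ball f g z l (1 - Cmod z)); [lra|].
  intros w Hw. apply H. replace w with ((w - z) + z)%C by ring.
  generalize (Cmod_triangle (w - z) z). lra.
Qed.

Lemma holomorphic_derive (f : C -> C) :
  holomorphic_on_disk f -> holomorphic_on_disk (C_derive f).
Proof.
  intros Hf. destruct (taylor_expansion f Hf) as [c Hc].
  assert (Hg := psum_power_series _ (coef_bounded_derive c (proj1 Hc))).
  assert (Hhol := power_series_holomorphic _ _ Hg).
  intros z Hz. destruct (Hhol z Hz) as [l Hl]. exists l.
  apply (is_Cderive_ext_disk (psum (derive_coef c))); [exact Hz| |exact Hl].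
  intros w Hw. symmetry. apply is_C_derive_unique.
  now apply (power_series_derive c).
Qed.

(** Removal of a zero at the origin, by a shift of the Taylor coefficients. *)
Lemma holomorphic_div_id (f : C -> C) :
  holomorphic_on_disk f -> f (RtoC 0) = RtoC 0 ->
  exists p, holomorphic_on_disk p /\ forall z, Cmod z < 1 -> f z = (z * p z)%C.
Proof.
  intros Hf H0. destruct (taylor_expansion f Hf) as [c Hc].
  assert (Hc0 := power_series_at_0 c f Hc). rewrite H0 in Hc0.
  assert (Hb : coef_bounded (fun n => c (S n))).
  { intros r Hr. destruct (proj1 Hc r Hr) as [M HM]. exists (M / r). intros n.
    apply (proj1 (Rle_div_r _ M r (proj1 Hr))). rewrite Rmult_assoc, (Rmult_comm _ r).
    apply (HM (S n)). }
  assert (Hp := psum_power_series _ Hb). exists (psum (fun n => c (S n))). split.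
  - eapply power_series_holomorphic, Hp.
  - intros z Hz. apply (sums_to_unique (fun n => c n * z ^ n)%C); [now apply Hc|].
    replace (z * psum (fun n => c (S n)) z)%C
      with (c 0%nat * z ^ 0 + z * psum (fun n => c (S n)) z)%C
      by (rewrite <- Hc0; ring).
    apply (sums_to_S (fun n => c n * z ^ n)%C).
    eapply sums_to_ext; [|apply sums_to_Cmult, Hp, Hz].
    intros n. rewrite Cpow_S. ring.
Qed.

Lemma holomorphic_primitive (f : C -> C) :
  holomorphic_on_disk f ->
  exists F, F (RtoC 0) = RtoC 0 /\ forall z, Cmod z < 1 -> is_Cderive F z (f z).
Proof.
  intros Hf. destruct (taylor_expansion f Hf) as [c Hc].
  pose (C' := fun n => match n with O => RtoC 0
     | S m => (/ RtoC (INR (S m)) * c m)%C end).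
  assert (Hn : forall n, RtoC (INR (S n)) <> RtoC 0).
  { intros n. apply Cmod_gt_0. rewrite Cmod_R. apply Rabs_pos_lt.
    apply not_0_INR. lia. }
  assert (Hb : coef_bounded C').
  { intros r Hr. destruct (proj1 Hc r Hr) as [M HM].
    assert (PM : 0 <= M).
    { eapply Rle_trans; [|apply (HM 0%nat)]. simpl. rewrite Rmult_1_r.
      apply Cmod_ge_0. }
    exists M. intros [|n]; unfold C'; [rewrite Cmod_0; lra|].
    rewrite Cmod_mult, Cmod_inv, Cmod_R, Rabs_pos_eq by (auto; apply pos_INR).
    assert (Hi : 1 <= INR (S n)) by (rewrite S_INR; generalize (pos_INR n); lra).
    assert (Hi' : 0 < / INR (S n) <= 1).
    { split; [apply Rinv_0_lt_compat; lra|]. rewrite <- Rinv_1.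
      apply Rinv_le_contravar; lra. }
    specialize (HM n). change (r ^ S n) with (r * r ^ n).
    assert (P : 0 <= Cmod (c n) * r ^ n)
      by (apply Rmult_le_pos; [apply Cmod_ge_0|apply pow_le; lra]).
    replace (/ INR (S n) * Cmod (c n) * (r * r ^ n))
      with ((/ INR (S n) * r) * (Cmod (c n) * r ^ n)) by ring.
    assert (0 <= / INR (S n) * r <= 1) by nra. nra. }
  assert (HF := psum_power_series _ Hb). exists (psum C'). split.
  - now rewrite (power_series_at_0 _ _ HF).
  - intros z Hz. apply (power_series_derive C'); [exact HF| |exact Hz].
    split; [apply coef_bounded_derive, Hb|]. intros w Hw.
    eapply sums_to_ext; [|apply Hc, Hw]. intros n. unfold derive_coef, C'.
    field. apply Hn.
Qed.

(** * The lemmas of Schwarz, Schwarz-Pick and Jack *)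

(** Schwarz's lemma for a function given as [z p z]: on the circle of radius [r] one has
    [|p| <= 1 / r], the maximum modulus principle carries this inside, and [r] tends
    to [1]. *)
Lemma schwarz (p : C -> C) (a : C) :
  holomorphic_on_disk p -> (forall z, Cmod z < 1 -> Cmod (z * p z) <= 1) ->
  Cmod a < 1 -> Cmod (p a) <= 1.
Proof.
  intros Hp Hb Ha. assert (Pa := Cmod_ge_0 a).
  apply Rnot_lt_le. intros Hlt. set (x := Cmod (p a)) in *.
  assert (Hx : / x < 1) by (rewrite <- Rinv_1; apply Rinv_lt_contravar; lra).
  assert (Hx0 : 0 < / x) by (apply Rinv_0_lt_compat; lra).
  (* If [x > 1], this radius lies beyond [a] and satisfies [1 / r < x]. *)
  set (r := (Rmax (Cmod a) (/ x) + 1) / 2).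
  assert (M1 := Rmax_l (Cmod a) (/ x)). assert (M2 := Rmax_r (Cmod a) (/ x)).
  assert (M3 : Rmax (Cmod a) (/ x) < 1) by (apply Rmax_lub_lt; lra).
  assert (Hr : Cmod a < r < 1) by (unfold r; lra).
  assert (K : x <= / r).
  { apply (maximum_modulus p a r); [exact Hp|exact Hr|]. intros z Hz.
    apply Rmult_le_reg_l with r; [lra|]. rewrite Rinv_r by lra.
    rewrite <- Hz at 1. rewrite <- Cmod_mult. apply Hb. lra. }
  assert (/ r < / / x) by (apply Rinv_lt_contravar; [|unfold r; lra];
    apply Rmult_lt_0_compat; lra).
  rewrite Rinv_inv in *. lra.
Qed.

Lemma Cmod_sqr (z : C) : Cmod z * Cmod z = Re z * Re z + Im z * Im z.
Proof. generalize (Cmod2_alt z). simpl. lra. Qed.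

Lemma Cmod_le_iff (z w : C) :
  Re z * Re z + Im z * Im z <= Re w * Re w + Im w * Im w -> Cmod z <= Cmod w.
Proof.
  rewrite <- !Cmod_sqr. intros H.
  assert (P1 := Cmod_ge_0 z). assert (P2 := Cmod_ge_0 w). nra.
Qed.

(** [|1 - c^* u|^2 - |u - c|^2 = (1 - |u|^2) (1 - |c|^2)]. *)
Lemma pick_contraction (u c : C) :
  Cmod u <= 1 -> Cmod c <= 1 -> Cmod (u - c) <= Cmod (RtoC 1 - Cconj c * u).
Proof.
  intros Hu Hc. apply Cmod_le_iff.
  assert (Su := Cmod_sqr u). assert (Sc := Cmod_sqr c).
  assert (Pu := Cmod_ge_0 u). assert (Pc := Cmod_ge_0 c).
  assert (Hu' : Re u * Re u + Im u * Im u <= 1) by nra.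
  assert (Hc' : Re c * Re c + Im c * Im c <= 1) by nra.
  clear -Hu' Hc'. destruct u as [x y], c as [s t]. unfold Re, Im in *; simpl in *.
  assert (K : 0 <= (1 - (x * x + y * y)) * (1 - (s * s + t * t)))
    by (apply Rmult_le_pos; lra).
  lra.
Qed.

(** Schwarz's lemma for [phi] followed by the disk automorphism that moves [phi 0] to [0].
    So that the automorphism is defined also when [|phi 0| = 1], the argument runs for
    [r phi] with [r < 1], and [r] tends to [1] at the end. *)
Lemma schwarz_pick_0 (phi : C -> C) :
  holomorphic_on_disk phi -> (forall z, Cmod z < 1 -> Cmod (phi z) <= 1) ->
  Cmod (C_derive phi (RtoC 0)) <= 1 - Cmod (phi (RtoC 0)) * Cmod (phi (RtoC 0)).
Proof.
  intros Hphi Hb. assert (H0 : Cmod (RtoC 0) < 1) by (rewrite Cmod_0; lra).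
  set (d := C_derive phi (RtoC 0)). set (y := Cmod (phi (RtoC 0))).
  assert (Hd : is_Cderive phi (RtoC 0) d) by now apply holomorphic_is_Cderive.
  assert (Hy : y <= 1) by now apply Hb. assert (Py : 0 <= y) by apply Cmod_ge_0.
  assert (Key : forall r, 0 < r < 1 -> r * Cmod d <= 1 - r * y * (r * y)).
  { intros r Hr. set (c := (RtoC r * phi (RtoC 0))%C).
    assert (Hc : Cmod c = r * y) by (unfold c; rewrite Cmod_mult, Cmod_R, Rabs_pos_eq;
        [reflexivity|lra]).
    assert (Hru : forall z, Cmod z < 1 -> Cmod (RtoC r * phi z) <= r).
    { intros z Hz. rewrite Cmod_mult, Cmod_R, Rabs_pos_eq by lra.
      specialize (Hb z Hz). nra. }
    assert (Hc1 : Cmod c < 1) by (rewrite Hc; nra).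
    assert (Hn : forall z, Cmod z < 1 -> (RtoC 1 - Cconj c * (RtoC r * phi z))%C <> RtoC 0).
    { intros z Hz. apply Cminus_neq_0_Cmod. rewrite Cmod_1, Cmod_mult, Cmod_conj.
      assert (P := Cmod_ge_0 (RtoC r * phi z)%C). assert (P' := Cmod_ge_0 c).
      specialize (Hru z Hz). nra. }
    pose (psi := fun z => ((RtoC r * phi z - c) / (RtoC 1 - Cconj c * (RtoC r * phi z)))%C).
    assert (Dpsi : forall z l, Cmod z < 1 -> is_Cderive phi z l ->
      is_Cderive psi z ((RtoC r * l * (RtoC 1 - Cconj c * (RtoC r * phi z))
         + (RtoC r * phi z - c) * (Cconj c * (RtoC r * l)))
         / ((RtoC 1 - Cconj c * (RtoC r * phi z)) * (RtoC 1 - Cconj c * (RtoC r * phi z))))%C).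
    { intros z l Hz Hl. eapply is_Cderive_eq.
      - apply is_Cderive_div; [| |now apply Hn].
        + apply is_Cderive_minus; [|apply is_Cderive_const].
          apply is_Cderive_mult; [apply is_Cderive_const|exact Hl].
        + apply is_Cderive_minus; [apply is_Cderive_const|].
          apply is_Cderive_mult; [apply is_Cderive_const|].
          apply is_Cderive_mult; [apply is_Cderive_const|exact Hl].
      - cbv beta. field. intros E. apply (Hn z Hz). rewrite <- E. ring. }
    assert (Hpsi : holomorphic_on_disk psi).
    { intros z Hz. destruct (Hphi z Hz) as [l Hl]. eexists. exact (Dpsi z l Hz Hl). }
    assert (Hpsi0 : psi (RtoC 0) = RtoC 0).
    { unfold psi. fold c. replace (c - c)%C with (RtoC 0) by ring.
      unfold Cdiv. apply Cmult_0_l. }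
    destruct (holomorphic_div_id psi Hpsi Hpsi0) as (p & Hp & Ep).
    assert (B : Cmod (p (RtoC 0)) <= 1).
    { apply schwarz; [exact Hp| |exact H0]. intros z Hz. rewrite <- Ep by exact Hz.
      unfold psi. rewrite Cmod_div by now apply Hn.
      apply Rle_div_l; [now apply Cmod_gt_0, Hn|]. rewrite Rmult_1_l.
      apply pick_contraction; [|lra]. specialize (Hru z Hz). lra. }
    assert (E : p (RtoC 0) = (RtoC r * d / (RtoC 1 - Cconj c * c))%C).
    { transitivity (C_derive psi (RtoC 0)).
      - symmetry. apply is_C_derive_unique.
        apply (is_Cderive_ext_disk (fun z => z * p z)%C); [exact H0| |].
        + intros w Hw. now rewrite Ep.
        + destruct (Hp (RtoC 0) H0) as [l Hl]. eapply is_Cderive_eq.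
          * apply is_Cderive_mult; [apply is_Cderive_id|exact Hl].
          * cbv beta. ring.
      - apply is_C_derive_unique. eapply is_Cderive_eq; [exact (Dpsi _ _ H0 Hd)|].
        fold c. field. intros E. apply (Hn (RtoC 0) H0). fold c. rewrite <- E. ring. }
    assert (En : (RtoC 1 - Cconj c * c)%C = RtoC (1 - r * y * (r * y))).
    { rewrite RtoC_minus, Cmult_comm, <- Cmod2_conj, Hc. do 2 f_equal. ring. }
    assert (Pn : 0 < 1 - r * y * (r * y)) by (rewrite <- Hc; assert (P := Cmod_ge_0 c); nra).
    rewrite E, En, Cmod_div, Cmod_mult, !Cmod_R, !Rabs_pos_eq in B;
      try lra.
    - apply Rle_div_l in B; lra.
    - apply Cmod_gt_0. rewrite Cmod_R, Rabs_pos_eq; lra. }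
  assert (Px := Cmod_ge_0 d). set (x := Cmod d) in *.
  (* If the bound failed by [e], it would fail by at least [e / 2] for [r = 1 - t]. *)
  apply Rnot_lt_le. intros Hlt. set (e := x - (1 - y * y)).
  set (t := e / (2 * (x + 2))).
  assert (He : 0 < e <= x) by (unfold e; nra).
  assert (Et : t * (x + 2) = e / 2) by (unfold t; field; lra).
  assert (Ht : 0 < t < 1).
  { unfold t. split; [apply Rdiv_lt_0_compat; lra|]. apply Rlt_div_l; lra. }
  specialize (Key (1 - t) ltac:(lra)). unfold e in *.
  assert (Q : (1 - t) * y * ((1 - t) * y) = y * y - (2 * t - t * t) * (y * y)) by ring.
  assert (Hyy : 0 <= y * y <= 1) by nra. nra.
Qed.

(** The first order condition at a boundary maximum. If [|1 + c h + o(h)| <= 1] for all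
    small [h] that point into the unit disk at [1], then [Re (c h) <= o(h)] in these
    directions. The inner normal gives [Re c >= 0] and the two tangents give [Im c = 0]. *)
Lemma boundary_max_derivative (c : C) :
  (forall eps, 0 < eps -> exists delta, 0 < delta /\
     forall h, Cmod h < delta -> Cmod (RtoC 1 + h) <= 1 ->
       Re (c * h)%C <= eps * Cmod h) ->
  0 <= Re c /\ Im c = 0.
Proof.
  intros H.
  assert (HRe : 0 <= Re c).
  { apply Rnot_lt_le. intros Hlt. destruct (H (- Re c / 2)) as [d [Hd Hc]]; [lra|].
    set (t := Rmin (d / 2) 1).
    assert (T1 := Rmin_l (d / 2) 1). assert (T2 := Rmin_r (d / 2) 1).
    assert (Ht : 0 < t) by (apply Rmin_pos; lra).
    specialize (Hc (RtoC (- t))). rewrite <- RtoC_plus, !Cmod_R in Hc.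
    rewrite re_scal_r in Hc. rewrite Rabs_Ropp in Hc.
    rewrite !Rabs_pos_eq in Hc by (unfold t in *; lra).
    specialize (Hc ltac:(unfold t in *; lra) ltac:(unfold t in *; lra)). nra. }
  split; [exact HRe|].
  assert (HIm : forall s, s * s = 1 -> forall eps, 0 < eps -> - s * Im c <= 3 * eps).
  { intros s Hs eps He. destruct (H eps He) as [d [Hd Hc]].
    set (t := Rmin (d / 3) (Rmin 1 (eps / (Re c + 1)))).
    assert (T1 : t <= d / 3) by apply Rmin_l.
    assert (T2 : t <= 1) by (eapply Rle_trans; [apply Rmin_r|apply Rmin_l]).
    assert (T3 : t <= eps / (Re c + 1)) by (eapply Rle_trans; [apply Rmin_r|apply Rmin_r]).
    assert (Ht : 0 < t).
    { repeat apply Rmin_pos; try lra. apply Rdiv_lt_0_compat; lra. }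
    apply Rle_div_r in T3; [|lra].
    (* A tangential step of length [t], bent inward by [t^2] so as to stay in the disk. *)
    pose (h := (- (t * t), s * t) : C). specialize (Hc h).
    assert (Hh : Cmod h <= 2 * t).
    { eapply Rle_trans; [apply Cmod_le_Re_Im|]. unfold h, Re, Im; simpl.
      rewrite Rabs_Ropp, !Rabs_mult, (Rabs_pos_eq t (Rlt_le _ _ Ht)).
      assert (Rabs s = 1).
      { assert (Rabs s * Rabs s = 1) by (rewrite <- Rabs_mult, Hs, Rabs_R1; ring).
        assert (P := Rabs_pos s). nra. }
      nra. }
    assert (Hcond : Cmod (RtoC 1 + h)%C <= 1).
    { apply Rle_trans with (Cmod (RtoC 1)); [|rewrite Cmod_1; lra].
      apply Cmod_le_iff. unfold h, Re, Im; simpl.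
      replace ((0 + s * t) * (0 + s * t)) with (s * s * (t * t)) by ring.
      rewrite Hs. assert (0 < t * t) by nra. assert (t * t <= 1) by nra. nra. }
    specialize (Hc ltac:(lra) Hcond).
    replace (Re (c * h)%C) with (- Re c * (t * t) - Im c * (s * t)) in Hc
      by (unfold h, Re, Im; simpl; ring).
    assert (Hc' : - Re c * (t * t) - Im c * (s * t) <= eps * (2 * t)) by nra.
    apply Rmult_le_reg_r with t; [exact Ht|]. nra. }
  assert (Hz : forall x, (forall eps, 0 < eps -> x <= 3 * eps) -> x <= 0).
  { intros x Hx. apply Rnot_lt_le. intros Hlt. specialize (Hx (x / 6)). lra. }
  assert (I1 := Hz _ (HIm 1 ltac:(ring))).
  assert (I2 := Hz _ (HIm (-1) ltac:(ring))). lra.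
Qed.

(** Let [omega = z phi] and let [z0] be a point of the
    circle through [z1] where [|phi|] is largest. By the maximum modulus principle it is
    largest on the whole closed disk, so [z0 phi' / phi] is real and nonnegative at [z0];
    and [z omega' / omega = 1 + z phi' / phi]. The point is sought on
    the circle through [z1], and not on the first circle where [|omega|] reaches [1], so the
    conclusion has [1 <= |omega z0|] in place of an equality. *)
Theorem jack (omega : C -> C) (z1 : C) :
  holomorphic_on_disk omega -> omega (RtoC 0) = RtoC 0 ->
  Cmod z1 < 1 -> 1 <= Cmod (omega z1) ->
  exists z0 k, 0 < Cmod z0 < 1 /\ 1 <= Cmod (omega z0) /\ 1 <= k /\
    (z0 * C_derive omega z0 = RtoC k * omega z0)%C.
Proof.
  intros Hw H0 Hz1 H1.
  destruct (holomorphic_div_id omega Hw H0) as (phi & Hphi & E).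
  set (r := Cmod z1) in *.
  assert (Hr : 0 < r).
  { destruct (Cmod_ge_0 z1) as [|E0]; [assumption|]. symmetry in E0.
    rewrite (Cmod_eq_0 _ E0), H0, Cmod_0 in H1. lra. }
  destruct (circle_max phi r) as (z0 & Hz0 & Hmax); [lra| |].
  { intros z Hz. apply holomorphic_continuous; [exact Hphi|lra]. }
  assert (Hm : 1 <= r * Cmod (phi z0)).
  { rewrite E, Cmod_mult in H1 by exact Hz1. fold r in H1.
    specialize (Hmax z1 eq_refl). nra. }
  assert (Hp0 : phi z0 <> RtoC 0).
  { apply Cmod_gt_0. assert (P := Cmod_ge_0 (phi z0)). nra. }
  assert (Hd : Cmod z0 < 1) by lra.
  assert (Hl := holomorphic_is_Cderive phi z0 Hphi Hd).
  set (l := C_derive phi z0) in *. set (c := (z0 * l / phi z0)%C).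
  assert (Hball : forall z, Cmod z <= r -> Cmod (phi z) <= Cmod (phi z0)).
  { intros z [Hz|Hz]; [|now apply Hmax].
    apply (maximum_modulus phi z r); [exact Hphi|lra|exact Hmax]. }
  destruct (boundary_max_derivative c) as [HRe HIm].
  { intros eps He. apply is_Cderive_iff in Hl.
    set (m := Cmod (phi z0)) in *. assert (Pm : 0 < m) by now apply Cmod_gt_0.
    destruct (Hl (eps * m)) as [d [Hdp Happ]]; [nra|].
    exists (d / r). split; [apply Rdiv_lt_0_compat; lra|]. intros h Hh Hh1.
    set (w := (z0 * (RtoC 1 + h))%C).
    assert (Ew : (w - z0 = z0 * h)%C) by (unfold w; ring).
    assert (Nw : Cmod (w - z0) = r * Cmod h) by now rewrite Ew, Cmod_mult, Hz0.
    assert (Ph := Cmod_ge_0 h).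
    apply Rlt_div_r in Hh; [|exact Hr].
    assert (A1 := Happ w ltac:(lra)). rewrite Nw in A1.
    assert (A2 : Cmod (phi w) <= m).
    { apply Hball. unfold w. rewrite Cmod_mult, Hz0. nra. }
    set (err := (phi w - phi z0 - (w - z0) * l)%C) in *.
    assert (Ed : (phi w / phi z0 = RtoC 1 + c * h + err / phi z0)%C).
    { unfold err, c. rewrite Ew. field. exact Hp0. }
    assert (B1 : Cmod (phi w / phi z0) <= 1).
    { rewrite Cmod_div by exact Hp0. fold m. apply Rle_div_l; lra. }
    assert (B2 : Cmod (err / phi z0) <= eps * Cmod h).
    { rewrite Cmod_div by exact Hp0. fold m. apply Rle_div_l; [exact Pm|].
      apply Rle_trans with (1 := A1). assert (0 <= eps * m * Cmod h) by
        (apply Rmult_le_pos; [nra|lra]). nra. }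
    assert (R1 := re_le_Cmod (phi w / phi z0)%C).
    assert (R2 := re_le_Cmod (err / phi z0)%C).
    rewrite Ed, !re_plus, re_RtoC in R1. rewrite <- Ed in R1.
    assert (L1 := Rle_abs (1 + Re (c * h)%C + Re (err / phi z0)%C)).
    assert (L2 := Rle_abs (- Re (err / phi z0)%C)). rewrite Rabs_Ropp in L2.
    lra. }
  exists z0, (1 + Re c). repeat split; try lra.
  - rewrite E, Cmod_mult, Hz0 by exact Hd. exact Hm.
  - assert (Dw : C_derive omega z0 = (phi z0 + z0 * l)%C).
    { apply is_C_derive_unique.
      apply (is_Cderive_ext_disk (fun z => z * phi z)%C); [exact Hd| |].
      - intros w Hw'. now rewrite E.
      - eapply is_Cderive_eq.
        + apply is_Cderive_mult; [apply is_Cderive_id|exact Hl].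
        + cbv beta. ring. }
    rewrite Dw, E by exact Hd.
    assert (Ec : RtoC (1 + Re c) = (RtoC 1 + c)%C).
    { destruct c as [cx cy]. unfold Re, Im in *; simpl in *. subst cy.
      unfold RtoC, Cplus; simpl. f_equal; ring. }
    rewrite Ec. unfold c. field. exact Hp0.
Qed.

(** * The classes in terms of the quotient f(z)/z *)

(** The function [p] is [f z / z] with the singularity at [0] removed; all the classes are
    studied through it. *)
Definition disk_factor (f p : C -> C) : Prop :=
  holomorphic_on_disk p /\ p (RtoC 0) = RtoC 1 /\
  forall z, Cmod z < 1 -> f z = (z * p z)%C.

Lemma Cmod_0_lt_1 : Cmod (RtoC 0) < 1.
Proof. rewrite Cmod_0. lra. Qed.

Lemma disk_factor_derive (f p : C -> C) (z : C) :
  disk_factor f p -> Cmod z < 1 ->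
  is_Cderive f z (p z + z * C_derive p z)%C.
Proof.
  intros (Hp & _ & E) Hz.
  apply (is_Cderive_ext_disk (fun w => w * p w)%C); [exact Hz| |].
  - intros w Hw. now rewrite E.
  - eapply is_Cderive_eq.
    + apply is_Cderive_mult; [apply is_Cderive_id|now apply holomorphic_is_Cderive].
    + cbv beta. ring.
Qed.

Lemma class_A_disk_factor (f : C -> C) :
  class_A f -> exists p, disk_factor f p.
Proof.
  intros (Hf & H0 & H1).
  destruct (holomorphic_div_id f Hf H0) as (p & Hp & E). exists p.
  split; [exact Hp|]. split; [|exact E]. rewrite <- H1. symmetry.
  apply is_C_derive_unique.
  apply (is_Cderive_ext_disk (fun w => w * p w)%C); [exact Cmod_0_lt_1| |].
  - intros w Hw. now rewrite E.
  - eapply is_Cderive_eq.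
    + apply is_Cderive_mult; [apply is_Cderive_id|].
      apply holomorphic_is_Cderive; [exact Hp|exact Cmod_0_lt_1].
    + cbv beta. ring.
Qed.

Lemma disk_factor_class_A (f p : C -> C) : disk_factor f p -> class_A f.
Proof.
  intros H. split; [|split].
  - intros z Hz. eexists. now apply (disk_factor_derive f p).
  - destruct H as (_ & _ & E). rewrite E by exact Cmod_0_lt_1. ring.
  - rewrite (is_C_derive_unique f (RtoC 0) _ (disk_factor_derive f p _ H Cmod_0_lt_1)).
    destruct H as (_ & H1 & _). rewrite H1. ring.
Qed.

Lemma disk_factor_C_derive (f p : C -> C) (z : C) :
  disk_factor f p -> Cmod z < 1 -> C_derive f z = (p z + z * C_derive p z)%C.
Proof. intros H Hz. now apply is_C_derive_unique, disk_factor_derive. Qed.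

Lemma disk_factor_derive_2 (f p : C -> C) (z : C) :
  disk_factor f p -> Cmod z < 1 ->
  is_Cderive (C_derive f) z
    (RtoC 2 * C_derive p z + z * C_derive (C_derive p) z)%C.
Proof.
  intros H Hz. assert (Hp := proj1 H).
  apply (is_Cderive_ext_disk (fun w => p w + w * C_derive p w)%C); [exact Hz| |].
  - intros w Hw. now rewrite (disk_factor_C_derive f p).
  - eapply is_Cderive_eq.
    + apply is_Cderive_plus; [now apply holomorphic_is_Cderive|].
      apply is_Cderive_mult; [apply is_Cderive_id|].
      now apply holomorphic_is_Cderive; [apply holomorphic_derive|].
    + cbv beta. ring.
Qed.

Lemma disk_factor_C_derive_2 (f p : C -> C) (z : C) :
  disk_factor f p -> Cmod z < 1 ->
  C_derive_n f 2 z = (RtoC 2 * C_derive p z + z * C_derive (C_derive p) z)%C.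
Proof. intros H Hz. now apply is_C_derive_unique, disk_factor_derive_2. Qed.

Lemma disk_factor_derive_3 (f p : C -> C) :
  disk_factor f p ->
  is_Cderive (C_derive_n f 2) (RtoC 0) (RtoC 3 * C_derive (C_derive p) (RtoC 0))%C.
Proof.
  intros H. assert (H0 := Cmod_0_lt_1). assert (Hp := proj1 H).
  assert (Hp1 := holomorphic_derive p Hp).
  assert (Hp2 := holomorphic_derive _ Hp1).
  apply (is_Cderive_ext_disk
    (fun w => RtoC 2 * C_derive p w + w * C_derive (C_derive p) w)%C); [exact H0| |].
  - intros w Hw. now rewrite (disk_factor_C_derive_2 f p).
  - eapply is_Cderive_eq.
    + apply is_Cderive_plus.
      * apply is_Cderive_mult; [apply is_Cderive_const|now apply holomorphic_is_Cderive].
      * apply is_Cderive_mult; [apply is_Cderive_id|now apply holomorphic_is_Cderive].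
    + cbv beta. ring.
Qed.

Lemma disk_factor_taylor_2 (f p : C -> C) :
  disk_factor f p -> taylor_coef f 2 = C_derive p (RtoC 0).
Proof.
  intros H. unfold taylor_coef.
  rewrite (disk_factor_C_derive_2 f p _ H Cmod_0_lt_1).
  replace (INR (fact 2)) with 2 by (simpl; ring). field.
Qed.

Lemma disk_factor_taylor_3 (f p : C -> C) :
  disk_factor f p -> taylor_coef f 3 = (C_derive (C_derive p) (RtoC 0) / RtoC 2)%C.
Proof.
  intros H. unfold taylor_coef.
  change (C_derive_n f 3) with (C_derive (C_derive_n f 2)).
  rewrite (is_C_derive_unique _ _ _ (disk_factor_derive_3 f p H)).
  replace (INR (fact 3)) with (2 * 3) by (simpl; ring).
  rewrite RtoC_mult. field.
Qed.

Lemma disk_factor_quot_id (f p : C -> C) (z : C) :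
  disk_factor f p -> Cmod z < 1 -> quot_id f z = p z.
Proof.
  intros (_ & H1 & E) Hz. unfold quot_id.
  destruct (Ceq_dec z (RtoC 0)) as [->|Hn]; [now rewrite H1|].
  rewrite E by exact Hz. field. exact Hn.
Qed.

Lemma disk_factor_star_quot (f p : C -> C) (z : C) :
  disk_factor f p -> Cmod z < 1 -> p z <> RtoC 0 ->
  star_quot f z = (C_derive f z / p z)%C.
Proof.
  intros H Hz Hpz. unfold star_quot.
  destruct (Ceq_dec z (RtoC 0)) as [->|Hn].
  - rewrite (disk_factor_C_derive f p) by auto.
    destruct H as (_ & H1 & _). rewrite H1. field.
  - destruct H as (_ & _ & E). rewrite E by exact Hz. field. auto.
Qed.

Lemma disk_factor_nonzero (f p : C -> C) :
  disk_factor f p ->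
  (nonzero_off_origin f <-> forall z, Cmod z < 1 -> p z <> RtoC 0).
Proof.
  intros (_ & H1 & E). split.
  - intros H z Hz Hpz. destruct (Ceq_dec z (RtoC 0)) as [->|Hn].
    + rewrite H1 in Hpz. now apply C1_nz.
    + apply (H z Hz Hn). rewrite E by exact Hz. rewrite Hpz. ring.
  - intros H z Hz Hn. rewrite E by exact Hz. now apply Cmult_neq_0; [|apply H].
Qed.

Lemma Re_Cinv (c : C) : Re (/ c)%C = Re c / (Re c * Re c + Im c * Im c).
Proof. unfold Re, Im; simpl. now rewrite !Rmult_1_r. Qed.

(** The map [omega |-> 1 / (1 - omega)] takes the unit disk to the half plane [Re > 1 / 2] and
    the complement of the disk to the complementary half plane. *)
Lemma Re_inv_one_minus (omega : C) :
  omega <> RtoC 1 ->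
  Re (/ (RtoC 1 - omega))%C - 1 / 2 =
  (1 - Cmod omega * Cmod omega) / (2 * (Cmod (RtoC 1 - omega) * Cmod (RtoC 1 - omega))).
Proof.
  intros Hn. assert (Hp : 0 < Cmod (RtoC 1 - omega)).
  { apply Cmod_gt_0. intros E. apply Hn. symmetry. now apply Ceq_minus. }
  rewrite Re_Cinv.
  assert (S1 := Cmod_sqr (RtoC 1 - omega)%C). assert (S2 := Cmod_sqr omega).
  rewrite <- S1.
  assert (S3 : Cmod (RtoC 1 - omega) * Cmod (RtoC 1 - omega)
     = 1 - 2 * Re omega + Cmod omega * Cmod omega).
  { rewrite S1, S2. unfold Re, Im; simpl. ring. }
  replace (Re (RtoC 1 - omega)%C) with (1 - Re omega) by (unfold Re; simpl; ring).
  replace (Cmod omega * Cmod omega)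
    with (Cmod (RtoC 1 - omega) * Cmod (RtoC 1 - omega) - 1 + 2 * Re omega) by lra.
  field. lra.
Qed.

Lemma Re_inv_one_minus_gt (omega : C) :
  Cmod omega < 1 -> Re (/ (RtoC 1 - omega))%C > 1 / 2.
Proof.
  intros H. assert (P := Cmod_ge_0 omega).
  assert (Hn : omega <> RtoC 1) by (intros ->; rewrite Cmod_1 in H; lra).
  assert (E := Re_inv_one_minus omega Hn).
  assert (Hp : 0 < Cmod (RtoC 1 - omega)).
  { apply Cmod_gt_0. intros E'. apply Hn. symmetry. now apply Ceq_minus. }
  assert (0 < (1 - Cmod omega * Cmod omega) /
     (2 * (Cmod (RtoC 1 - omega) * Cmod (RtoC 1 - omega)))).
  { apply Rdiv_lt_0_compat; nra. }
  lra.
Qed.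

Lemma Re_inv_one_minus_le (omega : C) :
  1 <= Cmod omega -> omega <> RtoC 1 -> Re (/ (RtoC 1 - omega))%C <= 1 / 2.
Proof.
  intros H Hn. assert (E := Re_inv_one_minus omega Hn).
  assert (Hp : 0 < Cmod (RtoC 1 - omega)).
  { apply Cmod_gt_0. intros E'. apply Hn. symmetry. now apply Ceq_minus. }
  assert (0 <= (Cmod omega * Cmod omega - 1) /
     (2 * (Cmod (RtoC 1 - omega) * Cmod (RtoC 1 - omega)))).
  { apply Rdiv_le_0_compat; nra. }
  unfold Rdiv in *. lra.
Qed.

Lemma Re_M0_expression (f : C -> C) (beta : R) (z : C) :
  Re (Cplus (Cmult (RtoC beta) (star_quot f z))
            (Cmult (RtoC (1 - beta)) (convex_quot f z))) =
  beta * Re (star_quot f z) + (1 - beta) * Re (convex_quot f z).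
Proof. now rewrite re_plus, !re_scal_l. Qed.

(** * The inclusions *)

(** Let [p = f / z = 1 / (1 - omega)]. If [|omega| < 1] on the disk, then
    [Re p > 1 / 2]. Otherwise, at a point as in Jack's lemma,
    [z f' / f = 1 + z p' / p = 1 + k (p - 1)] where [Re p <= 1 / 2] and [k >= 1], so that
    the real part is at most [1 / 2], against the hypothesis. *)
Theorem starlike_half_included_G : Included _ starlike_half class_G.
Proof.
  intros f (HA & Hnz & Hre). split; [exact HA|].
  destruct (class_A_disk_factor f HA) as [p H].
  assert (Hpnz := proj1 (disk_factor_nonzero f p H) Hnz).
  assert (Hp := proj1 H). assert (H1 := proj1 (proj2 H)).
  pose (omega := fun z => (RtoC 1 - / p z)%C).
  assert (Dw : forall z, Cmod z < 1 ->
            is_Cderive omega z (C_derive p z / (p z * p z))%C).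
  { intros z Hz. eapply is_Cderive_eq.
    - apply is_Cderive_minus; [apply is_Cderive_const|].
      apply is_Cderive_inv; [now apply holomorphic_is_Cderive|now apply Hpnz].
    - cbv beta. field. now apply Hpnz. }
  assert (Hw0 : omega (RtoC 0) = RtoC 0) by (unfold omega; rewrite H1; field).
  assert (Hinv : forall z, Cmod z < 1 -> (/ (RtoC 1 - omega z) = p z)%C).
  { intros z Hz. unfold omega. field. split; [now apply Hpnz|].
    replace (p z - (p z - RtoC 1))%C with (RtoC 1) by ring. apply C1_nz. }
  assert (Hw : forall z, Cmod z < 1 -> Cmod (omega z) < 1).
  { intros z Hz. apply Rnot_le_lt. intros Hle.
    destruct (jack omega z) as (z0 & k & Hz0 & Hw1 & Hk & E); auto.
    { intros w Hw. eexists. now apply Dw. }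
    assert (Hz0' : Cmod z0 < 1) by lra.
    rewrite (is_C_derive_unique _ _ _ (Dw z0 Hz0')) in E.
    assert (Hpz := Hpnz z0 Hz0').
    assert (Hne : omega z0 <> RtoC 1).
    { unfold omega. intros E'. apply C1_nz. 
      replace (RtoC 1) with (p z0 * (RtoC 1 - (RtoC 1 - / p z0)))%C by (field; auto).
      rewrite E'. ring. }
    assert (Hle2 := Re_inv_one_minus_le _ Hw1 Hne). rewrite Hinv in Hle2 by exact Hz0'.
    specialize (Hre z0 Hz0').
    rewrite (disk_factor_star_quot f p) in Hre by auto.
    rewrite (disk_factor_C_derive f p) in Hre by auto.
    assert (Eg : ((p z0 + z0 * C_derive p z0) / p z0
       = RtoC 1 + RtoC k * (p z0 - RtoC 1))%C).
    { replace (RtoC k * (p z0 - RtoC 1))%C with (RtoC k * omega z0 * p z0)%C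
        by (unfold omega; field; auto).
      rewrite <- E. field. auto. }
    rewrite Eg, re_plus, re_scal_l, re_RtoC in Hre.
    unfold Cminus in Hre. rewrite re_plus, re_opp, re_RtoC in Hre. nra. }
  intros z Hz. rewrite (disk_factor_quot_id f p) by auto.
  assert (G := Re_inv_one_minus_gt _ (Hw z Hz)). rewrite Hinv in G by exact Hz. lra.
Qed.

(** The contradiction at a point as in Jack's lemma. Here [omega] and [h] are the values of
    [1 - f / (z f')] and [1 + z f'' / f'], and the equation is what Jack's lemma says of them.
    With [g = 1 / (1 - omega)] it reads [h = g + k (g - 1)], and [Re g <= 1 / 2]. *)
Lemma jack_point_estimate (omega h : C) (beta k : R) :
  0 <= beta <= 1 -> 1 <= k -> 1 <= Cmod omega ->
  (h * (RtoC 1 - omega) = RtoC 1 + RtoC k * omega)%C ->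
  omega <> RtoC 1 /\
  beta * Re (/ (RtoC 1 - omega))%C + (1 - beta) * Re h <= beta / 2.
Proof.
  intros Hb Hk Hw E.
  assert (Hne : omega <> RtoC 1).
  { intros ->. assert (E' : RtoC (1 + k) = RtoC 0).
    { rewrite RtoC_plus. replace (RtoC k) with (RtoC k * RtoC 1)%C by ring.
      rewrite <- E. ring. }
    apply RtoC_inj in E'. lra. }
  split; [exact Hne|].
  assert (Hg := Re_inv_one_minus_le omega Hw Hne).
  set (g := (/ (RtoC 1 - omega))%C) in *.
  assert (Hn : (RtoC 1 - omega)%C <> RtoC 0).
  { intros E'. apply Hne. symmetry. now apply Ceq_minus. }
  assert (Eh : h = (g + RtoC k * (g - RtoC 1))%C).
  { replace h with (h * (RtoC 1 - omega) * g)%C by (unfold g; field; auto).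
    rewrite E. unfold g. field. auto. }
  rewrite Eh, re_plus, re_scal_l. unfold Cminus. rewrite re_plus, re_opp, re_RtoC.
  assert (k * (Re g + - (1)) <= - (1 / 2)) by nra. nra.
Qed.

(** Let [beta < 1]. With [z f' / f = 1 / (1 - omega)], that is [omega = 1 - f / (z f')],
    the claim says [|omega| < 1]. This [omega] is holomorphic as soon as [f'] does not
    vanish, so the zeros of [f] need not be excluded beforehand: [omega = 1] would be
    the only trace of one, and [jack_point_estimate] rules it out. *)
Theorem M0_included_starlike_half (beta : R) :
  0 <= beta <= 1 -> Included _ (M0 beta) starlike_half.
Proof.
  intros Hb f (HA & Hnz & Hdnz & Hre).
  destruct (Req_dec beta 1) as [->|Hb1].
  { split; [exact HA|]. split; [apply Hnz; lra|]. intros z Hz.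
    specialize (Hre z Hz). rewrite Re_M0_expression in Hre. lra. }
  destruct (class_A_disk_factor f HA) as [p H].
  assert (Hp := proj1 H). assert (Hp1 := holomorphic_derive p Hp).
  specialize (Hdnz Hb1).
  pose (omega := fun z => (z * C_derive p z / C_derive f z)%C).
  assert (E1 : forall z, Cmod z < 1 ->
            ((RtoC 1 - omega z) * C_derive f z = p z)%C).
  { intros z Hz. unfold omega.
    replace (p z) with (C_derive f z - z * C_derive p z)%C
      by (rewrite (disk_factor_C_derive f p) by auto; ring).
    field. now apply Hdnz. }
  assert (Dw : forall z, Cmod z < 1 -> is_Cderive omega z
     (((C_derive p z + z * C_derive (C_derive p) z) * C_derive f z
       - z * C_derive p z * C_derive_n f 2 z) / (C_derive f z * C_derive f z))%C).
  { intros z Hz. eapply is_Cderive_eq.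
    - apply is_Cderive_div; [| |now apply Hdnz].
      + apply is_Cderive_mult; [apply is_Cderive_id|now apply holomorphic_is_Cderive].
      + apply holomorphic_is_Cderive; [apply holomorphic_derive, HA|exact Hz].
    - cbv beta. change (C_derive (C_derive f) z) with (C_derive_n f 2 z).
      field. now apply Hdnz. }
  assert (Hw : forall z, Cmod z < 1 -> Cmod (omega z) < 1).
  { intros z Hz. apply Rnot_le_lt. intros Hle.
    destruct (jack omega z) as (z0 & k & Hz0 & Hw1 & Hk & E); auto.
    { intros w Hw. eexists. now apply Dw. }
    { unfold omega. rewrite Cmult_0_l. unfold Cdiv. now rewrite Cmult_0_l. }
    assert (Hz0' : Cmod z0 < 1) by lra.
    rewrite (is_C_derive_unique _ _ _ (Dw z0 Hz0')) in E.
    specialize (Hre z0 Hz0'). specialize (E1 z0 Hz0').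
    assert (Hd := Hdnz z0 Hz0').
    destruct (jack_point_estimate (omega z0) (convex_quot f z0) beta k)
      as [Hne Hest]; auto.
    { rewrite <- E. unfold convex_quot, omega.
      rewrite (disk_factor_C_derive_2 f p) by auto.
      replace (C_derive p z0 + z0 * C_derive (C_derive p) z0)%C
        with (RtoC 2 * C_derive p z0 + z0 * C_derive (C_derive p) z0 - C_derive p z0)%C
        by ring.
      field. auto. }
    assert (Hn : (RtoC 1 - omega z0)%C <> RtoC 0).
    { intros E'. apply Hne. symmetry. now apply Ceq_minus. }
    assert (Hpz : p z0 <> RtoC 0) by (rewrite <- E1; now apply Cmult_neq_0).
    rewrite Re_M0_expression, (disk_factor_star_quot f p) in Hre by auto.
    rewrite <- E1 in Hre.
    replace (C_derive f z0 / ((RtoC 1 - omega z0) * C_derive f z0))%C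
      with (/ (RtoC 1 - omega z0))%C in Hre by (field; auto).
    lra. }
  assert (Hone : forall z, Cmod z < 1 -> (RtoC 1 - omega z)%C <> RtoC 0).
  { intros z Hz. apply Cminus_neq_0_Cmod. rewrite Cmod_1. now apply Hw. }
  assert (Hpnz : forall z, Cmod z < 1 -> p z <> RtoC 0).
  { intros z Hz. rewrite <- E1 by exact Hz. apply Cmult_neq_0; [now apply Hone|].
    now apply Hdnz. }
  split; [exact HA|]. split; [now apply (disk_factor_nonzero f p H)|].
  intros z Hz. rewrite (disk_factor_star_quot f p) by auto.
  rewrite <- E1 by exact Hz.
  replace (C_derive f z / ((RtoC 1 - omega z) * C_derive f z))%C
    with (/ (RtoC 1 - omega z))%C by (field; split; [now apply Hdnz|now apply Hone]).
  now apply Re_inv_one_minus_gt, Hw.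
Qed.

Lemma starlike_half_included_M0_1 : Included _ starlike_half (M0 1).
Proof.
  intros f (HA & Hnz & Hre). split; [exact HA|]. split; [auto|]. split; [lra|].
  intros z Hz. rewrite Re_M0_expression. specialize (Hre z Hz). lra.
Qed.

(** Once the starlike quotient is known to have real part above [1 / 2], the condition for [t]
    is a convex combination of the condition for [s] and of this bound. *)
Theorem M0_monotone (s t : R) :
  0 <= s -> s <= t -> t <= 1 -> Included _ (M0 s) (M0 t).
Proof.
  intros Hs Hst Ht f Hf.
  assert (Hstar := M0_included_starlike_half s ltac:(lra) f Hf).
  destruct (Req_dec s 1) as [Hs1|Hs1].
  { replace t with 1 by lra. now apply starlike_half_included_M0_1. }
  destruct Hf as (HA & _ & Hdnz & Hre). destruct Hstar as (_ & Hnz & Hre1).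
  split; [exact HA|]. split; [auto|]. split; [auto|]. intros z Hz.
  specialize (Hre z Hz). specialize (Hre1 z Hz). rewrite Re_M0_expression in *.
  set (X := Re (star_quot f z)) in *. set (Y := Re (convex_quot f z)) in *.
  apply Rmult_lt_reg_l with (1 - s); [lra|].
  replace ((1 - s) * (t * X + (1 - t) * Y))
    with ((1 - t) * (s * X + (1 - s) * Y) + (t - s) * X) by ring.
  destruct (Req_dec t 1) as [->|Ht1]; [nra|].
  assert ((1 - t) * (s / 2) < (1 - t) * (s * X + (1 - s) * Y))
    by (apply Rmult_lt_compat_l; lra).
  nra.
Qed.

Theorem M0_filtration :
  filtration_of_G (Finite 0) (Finite 1) (fun s : Rbar => M0 (real s)).
Proof.
  split; [simpl; lra|]. split.
  - intros [s| |] H1 H2; simpl in *; try contradiction.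
    intros f Hf. apply starlike_half_included_G.
    now apply (M0_included_starlike_half s).
  - intros [s| |] [t| |] H1 H2 H3; simpl in *; try contradiction.
    now apply M0_monotone.
Qed.

(** * The upper bound *)

Lemma Cmod_le_shift (u : C) (m : R) :
  0 < m -> - m / 2 <= Re u -> Cmod u <= Cmod (u + RtoC m).
Proof.
  intros Hm Hu. apply Cmod_le_iff.
  rewrite re_plus, im_plus, re_RtoC, im_RtoC. nra.
Qed.

(** Let [1 + z K] be the expression in the definition of the class and [m = 2 - beta]. Its real
    part exceeds [beta / 2] exactly when [z K / (z K + m)] maps the disk to itself, so
    [phi = K / (z K + m)] is bounded by [1]. Its value and derivative at [0] are the
    numbers [w1] and [w2], and solving for the Taylor coefficients of [f] gives [f_2 = w1]
    and [f_3 = (2 - beta) / (6 - 4 beta) w2 + w1^2]. *)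
Theorem M0_Phi_representation (beta : R) (f : C -> C) :
  0 <= beta <= 1 -> M0 beta f ->
  exists w1 w2 : C, Cmod w1 <= 1 /\ Cmod w2 <= 1 - Cmod w1 * Cmod w1 /\
    forall lambda, Phi f lambda =
      (RtoC ((2 - beta) / (6 - 4 * beta)) * w2 + (RtoC 1 - lambda) * (w1 * w1))%C.
Proof.
  intros Hb Hf.
  destruct (M0_included_starlike_half beta Hb f Hf) as (HA & Hnz & Hstar).
  destruct Hf as (_ & _ & Hdnz & Hre).
  destruct (class_A_disk_factor f HA) as [p H].
  assert (Hpnz := proj1 (disk_factor_nonzero f p H) Hnz).
  assert (Hp := proj1 H). assert (Hp1 := holomorphic_derive p Hp).
  assert (Hf1 := holomorphic_derive f (proj1 HA)).
  assert (Hf2 := holomorphic_derive _ Hf1).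
  assert (Hd : forall z, Cmod z < 1 -> C_derive f z <> RtoC 0).
  { intros z Hz E. specialize (Hstar z Hz).
    rewrite (disk_factor_star_quot f p), E in Hstar by auto.
    unfold Cdiv in Hstar. rewrite Cmult_0_l, re_RtoC in Hstar. lra. }
  set (m := 2 - beta).
  assert (Hm : RtoC m <> RtoC 0).
  { apply Cmod_gt_0. rewrite Cmod_R, Rabs_pos_eq; unfold m; lra. }
  pose (K := fun z => (RtoC beta * (C_derive p z / p z)
                       + RtoC (1 - beta) * (C_derive_n f 2 z / C_derive f z))%C).
  assert (DK : forall z, Cmod z < 1 -> is_Cderive K z
    (RtoC beta * ((C_derive (C_derive p) z * p z - C_derive p z * C_derive p z)
                  / (p z * p z))
     + RtoC (1 - beta) * ((C_derive (C_derive_n f 2) z * C_derive f z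
          - C_derive_n f 2 z * C_derive_n f 2 z) / (C_derive f z * C_derive f z)))%C).
  { intros z Hz. eapply is_Cderive_eq.
    - apply is_Cderive_plus; (apply is_Cderive_mult; [apply is_Cderive_const|]);
        apply is_Cderive_div; auto; now apply holomorphic_is_Cderive.
    - cbv beta. change (C_derive (C_derive f) z) with (C_derive_n f 2 z). ring. }
  assert (HK : forall z, Cmod z < 1 -> - m / 2 <= Re (z * K z)%C).
  { intros z Hz. specialize (Hre z Hz). unfold convex_quot in Hre.
    rewrite (disk_factor_star_quot f p) in Hre by auto.
    assert (Hdz := Hd z Hz). assert (Hpz := Hpnz z Hz).
    replace (C_derive f z / p z)%C with (RtoC 1 + z * (C_derive p z / p z))%C in Hre
      by (rewrite (disk_factor_C_derive f p) by auto; field; auto).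
    replace (RtoC beta * (RtoC 1 + z * (C_derive p z / p z))
       + RtoC (1 - beta) * (RtoC 1 + z * C_derive_n f 2 z / C_derive f z))%C
      with (RtoC 1 + z * K z)%C in Hre
      by (unfold K; rewrite RtoC_minus; field; auto).
    rewrite re_plus, re_RtoC in Hre. unfold m. lra. }
  assert (Hden : forall z, Cmod z < 1 -> (z * K z + RtoC m)%C <> RtoC 0).
  { intros z Hz E. specialize (HK z Hz).
    assert (E' : Re (z * K z + RtoC m)%C = 0) by now rewrite E.
    rewrite re_plus, re_RtoC in E'. unfold m in *. lra. }
  pose (phi := fun z => (K z / (z * K z + RtoC m))%C).
  assert (Dphi : forall z l, Cmod z < 1 -> is_Cderive K z l -> is_Cderive phi z
     ((l * (z * K z + RtoC m) - K z * (K z + z * l))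
       / ((z * K z + RtoC m) * (z * K z + RtoC m)))%C).
  { intros z l Hz Hl. eapply is_Cderive_eq.
    - apply is_Cderive_div; [exact Hl| |now apply Hden].
      apply is_Cderive_plus; [|apply is_Cderive_const].
      apply is_Cderive_mult; [apply is_Cderive_id|exact Hl].
    - cbv beta. f_equal. ring. }
  assert (Hphi : holomorphic_on_disk phi).
  { intros z Hz. eexists. exact (Dphi z _ Hz (DK z Hz)). }
  assert (Hbound : forall z, Cmod z < 1 -> Cmod (phi z) <= 1).
  { intros z Hz. apply schwarz; [exact Hphi| |exact Hz]. clear z Hz. intros z Hz.
    unfold phi. replace (z * (K z / (z * K z + RtoC m)))%C
      with (z * K z / (z * K z + RtoC m))%C by (field; now apply Hden).
    rewrite Cmod_div by now apply Hden.
    apply Rle_div_l; [now apply Cmod_gt_0, Hden|]. rewrite Rmult_1_l.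
    apply Cmod_le_shift; [unfold m; lra|now apply HK]. }
  assert (H0 := Cmod_0_lt_1). assert (HP := schwarz_pick_0 phi Hphi Hbound).
  exists (phi (RtoC 0)), (C_derive phi (RtoC 0)).
  split; [now apply Hbound|]. split; [exact HP|].
  assert (Ef1 := disk_factor_C_derive f p (RtoC 0) H H0).
  assert (Ef2 := disk_factor_C_derive_2 f p (RtoC 0) H H0).
  assert (Ef3 := is_C_derive_unique _ _ _ (disk_factor_derive_3 f p H)).
  assert (Ep := proj1 (proj2 H)).
  set (B := C_derive p (RtoC 0)) in *.
  set (G := C_derive (C_derive p) (RtoC 0)) in *.
  rewrite Ep in Ef1.
  replace (RtoC 1 + RtoC 0 * B)%C with (RtoC 1) in Ef1 by ring.
  replace (RtoC 2 * B + RtoC 0 * G)%C with (RtoC 2 * B)%C in Ef2 by ring.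
  assert (Em : RtoC m = (RtoC 2 - RtoC beta)%C) by (unfold m; apply RtoC_minus).
  assert (EK : K (RtoC 0) = (RtoC m * B)%C).
  { unfold K. rewrite Ef2, Ef1, Ep. fold B. rewrite Em, RtoC_minus. field. }
  assert (E1 : phi (RtoC 0) = B).
  { unfold phi. rewrite EK.
    replace (RtoC 0 * (RtoC m * B) + RtoC m)%C with (RtoC m) by ring.
    field. exact Hm. }
  assert (E2 := is_C_derive_unique _ _ _ (Dphi _ _ H0 (DK _ H0))).
  rewrite EK, Ef1, Ef2, Ef3, Ep in E2. fold B G in E2.
  intros lambda. unfold Phi.
  rewrite (disk_factor_taylor_2 f p H), (disk_factor_taylor_3 f p H). fold B G.
  rewrite E1, E2.
  assert (Hc : RtoC (6 - 4 * beta) <> RtoC 0).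
  { apply Cmod_gt_0. rewrite Cmod_R, Rabs_pos_eq; lra. }
  rewrite RtoC_div by lra. fold m.
  replace (RtoC 0 * (RtoC m * B) + RtoC m)%C with (RtoC m) by ring.
  assert (E6 : RtoC (6 - 4 * beta) = (RtoC 6 - RtoC 4 * RtoC beta)%C)
    by (rewrite RtoC_minus, RtoC_mult; reflexivity).
  assert (E4 : RtoC (1 - beta) = (RtoC 1 - RtoC beta)%C) by apply RtoC_minus.
  rewrite E4, E6, Em in *. field. auto.
Qed.

(** The representation bounds [|Phi|] by a convex combination, with weights [1 - |w1|^2]
    and [|w1|^2], of the two numbers under the maximum. *)
Theorem M0_Phi_upper_bound (beta : R) (f : C -> C) (lambda : C) :
  0 <= beta <= 1 -> M0 beta f ->
  Cmod (Phi f lambda) <=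
  Rmax ((2 - beta) / (6 - 4 * beta)) (Cmod (RtoC 1 - lambda)).
Proof.
  intros Hb Hf.
  destruct (M0_Phi_representation beta f Hb Hf) as (w1 & w2 & H1 & H2 & E).
  rewrite E. set (a := (2 - beta) / (6 - 4 * beta)).
  assert (Ha : 0 <= a) by (apply Rdiv_le_0_compat; lra).
  assert (M1 := Rmax_l a (Cmod (RtoC 1 - lambda))).
  assert (M2 := Rmax_r a (Cmod (RtoC 1 - lambda))).
  set (M := Rmax a (Cmod (RtoC 1 - lambda))) in *.
  eapply Rle_trans; [apply Cmod_triangle|].
  rewrite !Cmod_mult, Cmod_R, (Rabs_pos_eq a Ha).
  assert (P1 := Cmod_ge_0 w1). assert (P2 := Cmod_ge_0 w2).
  set (x := Cmod w1) in *.
  assert (0 <= x * x <= 1) by nra.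
  assert (a * Cmod w2 <= M * (1 - x * x)) by (apply Rmult_le_compat; lra).
  assert (Cmod (RtoC 1 - lambda) * (x * x) <= M * (x * x))
    by (apply Rmult_le_compat_r; lra).
  lra.
Qed.

(** * Sharpness and strictness *)

(** The polynomial [z + z^2] separates the classes, as its derivative vanishes at [- 1 / 2]. *)
Lemma starlike_half_neq_G : starlike_half <> class_G.
Proof.
  intros Heq. pose (p := fun z : C => (RtoC 1 + z)%C). pose (f := fun z => (z * p z)%C).
  assert (Dp : forall z, is_Cderive p z (RtoC 1)).
  { intros z. eapply is_Cderive_eq.
    - apply is_Cderive_plus; [apply is_Cderive_const|apply is_Cderive_id].
    - ring. }
  assert (H : disk_factor f p).
  { split; [intros z _; eexists; apply Dp|]. split; [unfold p; ring|reflexivity]. }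
  assert (HG : class_G f).
  { split; [now apply (disk_factor_class_A f p)|]. intros z Hz.
    rewrite (disk_factor_quot_id f p) by auto. unfold p.
    rewrite re_plus, re_RtoC. assert (B := re_le_Cmod z).
    assert (B' := Rle_abs (- Re z)). rewrite Rabs_Ropp in B'.
    unfold unit_disk in Hz. lra. }
  rewrite <- Heq in HG. destruct HG as (_ & _ & Hre).
  assert (Hz : Cmod (RtoC (- (1 / 2))) < 1)
    by (rewrite Cmod_R, Rabs_left; lra).
  specialize (Hre _ Hz).
  rewrite (disk_factor_star_quot f p), (disk_factor_C_derive f p) in Hre; auto.
  - rewrite (is_C_derive_unique _ _ _ (Dp _)) in Hre. unfold p in Hre.
    replace (RtoC 1 + RtoC (- (1 / 2)) + RtoC (- (1 / 2)) * RtoC 1)%C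
      with (RtoC 0) in Hre.
    + unfold Cdiv in Hre. rewrite Cmult_0_l, re_RtoC in Hre. lra.
    + rewrite Cmult_1_r, <- !RtoC_plus. f_equal. lra.
  - unfold p. rewrite <- RtoC_plus. apply Cmod_gt_0. rewrite Cmod_R, Rabs_pos_eq; lra.
Qed.

(** With [g = z f' / f] one has [1 + z f'' / f' = g + z g' / g], which turns the condition of
    the class into one on [g] alone. *)
Lemma M0_of_star_quot (beta : R) (f p g g' : C -> C) :
  disk_factor f p ->
  (forall z, Cmod z < 1 -> p z <> RtoC 0) ->
  (forall z, Cmod z < 1 -> g z <> RtoC 0) ->
  (forall z, Cmod z < 1 -> is_Cderive g z (g' z)) ->
  (forall z, Cmod z < 1 -> C_derive f z = (p z * g z)%C) ->
  (forall z, Cmod z < 1 ->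
     Re (g z + RtoC (1 - beta) * (z * g' z / g z))%C > beta / 2) ->
  M0 beta f.
Proof.
  intros H Hp Hg Dg Ef Hre.
  split; [now apply (disk_factor_class_A f p)|].
  split; [intros _; now apply (disk_factor_nonzero f p H)|].
  split; [intros _ z Hz; rewrite Ef by exact Hz; now apply Cmult_neq_0; [apply Hp|apply Hg]|].
  intros z Hz. specialize (Hre z Hz).
  assert (Hpz := Hp z Hz). assert (Hgz := Hg z Hz).
  assert (E2 : C_derive_n f 2 z = (C_derive p z * g z + p z * g' z)%C).
  { apply is_C_derive_unique.
    apply (is_Cderive_ext_disk (fun w => p w * g w)%C); [exact Hz| |].
    - intros w Hw. now rewrite Ef.
    - apply is_Cderive_mult; [|now apply Dg].
      apply holomorphic_is_Cderive; [apply H|exact Hz]. }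
  assert (Ez : (z * C_derive p z = p z * g z - p z)%C).
  { rewrite <- Ef, (disk_factor_C_derive f p) by auto. ring. }
  rewrite (disk_factor_star_quot f p) by auto. unfold convex_quot. rewrite E2, Ef by exact Hz.
  replace (z * (C_derive p z * g z + p z * g' z))%C
    with ((z * C_derive p z) * g z + z * p z * g' z)%C by ring.
  rewrite Ez.
  replace (RtoC beta * (p z * g z / p z) + RtoC (1 - beta) *
    (RtoC 1 + ((p z * g z - p z) * g z + z * p z * g' z) / (p z * g z)))%C
    with (g z + RtoC (1 - beta) * (z * g' z / g z))%C; [exact Hre|].
  rewrite RtoC_minus. field. auto.
Qed.

Lemma one_minus_neq_0 (u : C) : Cmod u < 1 -> (RtoC 1 - u)%C <> RtoC 0.
Proof. intros H. apply Cminus_neq_0_Cmod. now rewrite Cmod_1. Qed.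

(** The function [z / (1 - z)], for which [w1 = 1] and [w2 = 0]. *)
Theorem M0_extremal_first (beta : R) :
  0 <= beta <= 1 ->
  exists f, M0 beta f /\ forall lambda, Phi f lambda = (RtoC 1 - lambda)%C.
Proof.
  intros Hb.
  pose (p := fun z => (/ (RtoC 1 - z))%C).
  pose (p1 := fun z => (/ ((RtoC 1 - z) * (RtoC 1 - z)))%C).
  pose (p2 := fun z => (RtoC 2 / ((RtoC 1 - z) * (RtoC 1 - z) * (RtoC 1 - z)))%C).
  pose (f := fun z => (z * p z)%C).
  assert (D1 : forall z, is_Cderive (fun z => RtoC 1 - z)%C z (- RtoC 1)%C).
  { intros z. eapply is_Cderive_eq.
    - apply is_Cderive_minus; [apply is_Cderive_const|apply is_Cderive_id].
    - ring. }
  assert (Dp : forall z, Cmod z < 1 -> is_Cderive p z (p1 z)).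
  { intros z Hz. eapply is_Cderive_eq.
    - apply is_Cderive_inv; [apply D1|now apply one_minus_neq_0].
    - unfold p1. field. now apply one_minus_neq_0. }
  assert (Dp1 : forall z, Cmod z < 1 -> is_Cderive p1 z (p2 z)).
  { intros z Hz. assert (Hn := one_minus_neq_0 z Hz). eapply is_Cderive_eq.
    - apply is_Cderive_inv; [|now apply Cmult_neq_0].
      apply is_Cderive_mult; apply D1.
    - unfold p2. field. exact Hn. }
  assert (H : disk_factor f p).
  { split; [intros z Hz; eexists; now apply Dp|]. split; [unfold p; field|reflexivity].
     }
  assert (Hp1 : forall z, Cmod z < 1 -> C_derive p z = p1 z)
    by (intros z Hz; now apply is_C_derive_unique, Dp).
  assert (Hp2 : C_derive (C_derive p) (RtoC 0) = RtoC 2).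
  { apply is_C_derive_unique. eapply is_Cderive_eq.
    - apply (is_Cderive_ext_disk p1); [exact Cmod_0_lt_1| |apply Dp1, Cmod_0_lt_1].
      intros w Hw. now rewrite Hp1.
    - unfold p2. field. }
  exists f. split.
  - apply (M0_of_star_quot beta f p p p1); auto.
    + intros z Hz E. apply C1_nz. transitivity (p z * (RtoC 1 - z))%C.
      * unfold p. field. now apply one_minus_neq_0.
      * rewrite E. ring.
    + intros z Hz E. apply C1_nz. transitivity (p z * (RtoC 1 - z))%C.
      * unfold p. field. now apply one_minus_neq_0.
      * rewrite E. ring.
    + intros z Hz. rewrite (disk_factor_C_derive f p), Hp1 by auto.
      unfold p, p1. field. now apply one_minus_neq_0.
    + intros z Hz. assert (Hn := one_minus_neq_0 z Hz).
      replace (p z + RtoC (1 - beta) * (z * p1 z / p z))%C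
        with (/ (RtoC 1 - z) + RtoC (1 - beta) * (/ (RtoC 1 - z) - RtoC 1))%C
        by (unfold p, p1; field; auto).
      assert (G := Re_inv_one_minus_gt z Hz).
      rewrite re_plus, re_scal_l. unfold Cminus at 2.
      rewrite re_plus, re_opp, re_RtoC. nra.
  - intros lambda. unfold Phi.
    rewrite (disk_factor_taylor_2 f p H), (disk_factor_taylor_3 f p H), Hp2.
    rewrite Hp1 by exact Cmod_0_lt_1. unfold p1. field.
Qed.

(** Taylor coefficients of the solution [tau] of the equation in [tau_ode]; the parameter [g]
    stands for [1 - beta]. *)
Fixpoint tau_coef (g : R) (n : nat) : R :=
  match n with
  | O => (1 + g) / (1 + 2 * g)
  | S m => g * (2 * INR m + 1) / (1 + 2 * g * (INR m + 2)) * tau_coef g m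
  end.

Lemma tau_coef_pos (g : R) (n : nat) : 0 <= g -> 0 <= tau_coef g n.
Proof.
  intros Hg. induction n as [|n IH]; simpl.
  - apply Rdiv_le_0_compat; lra.
  - assert (P := pos_INR n). apply Rmult_le_pos; [|exact IH].
    apply Rdiv_le_0_compat; nra.
Qed.

Lemma tau_coef_rec (g : R) (n : nat) : 0 <= g ->
  (1 + 2 * g * (INR n + 2)) * tau_coef g (S n) = g * (2 * INR n + 1) * tau_coef g n.
Proof.
  intros Hg. simpl tau_coef. assert (P := pos_INR n). field. nra.
Qed.

(** The recurrence makes [(1 + g) tau_coef n] the difference of consecutive values of
    [(1 + 2 g (n + 1)) tau_coef n], so the sum telescopes. The bound keeps
    [1 - u tau(u)] away from zero in the disk. *)
Lemma tau_coef_rsum (g : R) (n : nat) : 0 <= g -> rsum (tau_coef g) n <= 1.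
Proof.
  intros Hg.
  assert (E : (1 + g) * rsum (tau_coef g) n
    = (1 + g) - (1 + 2 * g * (INR n + 1)) * tau_coef g n).
  { induction n as [|n IH].
    - simpl. field. lra.
    - assert (Hrec := tau_coef_rec g n Hg). rewrite S_INR.
      replace (INR n + 1 + 1) with (INR n + 2) by ring. rewrite Hrec.
      change (rsum (tau_coef g) (S n)) with (rsum (tau_coef g) n + tau_coef g n).
      rewrite Rmult_plus_distr_l, IH. ring. }
  assert (P := tau_coef_pos g n Hg). assert (Pn := pos_INR n).
  assert (0 <= (1 + 2 * g * (INR n + 1)) * tau_coef g n)
    by (apply Rmult_le_pos; nra).
  nra.
Qed.

Definition tau (g : R) : C -> C := psum (fun n => RtoC (tau_coef g n)).

Lemma tau_power_series (g : R) : 0 <= g ->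
  power_series (fun n => RtoC (tau_coef g n)) (tau g).
Proof.
  intros Hg. apply psum_power_series. intros r Hr. exists 1. intros n.
  rewrite Cmod_R, Rabs_pos_eq by now apply tau_coef_pos.
  assert (P := tau_coef_pos g n Hg).
  assert (B : tau_coef g n <= 1).
  { assert (B := tau_coef_rsum g (S n) Hg). simpl in B.
    assert (0 <= rsum (tau_coef g) n).
    { clear B P. induction n as [|n IH]; simpl; [lra|].
      generalize (tau_coef_pos g n Hg). lra. }
    lra. }
  assert (0 <= r ^ n <= 1).
  { split; [apply pow_le; lra|]. rewrite <- (pow1 n). apply pow_incr. lra. }
  nra.
Qed.

Lemma Cmod_tau_le (g : R) (u : C) : 0 <= g -> Cmod u < 1 -> Cmod (tau g u) <= 1.
Proof.
  intros Hg Hu. destruct (tau_power_series g Hg) as [_ Hs].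
  apply (sums_to_bound _ _ 1 (Hs u Hu)). intros n.
  eapply Rle_trans; [|apply (tau_coef_rsum g n Hg)].
  apply Cmod_csum_le. intros k.
  assert (P := tau_coef_pos g k Hg).
  rewrite Cmod_mult, Cmod_R, Cmod_pow, Rabs_pos_eq by exact P.
  assert (Pu := Cmod_ge_0 u).
  assert (0 <= Cmod u ^ k <= 1).
  { split; [apply pow_le; lra|]. rewrite <- (pow1 k). apply pow_incr. lra. }
  nra.
Qed.

(** Comparison of coefficients. For [T(u) = u tau(u)] this is, up to the factor [u], the
    equation [(1 - u) 2 g u T' + (1 + g u) T = (1 + g) u]. *)
Lemma tau_ode (g : R) (u : C) : 0 <= g -> Cmod u < 1 ->
  ((RtoC 1 - u) * (RtoC (2 * g) * (tau g u + u * C_derive (tau g) u))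
   + (RtoC 1 + RtoC g * u) * tau g u = RtoC (1 + g))%C.
Proof.
  intros Hg Hu. assert (Hps := tau_power_series g Hg).
  assert (Hps' := psum_power_series _ (coef_bounded_derive _ (proj1 Hps))).
  assert (D := power_series_derive _ _ _ u Hps Hps' Hu).
  rewrite (is_C_derive_unique _ _ _ D).
  set (t1 := psum (derive_coef (fun n => RtoC (tau_coef g n))) u).
  assert (S0 := proj2 Hps u Hu). assert (S1 := proj2 Hps' u Hu). fold t1 in S1.
  assert (S2 : sums_to (fun n => RtoC (INR n * tau_coef g n) * u ^ n)%C (u * t1)%C).
  { replace (u * t1)%C with (RtoC (INR 0 * tau_coef g 0) * u ^ 0 + u * t1)%C.
    - apply (sums_to_S (fun n => RtoC (INR n * tau_coef g n) * u ^ n)%C).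
      eapply sums_to_ext; [|apply sums_to_Cmult, S1]. intros n. cbv beta.
      unfold derive_coef. rewrite RtoC_mult, Cpow_S. ring.
    - change (INR 0) with 0. rewrite Rmult_0_l. ring. }
  assert (SL := sums_to_plus _ _ _ _ (sums_to_Cmult _ (RtoC (1 + 2 * g)) _ S0)
                  (sums_to_Cmult _ (RtoC (2 * g)) _ S2)).
  assert (SR := sums_to_Cmult _ u _ (sums_to_plus _ _ _ _ (sums_to_Cmult _ (RtoC g) _ S0)
                  (sums_to_Cmult _ (RtoC (2 * g)) _ S2))).
  cbv beta in SL, SR.
  match type of SL with sums_to ?v ?x =>
    match type of SR with sums_to ?w ?y =>
      assert (E : x = (v 0%nat + y)%C) end end.
  { eapply sums_to_unique; [exact SL|].
    match type of SL with sums_to ?v _ => apply (sums_to_S v) end.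
    eapply sums_to_ext; [|exact SR]. intros n. cbv beta.
    rewrite S_INR, Cpow_S.
    transitivity (RtoC (g * (2 * INR n + 1) * tau_coef g n) * (u * u ^ n))%C.
    - repeat rewrite ?RtoC_mult, ?RtoC_plus. ring.
    - rewrite <- tau_coef_rec by exact Hg.
      repeat rewrite ?RtoC_mult, ?RtoC_plus. ring. }
  cbv beta in E.
  assert (E0 : (RtoC (1 + 2 * g) * (RtoC (tau_coef g 0) * u ^ 0)
     + RtoC (2 * g) * (RtoC (INR 0 * tau_coef g 0) * u ^ 0))%C = RtoC (1 + g)).
  { simpl Cpow. rewrite !Cmult_1_r, <- !RtoC_mult, <- RtoC_plus. f_equal.
    simpl. field. lra. }
  rewrite E0 in E. apply Ceq_minus. apply Ceq_minus in E. rewrite <- E.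
  rewrite !RtoC_plus, !RtoC_mult. ring.
Qed.

(** The extremal function has [w1 = 0] and [w2 = 1], that is
    [g + (1 - beta) z g' / g = (1 + (1 - beta) z^2) / (1 - z^2)] for [g = z f' / f].
    This nonlinear equation becomes linear for [1 / g = 1 - T(z^2)]: by [tau_ode] it is
    solved by [T(u) = u tau(u)]. Then [f = z exp (L (z^2))], where [L] is the primitive of
    [tau / (2 (1 - T))], satisfies [z f' / f = g]. *)
Theorem M0_extremal_second (beta : R) :
  0 <= beta <= 1 ->
  exists f, M0 beta f /\
    forall lambda, Phi f lambda = RtoC ((2 - beta) / (6 - 4 * beta)).
Proof.
  intros Hb. set (g := 1 - beta). assert (Hg : 0 <= g) by (unfold g; lra).
  assert (Hps := tau_power_series g Hg).
  assert (Ht := power_series_holomorphic _ _ Hps).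
  assert (Ht0 := power_series_at_0 _ _ Hps). cbv beta in Ht0.
  set (t := tau g) in *.
  assert (HT : forall u, Cmod u < 1 -> Cmod (u * t u) < 1).
  { intros u Hu. rewrite Cmod_mult. assert (B := Cmod_tau_le g u Hg Hu). fold t in B.
    assert (P := Cmod_ge_0 u). assert (P' := Cmod_ge_0 (t u)). nra. }
  assert (Hn : forall u, Cmod u < 1 -> (RtoC 1 - u * t u)%C <> RtoC 0)
    by (intros u Hu; now apply one_minus_neq_0, HT).
  assert (Dt : forall u, Cmod u < 1 -> is_Cderive t u (C_derive t u))
    by (intros u Hu; now apply holomorphic_is_Cderive).
  assert (DT : forall u, Cmod u < 1 ->
     is_Cderive (fun u => RtoC 1 - u * t u)%C u (- (t u + u * C_derive t u))%C).
  { intros u Hu. eapply is_Cderive_eq.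
    - apply is_Cderive_minus; [apply is_Cderive_const|].
      apply is_Cderive_mult; [apply is_Cderive_id|now apply Dt].
    - cbv beta. ring. }
  destruct (holomorphic_primitive (fun u => t u / (RtoC 2 * (RtoC 1 - u * t u)))%C)
    as (L & HL0 & DL).
  { intros u Hu. eexists. apply is_Cderive_div; [now apply Dt| |].
    - apply is_Cderive_mult; [apply is_Cderive_const|now apply DT].
    - apply Cmult_neq_0; [|now apply Hn].
      apply Cmod_gt_0. rewrite Cmod_R, Rabs_pos_eq; lra. }
  assert (Hsq : forall z, Cmod z < 1 -> Cmod (z * z) < 1).
  { intros z Hz. rewrite Cmod_mult. assert (P := Cmod_ge_0 z). nra. }
  assert (Dsq : forall z, is_Cderive (fun z => z * z)%C z (RtoC 2 * z)%C).
  { intros z. eapply is_Cderive_eq.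
    - apply is_Cderive_mult; apply is_Cderive_id.
    - cbv beta. ring. }
  pose (p := fun z => Cexp (L (z * z)%C)).
  pose (k := fun z => (t (z * z) / (RtoC 1 - z * z * t (z * z)) * p z)%C).
  pose (gq := fun z => (/ (RtoC 1 - z * z * t (z * z)))%C).
  pose (gq' := fun z => (RtoC 2 * z * (t (z * z) + z * z * C_derive t (z * z))
      / ((RtoC 1 - z * z * t (z * z)) * (RtoC 1 - z * z * t (z * z))))%C).
  pose (f := fun z => (z * p z)%C).
  assert (Dp : forall z, Cmod z < 1 -> is_Cderive p z (z * k z)%C).
  { intros z Hz. assert (Hzz := Hsq z Hz). eapply is_Cderive_eq.
    - apply (is_Cderive_comp Cexp (fun z => L (z * z)%C)); [apply is_Cderive_Cexp|].
      apply (is_Cderive_comp L (fun z => (z * z)%C)); [apply DL, Hzz|apply Dsq].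
    - unfold k, p. field. now apply Hn. }
  assert (Dgq : forall z, Cmod z < 1 -> is_Cderive gq z (gq' z)).
  { intros z Hz. assert (Hzz := Hsq z Hz). eapply is_Cderive_eq.
    - apply (is_Cderive_inv (fun z => RtoC 1 - z * z * t (z * z))%C); [|now apply Hn].
      apply (is_Cderive_comp (fun u => RtoC 1 - u * t u)%C (fun z => (z * z)%C));
        [now apply DT|apply Dsq].
    - unfold gq'. field. now apply Hn. }
  assert (H : disk_factor f p).
  { split; [intros z Hz; eexists; now apply Dp|]. split; [|reflexivity].
    unfold p. replace (RtoC 0 * RtoC 0)%C with (RtoC 0) by ring.
    rewrite HL0. apply Cexp_0. }
  assert (Hp1 : forall z, Cmod z < 1 -> C_derive p z = (z * k z)%C)
    by (intros z Hz; now apply is_C_derive_unique, Dp).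
  assert (Hk0 : k (RtoC 0) = RtoC (tau_coef g 0)).
  { unfold k. rewrite (proj1 (proj2 H)).
    replace (RtoC 0 * RtoC 0)%C with (RtoC 0) by ring. rewrite Ht0. field. }
  assert (Hp2 : C_derive (C_derive p) (RtoC 0) = RtoC (tau_coef g 0)).
  { assert (H0 := Cmod_0_lt_1). assert (H00 := Hsq _ H0).
    apply is_C_derive_unique. eapply is_Cderive_eq.
    - apply (is_Cderive_ext_disk (fun z => z * k z)%C); [exact H0| |].
      + intros w Hw. now rewrite Hp1.
      + apply is_Cderive_mult; [apply is_Cderive_id|].
        apply is_Cderive_mult; [|now apply Dp].
        apply is_Cderive_mult; [|now apply Dgq].
        apply (is_Cderive_comp t (fun z => (z * z)%C)); [now apply Dt|apply Dsq].
    - cbv beta. rewrite Hk0. ring. }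
  exists f. split.
  - apply (M0_of_star_quot beta f p gq gq'); auto.
    + intros z Hz. apply Cexp_neq_0.
    + intros z Hz E. apply C1_nz.
      transitivity (gq z * (RtoC 1 - z * z * t (z * z)))%C.
      * unfold gq. field. now apply Hn, Hsq.
      * rewrite E. ring.
    + intros z Hz. rewrite (disk_factor_C_derive f p), Hp1 by auto.
      unfold gq, k. field. now apply Hn, Hsq.
    + intros z Hz. assert (Hzz := Hsq z Hz). assert (Hnz := Hn _ Hzz).
      assert (Ode := tau_ode g _ Hg Hzz). fold t in Ode.
      assert (H1u := one_minus_neq_0 _ Hzz).
      assert (Gr := Re_inv_one_minus_gt _ Hzz). fold g.
      set (u := (z * z)%C) in *.
      replace (gq z + RtoC g * (z * gq' z / gq z))%C
        with (RtoC (1 + g) * / (RtoC 1 - u) - RtoC g)%C.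
      { unfold Cminus. rewrite re_plus, re_opp, re_scal_l, re_RtoC.
        change (RtoC 1 + - u)%C with (RtoC 1 - u)%C. unfold g in *. nra. }
      transitivity ((RtoC 1 + RtoC (2 * g) * u * (t u + u * C_derive t u))
                     / (RtoC 1 - u * t u))%C.
      * assert (Key : ((RtoC 1 - u) * (RtoC 1 + RtoC (2 * g) * u * (t u + u * C_derive t u))
           = (RtoC 1 + RtoC g * u) * (RtoC 1 - u * t u))%C).
        { apply Ceq_minus. transitivity (u * (RtoC (1 + g) - RtoC (1 + g)))%C; [|ring].
          rewrite <- Ode at 1. rewrite RtoC_plus. ring. }
        replace (RtoC 1 + RtoC (2 * g) * u * (t u + u * C_derive t u))%C
          with ((RtoC 1 + RtoC g * u) * (RtoC 1 - u * t u) / (RtoC 1 - u))%C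
          by (rewrite <- Key; field; auto).
        rewrite RtoC_plus. field. auto.
      * unfold gq, gq'. fold u. rewrite RtoC_mult.
        replace (z * (RtoC 2 * z * (t u + u * C_derive t u)
           / ((RtoC 1 - u * t u) * (RtoC 1 - u * t u))))%C
          with (RtoC 2 * u * (t u + u * C_derive t u)
           / ((RtoC 1 - u * t u) * (RtoC 1 - u * t u)))%C by (unfold u; field; auto).
        field. auto.
  - intros lambda. unfold Phi.
    rewrite (disk_factor_taylor_2 f p H), (disk_factor_taylor_3 f p H), Hp2.
    rewrite Hp1 by exact Cmod_0_lt_1.
    replace (RtoC ((2 - beta) / (6 - 4 * beta))) with (RtoC (tau_coef g 0) / RtoC 2)%C.
    + field.
    + rewrite <- RtoC_div by lra. f_equal. simpl. unfold g. field. lra.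
Qed.

Theorem theorem3p2 :
  filtration_of_G (Finite 0) (Finite 1) (fun s : Rbar => M0 (real s)) /\
  Same_set _ (M0 1) starlike_half /\
  Strict_Included _ starlike_half class_G /\
  (forall beta : R, (0 <= beta <= 1)%R ->
   forall lambda : C,
     is_lub (fun r : R => exists f : C -> C, M0 beta f /\ r = Cmod (Phi f lambda))
            (Rmax ((2 - beta) / (6 - 4 * beta))
                  (Cmod (Cminus (RtoC 1) lambda)))).
Proof.
  split; [exact M0_filtration|]. split; [|split].
  - split; [apply M0_included_starlike_half; lra|exact starlike_half_included_M0_1].
  - split; [exact starlike_half_included_G|exact starlike_half_neq_G].
  - intros beta Hb lambda. split.
    + intros r (f & Hf & ->). now apply M0_Phi_upper_bound.
    + intros b Hub. apply Rmax_lub.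
      * destruct (M0_extremal_second beta Hb) as (f & Hf & E).
        apply Hub. exists f. split; [exact Hf|]. rewrite E, Cmod_R, Rabs_pos_eq; auto.
        apply Rdiv_le_0_compat; lra.
      * destruct (M0_extremal_first beta Hb) as (f & Hf & E).
        apply Hub. exists f. split; [exact Hf|]. now rewrite E.
Qed.
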